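(* Let $\lambda=(\lambda_1,\dots,\lambda_l)$ be a partition with $l$ parts and $\alpha=(\alpha_1,\dots,\alpha_l)$ a weak composition such that $\lambda'\setminus\alpha'$ is a restricted shape (see context). Set $\alpha_{l+1}=\lambda_{l+1}=0$, $$j=\min(\{i\mid \alpha_i>0,\ \alpha_i\ge\alpha_{i+1}\}\cup\{l+1\}),\qquad j'=\max(\{i\mid\alpha_i<\lambda_i\}\cup\{0\}).$$ Suppose: (i) $\alpha$ is of the form $$(0,\dots,0,1,2,\dots,a,a,a+1,a+2,\dots,\alpha_{j'},\lambda_{j'+1},\lambda_{j'+2},\dots)\quad\text{or}\quad(0,\dots,0,1,2,\dots,\alpha_{j'},\lambda_{j'+1},\lambda_{j'+2},\dots),$$ where $\alpha_{j'}\ge\alpha_{j'+1}-1=\lambda_{j'+1}-1$ (no condition if $j'=0$), the initial run of $0$'s may be empty (in which case the run of consecutive integers written $1,2,\dots$ may start at any positive integer), and for the first form $j<j'$ and $j$ is the position of the first $a$, while for the second form $j$ is $j'$ or $j'+1$; (ii) $R$ is an RSST of shape $\lambda'\setminus\alpha'$ with entries $r_1=R_{\alpha_1+1,1},\dots,r_{j'}=R_{\alpha_{j'}+1,j'}$ along its northern border; (iii) $\mathsf{v}\mathsf{w}$ is a square respecting reading word of $R$ such that $\mathsf{w}$ is a subsequence of $r_{j+1}\cdots r_{j'}$ (as letters attached to the corresponding cells of $R$) which contains $r_{j+1}$ if $r_{j+1}>r_j+1$ (in particular $\mathsf{w}$ is empty if $j\ge j'$); (iv) $\mathbf{n}=(n_1,\dots,n_l)$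 is a tuple of integers with $0\le n_1\le n_2\le\cdots\le n_l$; (v) $n_c=r_c-1$ for $c\in[j']$, with the exception that $n_j$ may be $<r_j-1$ if $\mathsf{w}$ is empty or $\mathsf{w}_1\ne r_j+1$, where $\mathsf{w}_1$ is the first letter of $\mathsf w$. Then in the algebra $\mathcal{U}/I_3^{\mathrm{Lam}}$, $$\mathsf{v}\,J_\alpha^{\mathbf{n}}(j;\mathsf{w})=\sum_{\substack{T\in\mathrm{RSST}_{\lambda'},\ T_{\lambda'\setminus\alpha'}=R\\ T_{\alpha'}\in\mathrm{Tab}_{\alpha'}^{\mathbf{n}}}}\mathrm{sqread}(T).$$
   Context: **Algebra.** Let $\mathbf{A}=\mathbb{Q}[\hat q,\hat q^{-1}]$ and $q=\hat q^{-2}$. $\mathcal{U}$ is the free associative $\mathbf{A}$-algebra on noncommuting variables $u_i$, $i\in\mathbb{Z}$; monomials are identified with words in the alphabet $\mathbb{Z}$ (the letter $n$ stands for $u_n$). $\mathcal{U}/I_3^{\mathrm{Lam}}$ is the quotient of $\mathcal U$ by the relations: $u_i^2=0$, $u_{i+3}u_iu_{i+3}=0$, $u_iu_{i+3}u_i=0$ ($i\in\mathbb{Z}$); $u_iu_j=u_ju_i$ for $|i-j|>3$; $u_iu_j=q^{-1}u_ju_i$ for $0<j-i<3$. **Flagged Schur functions.** $[n]=\{1,\dots,n\}$, $[0]=\emptyset$. For $S\subseteq\mathbb{Z}$ and $d\ge1$, $e_d(S)=\sum u_{i_1}\cdots u_{i_d}$ over $i_1>\cdots>i_d$ in $S$;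 $e_0(S)=1$, $e_d(S)=0$ for $d<0$. For $\mathbf{n}=(n_1,\dots,n_l)$, $J_\alpha^{\mathbf n}(j;\mathsf{w})$ is obtained from $$J_\alpha^{\mathbf n}=\sum_{\pi\in\mathcal{S}_l}\mathrm{sgn}(\pi)\,e_{\alpha_1+\pi(1)-1}([n_1])\,e_{\alpha_2+\pi(2)-2}([n_2])\cdots e_{\alpha_l+\pi(l)-l}([n_l])$$ by inserting the word $\mathsf{w}$ immediately after the $j$-th factor $e_{\alpha_j+\pi(j)-j}([n_j])$ in every term; when $\mathsf{w}$ is empty it is just $J_\alpha^{\mathbf n}$. **Shapes.** Cells $(r,c)\in\mathbb{Z}_{\ge1}\times\mathbb{Z}_{\ge1}$: row $r$ numbered from north to south, column $c$ from west to east; diagonal (content) $c-r$. $(r,c)\le_{\searrow}(r',c')$ iff $r\le r'$, $c\le c'$; $(r,c)\le_{\nearrow}(r',c')$ iff $r\ge r'$, $c\le c'$. A restricted shape is a lower order ideal of a partition diagram for $\le_{\nearrow}$. For a weak composition $\alpha=(\alpha_1,\dots,\alpha_l)$, $\alpha'$ denotes the diagram $\{(r,c): c\in[l],\ r\in[\alpha_c]\}$; for a partition $\lambda$, $\lambda'$ (the diagram of the conjugate partition) is the case $\alpha=\lambda$. ''$\lambda'\setminus\alpha'$ is a restricted shape'' means that for some $j'\in\{0,\dots,l\}$: $0\le\alpha_1\le\cdots\le\alpha_{j'}$, $\alpha_i<\lambda_i$ for $i\le j'$, and $\alpha_i=\lambda_i$ for $i>j'$; it is the set difference of diagrams. **Tableaux.**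 A tableau of shape $\theta$ is a filling of the cells of $\theta$ with integers. $T_S$ is the restriction of $T$ to a set $S$ of cells. An RSST is a tableau of restricted shape whose entries strictly increase from north to south in columns and from west to east in rows, and satisfy $R_z+3\le R_{z'}$ whenever $z<_{\searrow}z'$ and $z,z'$ lie in different rows and different columns. $\mathrm{RSST}_{\lambda'}$ is the set of RSST of shape $\lambda'$. $\mathrm{Tab}_\theta^{\mathbf{n}}$ is the set of tableaux of shape $\theta$ whose entries in column $c$ lie in $[n_c]$. **Arrows.** For each pair of cells $(r,c),(r+1,c+1)$ of an RSST $R$ with $R_{r+1,c+1}=R_{r,c}+3$ (then $(r+1,c)$ is also a cell) there is one arrow: if $R_{r+1,c}=R_{r,c}+2$, a $\nwarrow$ arrow with tail $(r+1,c+1)$ and head $(r,c)$; if $R_{r+1,c}=R_{r,c}+1$, a $\searrow$ arrow with tail $(r,c)$ and head $(r+1,c+1)$. **Reading words.** A reading word of $R$ lists the entries of all cells of $R$ (each letter being attached to its cell) in an order such that $z$ comes before $z'$ whenever $z<_{\nearrow}z'$; it is square respecting if for each arrow the tail comes before the head. $\mathrm{sqread}(R)=\mathsf{w}^1\cdots\mathsf{w}^t$ where $D^1,\dots,D^t$ are the diagonals of $R$ from southwest to northeast and $\mathsf{w}^i$ is obtained by reading, in the $\nwarrow$ direction, the entries of $D^i$ that are tails of $\nwarrow$ arrows, followed by the remaining entries of $D^i$ read in the $\searrow$ direction. *)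

(* Defs.v *)
From HB Require Import structures.
From mathcomp Require Import all_boot all_order all_fingroup all_algebra.
From mathcomp Require Import finmap boolp.
From mathcomp Require Import monalg.

Set Implicit Arguments.
Unset Strict Implicit.
Unset Printing Implicit Defensive.

Import Order.TTheory GRing.Theory Num.Theory.
Local Open Scope fset_scope.
Local Open Scope fmap_scope.
Local Open Scope ring_scope.

Local Notation "x %:F" := (tofrac x) : ring_scope.

(* Laurent polynomials over the rationals in one variable qh, realised as the  *)
(* subring of rat(X) of the fractions p / X^n; qh is X.                        *)
Definition laurent_pred (x : {fraction {poly rat}}) : bool :=
  `[< exists (p : {poly rat}) (n : nat), x = p%:F / 'X%:F ^+ n >].

Fact polyXF_neq0 n : ('X : {poly rat})%:F ^+ n != 0.
Proof. by rewrite expf_neq0 // tofrac_eq0 polyX_eq0. Qed.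

Fact laurent_subring_closed : subring_closed laurent_pred.
Proof.
split; rewrite /laurent_pred.
- by apply/asboolP; exists 1, 0%N; rewrite tofrac1 expr0 divr1.
- move=> _ _ /asboolP[p [m ->]] /asboolP[r [n ->]]; apply/asboolP.
  exists (p * 'X ^+ n - r * 'X ^+ m), (m + n)%N.
  by rewrite tofracB !tofracM !tofracXn exprD -mulNr addf_div ?polyXF_neq0 ?mulNr.
- move=> _ _ /asboolP[p [m ->]] /asboolP[r [n ->]]; apply/asboolP.
  by exists (p * r), (m + n)%N; rewrite tofracM exprD mulf_div.
Qed.

HB.instance Definition _ :=
  GRing.isSubringClosed.Build {fraction {poly rat}} laurent_pred
    laurent_subring_closed.

Record laurent := Laurent {
  laurent_val :> {fraction {poly rat}};
  _ : laurent_pred laurent_val }.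

HB.instance Definition _ := [isSub for laurent_val].
HB.instance Definition _ := [Choice of laurent by <:].
HB.instance Definition _ := [SubChoice_isSubComNzRing of laurent by <:].

Fact laurent_qh_subproof : laurent_pred 'X%:F.
Proof. by apply/asboolP; exists 'X, 0%N; rewrite expr0 divr1. Qed.

Fact laurent_qhV_subproof : laurent_pred 'X%:F^-1.
Proof. by apply/asboolP; exists 1, 1%N; rewrite tofrac1 mul1r expr1. Qed.

Definition qh : laurent := Laurent laurent_qh_subproof.
Definition qhV : laurent := Laurent laurent_qhV_subproof.

Definition q : laurent := qhV ^+ 2.
Definition qV : laurent := qh ^+ 2.

Lemma qh_qhV : qh * qhV = 1.
Proof. by apply: val_inj; rewrite /= divff // (polyXF_neq0 1). Qed.

Lemma q_qV : q * qV = 1.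
Proof. by rewrite /q /qV -exprMn mulrC qh_qhV expr1n. Qed.

(* The free associative algebra on letters indexed by the integers: the        *)
(* algebra of the free monoid of words.                                        *)
Definition U := {malg laurent[{fmonom int}]}.

Definition word (s : seq int) : U := << FMonom s >>.

Lemma word_nil : word [::] = 1.
Proof. by rewrite /word -fmoneE. Qed.

Lemma word_cat s t : word (s ++ t) = word s * word t.
Proof. by rewrite /word malgM_def fgmulUU mulr1 [in RHS]/mmul /= fmmulE. Qed.

Definition u (i : int) : U := word [:: i].

Inductive lam3_rel : U -> Prop :=
| lam3_sq i : lam3_rel (u i * u i)
| lam3_hlh i : lam3_rel (u (i + 3) * u i * u (i + 3))
| lam3_lhl i : lam3_rel (u i * u (i + 3) * u i)
| lam3_far i j : 3 < `|i - j| -> lam3_rel (u i * u j - u j * u i)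
| lam3_near i j : 0 < j - i < 3 -> lam3_rel (u i * u j - qV *: (u j * u i)).

Inductive two_sided_ideal (G : U -> Prop) : U -> Prop :=
| ideal_gen x : G x -> two_sided_ideal G x
| ideal_zero : two_sided_ideal G 0
| ideal_add x y :
    two_sided_ideal G x -> two_sided_ideal G y -> two_sided_ideal G (x + y)
| ideal_lmul a x : two_sided_ideal G x -> two_sided_ideal G (a * x)
| ideal_rmul x a : two_sided_ideal G x -> two_sided_ideal G (x * a).

(* Equality in the quotient of U by the ideal generated by the relations.      *)
Definition eq_lam3 (x y : U) : Prop := two_sided_ideal lam3_rel (x - y).

Definition interval (n : nat) : {fset int} :=
  [fset i%:Z | i in iota 1 n].

(* Decreasing sequences in S of length d are the decreasing rearrangements of  *)
(* the d-element subsets of S.                                                 *)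
Definition e (d : int) (S : {fset int}) : U :=
  \sum_(A <- fpowerset S | #|` A|%:Z == d) word (sort (fun x y => y <= x) A).

(* The indices i of the product are 0-based, so i < j selects the first j      *)
(* factors.                                                                    *)
Definition J (l : nat) (al n : l.-tuple nat) (j : nat) (w : seq int) : U :=
  let factor (s : 'S_l) (i : 'I_l) :=
    e ((tnth al i)%:Z + (s i)%:Z - i%:Z) (interval (tnth n i)) in
  \sum_(s : 'S_l) (-1) ^+ odd_perm s *
    ((\prod_(i < l | (i < j)%N) factor s i) * word w *
     (\prod_(i < l | (j <= i)%N) factor s i)).

(* Cells (row, column), rows and columns numbered from 1.                      *)
Definition cell := (nat * nat)%type.

Definition content (z : cell) : int := z.2%:Z - z.1%:Z.

Definition lt_se (z z' : cell) : bool :=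
  [&& z != z', (z.1 <= z'.1)%N & (z.2 <= z'.2)%N].

Definition lt_ne (z z' : cell) : bool :=
  [&& z != z', (z'.1 <= z.1)%N & (z.2 <= z'.2)%N].

(* The i-th part, parts being numbered from 1; it is 0 beyond the last one.    *)
Definition part (s : seq nat) (i : nat) : nat := nth 0%N s i.-1.

(* The diagram whose c-th column consists of the rows 1, ..., part s c.        *)
Definition diagram (s : seq nat) : {fset cell} :=
  [fset z in [seq (r, c) | c <- iota 1 (size s), r <- iota 1 (part s c)]].

Lemma in_diagram s (z : cell) :
  (z \in diagram s) = (0 < z.2 <= size s)%N && (0 < z.1 <= part s z.2)%N.
Proof.
case: z => r c; rewrite inE /=; apply/allpairsPdep/idP => /=.
  by case=> [c' [r' [+ + [-> ->]]]]; rewrite !mem_iota !add1n !ltnS => -> ->.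
case/andP=> hc hr; exists c, r.
by rewrite !mem_iota !add1n !ltnS hc hr.
Qed.

Definition is_partition (s : seq nat) : bool :=
  sorted geq s && all (ltn 0) s.

(* The difference of the diagrams of lam and al is a restricted shape, i.e. a  *)
(* lower order ideal, for the order underlying lt_ne, of a partition diagram.  *)
Definition restricted_difference (lam al : seq nat) : Prop :=
  exists j' : nat,
    [/\ (j' <= size lam)%N,
        sorted leq (take j' al),
        forall i, (0 < i <= j')%N -> (part al i < part lam i)%N
      & forall i, (j' < i <= size lam)%N -> part al i = part lam i].

Definition tableau := {fmap cell -> int}.

Definition entry (T : tableau) (z : cell) : int := odflt 0 T.[? z].

(* Only the conditions on the filling: that the shape is restricted is stated  *)
(* where the shape is introduced.                                              *)
Definition is_rsst (theta : {fset cell}) (T : tableau) : Prop :=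
  domf T = theta /\
  {in theta &, forall z z' : cell,
    [/\ z.2 = z'.2 -> (z.1 < z'.1)%N -> entry T z < entry T z',
        z.1 = z'.1 -> (z.2 < z'.2)%N -> entry T z < entry T z'
      & lt_se z z' -> z.1 <> z'.1 -> z.2 <> z'.2 ->
          entry T z + 3 <= entry T z']}.

Definition is_tab (theta : {fset cell}) (n : seq nat) (T : tableau) : Prop :=
  domf T = theta /\
  {in theta, forall z : cell, entry T z \in interval (part n z.2)}.

Fixpoint fillings (n : seq nat) (zs : seq cell) : seq tableau :=
  if zs is z :: zs' then
    [seq T.[z <- i%:Z] | T <- fillings n zs', i <- iota 1 (part n z.2)]
  else [:: [fmap]].

Definition rsst_extending (lam al n : seq nat) (R : tableau) : {fset tableau} :=
  let candidates : seq tableau :=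
    [seq catf P R | P <- fillings n (enum_fset (diagram al))] in
  [fset T : tableau in candidates |
    `[< [/\ is_rsst (diagram lam) T,
            T.[& diagram lam `\` diagram al] = R
          & is_tab (diagram al) n T.[& diagram al]] >]].

Lemma entry_set (T : tableau) z x z' :
  entry T.[z <- x] z' = if z' == z then x else entry T z'.
Proof. by rewrite /entry fnd_set; case: eqP. Qed.

Lemma entry_restrict (T : tableau) (A : {fset cell}) z :
  entry T.[& A] z = if z \in A then entry T z else 0.
Proof. by rewrite /entry fnd_restrict; case: ifP. Qed.

Lemma tableauP (T T' : tableau) :
  domf T = domf T' -> {in domf T, entry T =1 entry T'} -> T = T'.
Proof.
move=> eqd eqe; apply/fmapP => z; have := eqe z.
rewrite /entry; case: (boolP (z \in domf T)) => zT.
  have zT' : z \in domf T' by rewrite -eqd.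
  by rewrite !in_fnd /= => /(_ isT) ->.
have zT' : z \notin domf T' by rewrite -eqd.
by rewrite !not_fnd.
Qed.

Lemma mem_fillings n (zs : seq cell) (T : tableau) : uniq zs ->
  domf T =i zs ->
  {in zs, forall z, entry T z \in interval (part n z.2)} ->
  T \in fillings n zs.
Proof.
elim: zs T => [|z zs IH] T /= Tu.
  move=> dT _; rewrite inE; apply/eqP/fmapP => x.
  by rewrite !not_fnd // dT.
move: Tu => /andP[zNzs uzs] dT eT.
have zT : z \in domf T by rewrite dT mem_head.
have /imfsetP[/= i iI ei] := eT z (mem_head _ _).
apply/allpairsPdep; exists T.[& [fset x in zs]], i; split=> //.
  apply: IH => //.
    move=> x; rewrite domf_restrict !inE dT inE.
    by case: (boolP (x \in zs)); rewrite ?orbT ?andbF //= andbT.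
  move=> x xzs; rewrite entry_restrict inE xzs.
  by apply: eT; rewrite inE xzs orbT.
apply: tableauP.
  apply/fsetP => x; rewrite dom_setf in_fset1U domf_restrict in_fsetI inE dT inE.
  by case: (x == z); case: (x \in zs).
move=> x; rewrite dT entry_set inE => /predU1P[->|xzs]; first by rewrite eqxx.
rewrite entry_restrict inE xzs; case: eqP => // ezx.
by rewrite -ezx xzs in zNzs.
Qed.

(* The candidates in rsst_extending only serve to make the set finite.         *)
Lemma in_rsst_extending (lam al n : seq nat) (R T : tableau) :
  T \in rsst_extending lam al n R <->
  [/\ is_rsst (diagram lam) T,
      T.[& diagram lam `\` diagram al] = R
    & is_tab (diagram al) n T.[& diagram al]].
Proof.
rewrite !inE /=; split=> [/andP[_ /asboolP]//|hT].
apply/andP; split; last exact/asboolP.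
case: hT => [[dT _] TR [dTal eTal]].
apply/mapP; exists T.[& diagram al].
  apply: mem_fillings => //; first exact: fset_uniq.
  by rewrite dTal.
rewrite -TR; apply/fmapP => z; rewrite fnd_cat !fnd_restrict domf_restrict.
rewrite in_fsetI in_fsetD -dT.
case: (boolP (z \in domf T)) => zT; last by rewrite andbF (not_fnd zT) if_same.
by rewrite !andbT; case: (z \in diagram al).
Qed.

(* The arrow between (r, c) and (r + 1, c + 1), with its tail given first.     *)
Definition nw_arrow (T : tableau) (t h : cell) : bool :=
  [&& t \in domf T, h \in domf T, t == (h.1.+1, h.2.+1),
      entry T t == entry T h + 3
    & T.[? (h.1.+1, h.2)] == Some (entry T h + 2)].

Definition se_arrow (T : tableau) (t h : cell) : bool :=
  [&& t \in domf T, h \in domf T, h == (t.1.+1, t.2.+1),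
      entry T h == entry T t + 3
    & T.[? (t.1.+1, t.2)] == Some (entry T t + 1)].

(* Words are handled as sequences of cells, so that each letter is attached to *)
(* its cell; letters T zs is the word proper.                                  *)
Definition letters (T : tableau) (zs : seq cell) : seq int := map (entry T) zs.

Definition reading_word (T : tableau) (zs : seq cell) : Prop :=
  perm_eq zs (domf T) /\
  {in domf T &, forall z z', lt_ne z z' -> (index z zs < index z' zs)%N}.

Definition square_respecting (T : tableau) (zs : seq cell) : Prop :=
  forall t h, nw_arrow T t h || se_arrow T t h ->
    (index t zs < index h zs)%N.

Definition contents (T : tableau) : seq int :=
  sort <=%O (undup [seq content z | z <- domf T]).

Definition diagonal (T : tableau) (k : int) : seq cell :=
  sort (fun z z' : cell => (z.1 <= z'.1)%N) [seq z <- domf T | content z == k].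

Definition is_nw_tail (T : tableau) (z : cell) : bool :=
  has (nw_arrow T z) (domf T).

Definition sqread (T : tableau) : seq int :=
  letters T (flatten
    [seq rev [seq z <- diagonal T k | is_nw_tail T z] ++
         [seq z <- diagonal T k | ~~ is_nw_tail T z] | k <- contents T]).

(* jmin is min ({i | al_i > 0, al_i >= al_(i+1)} U {l + 1}).                   *)
Definition jmin (al : seq nat) : nat :=
  \big[minn/(size al).+1]_(1 <= i < (size al).+1
    | (0 < part al i)%N && (part al i.+1 <= part al i)%N) i.

Definition jmax (lam al : seq nat) : nat :=
  \max_(1 <= i < (size al).+1 | (part al i < part lam i)%N) i.

(* The first jmax parts of al consist of k zeros, then b, b + 1, ..., then, in *)
(* the first form only, a second run of consecutive integers starting by       *)
(* repeating the last entry a = b + m of the first run. In the second form the *)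
(* run may be empty, so that al may start with jmax zeros.                     *)
Definition form1 (lam al : seq nat) : Prop :=
  exists k b m m' : nat,
    [/\ (0 < b)%N, (0 < k)%N -> b = 1%N,
        take (jmax lam al) al =
          nseq k 0%N ++ iota b m.+1 ++ iota (b + m) m'.+1,
        (jmin al < jmax lam al)%N
      & jmin al = (k + m).+1].

Definition form2 (lam al : seq nat) : Prop :=
  exists k b m : nat,
    [/\ (0 < b)%N, (0 < k)%N -> b = 1%N,
        take (jmax lam al) al = nseq k 0%N ++ iota b m
      & jmin al = jmax lam al \/ jmin al = (jmax lam al).+1].

Definition admissible_form (lam al : seq nat) : Prop :=
  [/\ drop (jmax lam al) al = drop (jmax lam al) lam,
      (0 < jmax lam al)%N ->
        (part al (jmax lam al).+1 <= (part al (jmax lam al)).+1)%N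
    & form1 lam al \/ form2 lam al].

Definition border_cell (al : seq nat) (c : nat) : cell := ((part al c).+1, c).

(* Main.v *)
(* Induction on |alpha| + |n|. With x = n_j, the identity
     e_d([x]) = e_d([x-1]) + u_x e_(d-1)([x-1])
   applied to the j-th factor splits J_alpha^n into two terms of the same kind with n_j
   lowered, while the tableaux on the right split according to whether the entry of
   the last cell of column j of alpha' is less than x or equal to x. In the second
   case that cell is added to R: its letter u_x is put in front of w, which is then
   inserted after the factor j - 1, or, when the factors before j are trivial, it is
   appended to v along with w.
     In the boundary cases no tableau, or no tableau with entry x, exists, and the
   corresponding determinant vanishes. For m < x,
     e_k([m]) u_x = u_x e_k([m]) + [e_1([m]), u_x] e_(k-1)([m])   and
     u_x e_k([m]) u_x = 0,
   whence the e_k([m]), k in Z, commute and a determinant with two equal rows is 0; the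
   determinant can be brought to that form because v r_c = 0 for the relevant c. The
   latter holds since a word with a repeated letter x is 0 as soon as at most one letter
   x + 3 or x - 3 lies in between; if there are two, R contains a square x-1 x / x x+1,
   for which the same problem arises one step further southwest. The same formula moves
   a first letter r_j + 1 of w into v.
     When alpha = 0, what remains is that all square respecting reading words of a
   tableau are equal: letters read in different orders are more than 3 apart. *)
Require Import Defs.
From HB Require Import structures.
From mathcomp Require Import all_boot all_order all_fingroup all_algebra.
From mathcomp Require Import finmap boolp monalg zify.
Import Order.TTheory GRing.Theory Num.Theory.
Local Open Scope fset_scope.
Local Open Scope fmap_scope.
Local Open Scope ring_scope.
Local Open Scope quotient_scope.

Set Implicit Arguments.
Unset Strict Implicit.
Unset Printing Implicit Defensive.

(** * The quotient algebra *)

(** Conditions (iii) and (v) are shaped by the place of the added cell, of entry x, between [v] and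
    [w]. In a two by two square of the enlarged tableau this cell can only be the northwest one,
    opposite to the border cell of column j + 1, and there is an arrow if r_(j+1) = x + 3. If r_j =
    x + 2, the arrow ends at the added cell and r_(j+1) = r_j + 1: the opposite cell has to be in
    [v], which fails only if [w] starts with r_j + 1. If r_j = x + 1, the arrow starts at the added
    cell and r_(j+1) > r_j + 1: the opposite cell has to be in [w], as (iii) provides. This is why a
    first letter r_j + 1 is moved into [v] before the split. The exception n_j < r_j - 1 in (v)
    accommodates the first term of the split, in which n_j decreases while R stays the same. *)

Definition lam3_ideal : {pred U} := fun x => `[< two_sided_ideal lam3_rel x >].

Fact lam3_ideal_zmod_closed : zmod_closed lam3_ideal.
Proof.
split; first by apply/asboolP; exact: ideal_zero.
move=> x y /asboolP Ix /asboolP Iy; apply/asboolP.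
by apply: ideal_add => //; rewrite -mulN1r; apply: ideal_lmul.
Qed.

HB.instance Definition _ :=
  GRing.isZmodClosed.Build U lam3_ideal lam3_ideal_zmod_closed.

(** This is only the additive quotient. The product is defined afterwards on representatives; it is
    well defined because the ideal is two-sided. *)
Definition Ulam : Type := Quotient.quot (GRing.ZmodClosed.clone U lam3_ideal _).
HB.instance Definition _ := GRing.Zmodule.on Ulam.

Definition toUlam (x : U) : Ulam := \pi_(Quotient.quot (GRing.ZmodClosed.clone U lam3_ideal _)) x.

Fact toUlam_is_zmod_morphism : zmod_morphism toUlam.
Proof. by move=> x y; rewrite /toUlam [LHS]raddfB. Qed.
HB.instance Definition _ :=
  GRing.isZmodMorphism.Build U Ulam toUlam toUlam_is_zmod_morphism.

Lemma toUlamP x y : toUlam x = toUlam y <-> eq_lam3 x y.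
Proof.
rewrite /toUlam; split=> [/eqP|xy]; last apply/eqP.
  by rewrite -Quotient.idealrBE => /asboolP.
by rewrite -Quotient.idealrBE; apply/asboolP.
Qed.

Definition urepr (x : Ulam) : U := generic_quotient.repr x.

Definition Ulam_one : Ulam := toUlam 1.
Definition Ulam_mul (x y : Ulam) : Ulam := toUlam (urepr x * urepr y).

Lemma toUlamK (x : Ulam) : toUlam (urepr x) = x.
Proof. exact: reprK. Qed.

Lemma toUlam_mul x y : toUlam (x * y) = Ulam_mul (toUlam x) (toUlam y).
Proof.
apply/toUlamP; set x' := urepr _; set y' := urepr _.
have Ix : eq_lam3 x x' by apply/toUlamP; rewrite toUlamK.
have Iy : eq_lam3 y y' by apply/toUlamP; rewrite toUlamK.
have e : x * y - x' * y' = (x - x') * y + x' * (y - y').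
  by rewrite mulrBl mulrBr addrA subrK.
rewrite /eq_lam3 e.
by apply: ideal_add; [apply: ideal_rmul | apply: ideal_lmul].
Qed.

Fact Ulam_mulA : associative Ulam_mul.
Proof.
by move=> x y z; rewrite -[x]toUlamK -[y]toUlamK -[z]toUlamK -!toUlam_mul mulrA.
Qed.

Fact Ulam_mul1l : left_id Ulam_one Ulam_mul.
Proof. by move=> x; rewrite -[x]toUlamK -toUlam_mul mul1r. Qed.

Fact Ulam_mul1r : right_id Ulam_one Ulam_mul.
Proof. by move=> x; rewrite -[x]toUlamK -toUlam_mul mulr1. Qed.

Fact Ulam_mulDl : left_distributive Ulam_mul +%R.
Proof.
move=> x y z; rewrite -[x]toUlamK -[y]toUlamK -[z]toUlamK.
by rewrite -raddfD -!toUlam_mul mulrDl raddfD.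
Qed.

Fact Ulam_mulDr : right_distributive Ulam_mul +%R.
Proof.
move=> x y z; rewrite -[x]toUlamK -[y]toUlamK -[z]toUlamK.
by rewrite -raddfD -!toUlam_mul mulrDr raddfD.
Qed.

HB.instance Definition _ := GRing.Zmodule_isPzRing.Build Ulam
  Ulam_mulA Ulam_mul1l Ulam_mul1r Ulam_mulDl Ulam_mulDr.

Fact toUlam_is_monoid_morphism : monoid_morphism toUlam.
Proof. by split; [rewrite -[RHS]/Ulam_one | exact: toUlam_mul]. Qed.
HB.instance Definition _ :=
  GRing.isMonoidMorphism.Build U Ulam toUlam toUlam_is_monoid_morphism.

Lemma lam3_quotient_exists :
  exists (A : pzRingType) (f : {rmorphism U -> A}),
    (forall a, exists x, a = f x) /\ forall x y, f x = f y <-> eq_lam3 x y.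
Proof.
exists Ulam, toUlam; split; last exact: toUlamP.
by move=> a; exists (urepr a); symmetry; exact: toUlamK.
Qed.

(** The quotient is used as a plain ring, in which the scalar a is represented by the image of
    [a *: 1]; this makes that image central. *)
Lemma scale1_central (a : laurent) (x : U) : (a *: 1) * x = x * (a *: 1).
Proof.
rewrite -scalerAl mul1r [x in RHS]monalgE mulr_suml [x in LHS]monalgE scaler_sumr.
apply: eq_bigr => k _; rewrite -[in RHS](mul_malgC a) mulr1 malgM_def fgmulUU.
by rewrite mulm1 -mul_malgC malgM_def fgmulUU mul1m mulrC.
Qed.

(* [lam3_c] and [lam3_cV] stand for q and its inverse. *)
Record lam3_algebra := Lam3Algebra {
  lam3_ring :> pzRingType;
  gen : int -> lam3_ring;
  lam3_c : lam3_ring;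
  lam3_cV : lam3_ring;
  lam3_cK : lam3_c * lam3_cV = 1;
  lam3_cC : forall x, lam3_c * x = x * lam3_c;
  lam3_cVC : forall x, lam3_cV * x = x * lam3_cV;
  gen_sq : forall i : int, gen i * gen i = 0;
  gen_hlh : forall i : int, gen (i + 3) * gen i * gen (i + 3) = 0;
  gen_lhl : forall i : int, gen i * gen (i + 3) * gen i = 0;
  gen_far : forall i j : int, 3 < `|i - j| -> gen i * gen j = gen j * gen i;
  gen_near : forall i j : int, 0 < j - i < 3 ->
    gen i * gen j = lam3_cV * (gen j * gen i) }.

Arguments gen {_}.
Arguments gen_sq {_}.
Arguments gen_hlh {_}.
Arguments gen_lhl {_}.
Arguments gen_far {_} [_ _].
Arguments gen_near {_} [_ _].
Arguments lam3_cK {_}.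
Arguments lam3_cC {_}.
Arguments lam3_cVC {_}.

(** * Monomials: when they vanish and when they agree *)

Section Words.

Variable A : lam3_algebra.
Local Notation g := (@gen A).
Local Notation c := (lam3_c A).
Local Notation cV := (lam3_cV A).

(** Distance 3 is the only obstacle to moving letters: at any other distance two letters commute up
    to a central factor. *)
Definition dist3 (i k : int) : bool := `|i - k| == 3.

Definition mon (s : seq int) : A := \prod_(i <- s) g i.

Lemma mon_nil : mon [::] = 1. Proof. exact: big_nil. Qed.
Lemma mon_cons i s : mon (i :: s) = g i * mon s. Proof. exact: big_cons. Qed.
Lemma mon_cat s t : mon (s ++ t) = mon s * mon t. Proof. exact: big_cat. Qed.
Lemma mon1 i : mon [:: i] = g i. Proof. exact: big_seq1. Qed.
Lemma mon_rcons s i : mon (rcons s i) = mon s * g i.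
Proof. by rewrite -cats1 mon_cat mon1. Qed.

Lemma gen_near_rev (i j : int) : 0 < j - i < 3 -> g j * g i = c * (g i * g j).
Proof. by move=> ij; rewrite (gen_near ij) mulrA lam3_cK mul1r. Qed.

Lemma gen_qcomm (i j : int) : `|i - j| != 3 ->
  exists2 k : A, (forall x, k * x = x * k) & g i * g j = k * (g j * g i).
Proof.
move=> ij; case: (ltrP 3 `|i - j|) => [far|near].
  by exists 1 => [x|]; rewrite ?mul1r ?mulr1 // gen_far.
case: (ltrgtP i j) => [lt|gt|<-]; last by exists 1 => [x|]; rewrite ?mul1r ?mulr1.
  by exists cV => [x|]; first exact: lam3_cVC; apply: gen_near; lia.
by exists c => [x|]; first exact: lam3_cC; apply: gen_near_rev; lia.
Qed.

Lemma mon_qcomm i s : (forall k : int, k \in s -> `|i - k| != 3) ->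
  exists2 k : A, (forall x, k * x = x * k) & g i * mon s = k * (mon s * g i).
Proof.
elim: s => [|j s IHs] hs; first by exists 1 => [x|]; rewrite ?mon_nil ?mul1r ?mulr1.
have [k1 k1C e1] := gen_qcomm (hs j (mem_head _ _)).
have [|k2 k2C e2] := IHs; first by move=> k ks; apply: hs; rewrite inE ks orbT.
exists (k1 * k2) => [x|]; first by rewrite -mulrA k2C mulrA k1C -mulrA.
rewrite mon_cons [LHS]mulrA e1 -[LHS]mulrA -[X in _ * X]mulrA e2.
by rewrite [X in k1 * X]mulrA -(k2C (g j)) !mulrA.
Qed.

(** The central factors are not claimed to be invertible, so this direction has its own
    induction. *)
Lemma mon_qcomm_rev i s : (forall k : int, k \in s -> `|i - k| != 3) ->
  exists2 k : A, (forall x, k * x = x * k) & mon s * g i = k * (g i * mon s).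
Proof.
elim: s => [|j s IHs] hs; first by exists 1 => [x|]; rewrite ?mon_nil ?mul1r ?mulr1.
have [|k1 k1C e1] := @gen_qcomm j i; first by rewrite distrC hs ?mem_head.
have [|k2 k2C e2] := IHs; first by move=> k ks; apply: hs; rewrite inE ks orbT.
exists (k1 * k2) => [x|]; first by rewrite -mulrA k2C mulrA k1C -mulrA.
rewrite mon_cons -[LHS]mulrA e2 [LHS]mulrA -(k2C (g j)) -[LHS]mulrA.
by rewrite [X in k2 * X]mulrA e1 !mulrA k2C.
Qed.

Lemma mon_comm (i : int) s : (forall k : int, k \in s -> 3 < `|i - k|) ->
  g i * mon s = mon s * g i.
Proof.
elim: s => [|j s IHs] hs; first by rewrite mon_nil mul1r mulr1.
rewrite mon_cons mulrA gen_far ?hs ?mem_head // -mulrA IHs ?mulrA // => k ks.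
by apply: hs; rewrite inE ks orbT.
Qed.

(** If no letter of [s] is at distance 3 from i, the two u_i are brought together and u_i^2 = 0. If
    one letter k is, both u_i are brought next to u_k, and u_i u_k u_i = 0 since k is i + 3 or i -
    3. *)
Lemma gen_mon_gen_eq0 i s :
  (count (dist3 i) s <= 1)%N -> g i * mon s * g i = 0.
Proof.
have free (t : seq int) : ~~ has (dist3 i) t ->
    forall k : int, k \in t -> `|i - k| != 3.
  by move/hasPn=> ht k kt; apply: ht.
have [/split_find[k s1 s2 /eqP ik hs1] |hs _] :=
    boolP (has (dist3 i) s); last first.
  by have [k _ ->] := mon_qcomm (free _ hs); rewrite -!mulrA gen_sq !mulr0.
rewrite cat_rcons count_cat /= {2}/dist3 ik eqxx => cs.
have hs2 : ~~ has (dist3 i) s2 by rewrite has_count; lia.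
have [k1 _ e1] := mon_qcomm (free _ hs1).
have [k2 k2C e2] := mon_qcomm_rev (free _ hs2).
have e : g i * g k * g i = 0.
  have [->|->] : k = i + 3 \/ k = i - 3 by lia.
    exact: gen_lhl.
  by rewrite -{1 3}(subrK 3 i) gen_hlh.
rewrite mon_cat mon_cons mulrA e1 -!mulrA e2 !mulrA -[_ * k2]k2C !mulrA.
by rewrite -[X in X * mon s2]mulrA -[X in X * mon s2]mulrA [g i * _]mulrA e mulr0 mul0r.
Qed.

(** The first element of [s] is pulled to the front of [t]. Whatever stands before it in [t] comes
    after it in [s], so its letter commutes with the one that is moved. *)
Lemma mon_exchange (T : eqType) (e : T -> int) (s t : seq T) :
  uniq s -> perm_eq s t ->
  {in s &, forall x y, (index x s < index y s)%N -> (index y t < index x t)%N ->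
     3 < `|e x - e y|} ->
  mon (map e s) = mon (map e t).
Proof.
elim: s t => [|x s IHs] t /=; first by move=> _; rewrite perm_sym => /perm_nilP->.
move=> /andP[xs us] pst cst.
have xt : x \in t by rewrite -(perm_mem pst) mem_head.
have ut : uniq t by rewrite -(perm_uniq pst) /= xs us.
case/splitPr: t / xt pst cst ut => t1 t2 pst cst.
rewrite cat_uniq /= negb_or -!andbA => /and5P[ut1 xt1 t12 xt2 ut2].
have pst' : perm_eq s (t1 ++ t2).
  by rewrite -(perm_cons x) (perm_trans pst) // -cat1s perm_catCA.
have ix : index x (t1 ++ x :: t2) = size t1.
  by rewrite index_cat (negPf xt1) /= eqxx addn0.
rewrite map_cat /= mon_cat !mon_cons mulrA -mon_comm; last first.
  move=> _ /mapP[y yt1 ->]; apply: cst; rewrite ?mem_head //.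
  - by rewrite (perm_mem pst) mem_cat yt1.
  - rewrite eqxx; case: eqP => // exy; by rewrite exy yt1 in xt1.
  - by rewrite ix index_cat yt1 index_mem.
rewrite -mulrA -mon_cat -map_cat; congr (_ * _); apply: IHs => // y z ys zs.
have [nyx nzx] : y != x /\ z != x.
  by split; apply: contraNneq xs => <-.
move=> lyz lzy; apply: cst; rewrite ?inE ?ys ?zs ?orbT // 1?eq_sym.
  by rewrite ![x == _]eq_sym (negPf nyx) (negPf nzx) ltnS.
move: lzy; rewrite !index_cat /= ![x == _]eq_sym (negPf nyx) (negPf nzx).
case: (boolP (y \in t1)) => yt; case: (boolP (z \in t1)) => zt //.
- move=> /(leq_ltn_trans (leq_addr _ _)); rewrite ltnNge; case/negP.
  by apply: ltnW; rewrite index_mem.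
- by move=> _; apply: leq_trans (leq_addr _ _); rewrite index_mem.
- by rewrite !ltn_add2l ltnS.
Qed.

End Words.

Arguments mon {_}.
Arguments gen_near_rev {_} [_ _].
Arguments gen_mon_gen_eq0 {_} [_ _].

(** * Elementary polynomials *)

Section Elementary.

Variable A : lam3_algebra.
Local Notation g := (@gen A).
Local Notation c := (lam3_c A).
Local Notation cV := (lam3_cV A).

(** The polynomial e_d([m]), built by splitting off the largest letter, which comes first in
    decreasing words; [image_e] compares it with the sum over subsets. *)
Fixpoint elem (m : nat) (d : int) : A :=
  if m is m'.+1 then elem m' d + g m * elem m' (d - 1) else (d == 0)%:R.

Lemma elemS m d : elem m.+1 d = elem m d + g m.+1 * elem m (d - 1).
Proof. by []. Qed.

Lemma elem_lt0 m (d : int) : d < 0 -> elem m d = 0.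
Proof.
elim: m d => [|m IHm] d d0 /=; first by rewrite (_ : (d == 0) = false) //; lia.
by rewrite !IHm ?mulr0 ?addr0 //; lia.
Qed.

Lemma elem0 m : elem m 0 = 1.
Proof. by elim: m => [|m IHm] //=; rewrite IHm elem_lt0 // mulr0 addr0. Qed.

Lemma elem_far m (d x : int) : m%:Z + 3 < x -> g x * elem m d = elem m d * g x.
Proof.
elim: m d => [|m IHm] d mx /=; first by rewrite mulr_natl mulr_natr.
by rewrite mulrDr mulrDl !mulrA gen_far -?mulrA ?IHm //; lia.
Qed.

Lemma gen_gen_gen i j : g i * g j * g i = 0.
Proof.
by have := @gen_mon_gen_eq0 A i [:: j]; rewrite mon1; apply; rewrite /= addn0 leq_b1.
Qed.

(* The commutator of [elem m 1] and [g x]. *)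
Definition elem_comm (m : nat) (x : int) : A :=
  \sum_(0 <= i < m) (g i.+1 * g x - g x * g i.+1).

Lemma elem_commS m x :
  elem_comm m.+1 x = elem_comm m x + (g m.+1 * g x - g x * g m.+1).
Proof. by rewrite /elem_comm big_nat_recr. Qed.

(** In each summand, either the two letters are more than 3 apart and their commutator is 0, or p is
    at distance 1 or 2 from both: passing the smaller letter costs a factor q, passing u_x a factor
    q^(-1), and these cancel. *)
Lemma gen_elem_comm m (p x : int) : m%:Z < p < x ->
  g p * elem_comm m x = elem_comm m x * g p.
Proof.
elim: m => [|m IHm] mpx; first by rewrite /elem_comm big_geq // mulr0 mul0r.
rewrite elem_commS mulrDr mulrDl IHm; last by lia.
congr (_ + _); rewrite mulrBr mulrBl.
have [far|near] := ltrP 3 (x - m.+1%:Z); first by rewrite gen_far ?mulrBr ?subrr //; lia.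
have po : g p * g m.+1 = c * (g m.+1 * g p) by apply: gen_near_rev; lia.
have px : g p * g x = cV * (g x * g p) by apply: gen_near; lia.
have cVl (y z : A) : y * (cV * z) = cV * (y * z).
  by rewrite mulrA -lam3_cVC mulrA.
have cl (y z : A) : y * (c * z) = c * (y * z) by rewrite mulrA -lam3_cC mulrA.
congr (_ - _).
  by rewrite mulrA po -!mulrA px cVl mulrA lam3_cK mul1r.
by rewrite mulrA px -!mulrA po cl mulrA -lam3_cC lam3_cK mul1r.
Qed.

Lemma gen_elem_comm_eq0 m x : g x * elem_comm m x = 0.
Proof.
rewrite mulr_sumr big1 // => i _.
by rewrite mulrBr !mulrA gen_gen_gen gen_sq mul0r subrr.
Qed.

(** With p = u_(m+1), the unwanted terms of the induction contain p u_x p or p p and vanish, and p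
    passes the commutator by [gen_elem_comm]. *)
Lemma elem_gen m (d x : int) : m%:Z < x ->
  elem m d * g x = g x * elem m d + elem_comm m x * elem m (d - 1).
Proof.
elim: m d => [|m IHm] d mx.
  by rewrite /elem_comm big_geq // mul0r addr0 /= mulr_natl mulr_natr.
rewrite elemS mulrDl -[X in _ + X]mulrA !IHm; [|lia..].
set D := elem_comm m x; set p := g m.+1; set X := g x.
have pD : p * D = D * p by apply: gen_elem_comm; lia.
have pp : p * p = 0 by exact: gen_sq.
have pxp : p * X * p = 0 by exact: gen_gen_gen.
rewrite elemS elem_commS -/D -/p -/X !mulrDr !mulrDl !mulNr !mulrA.
rewrite pD pxp -[X * p * p]mulrA pp mulr0 !mul0r subr0.
rewrite -!addrA; congr (_ + _); rewrite [in RHS]addrCA; congr (_ + _).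
by rewrite addr0 [in RHS]addrCA; congr (_ + _); rewrite [RHS]addrA subrr add0r.
Qed.

Lemma gen_elem_gen m (d x : int) : m%:Z < x -> g x * elem m d * g x = 0.
Proof.
move=> mx; rewrite -mulrA elem_gen // mulrDr !mulrA gen_sq gen_elem_comm_eq0.
by rewrite !mul0r addr0.
Qed.

(** Once u_(m+1) has been moved to the front by [elem_gen], the expansion of the product is
    symmetric in the two indices by the induction hypothesis. *)
Lemma elemC m (k l : int) : elem m k * elem m l = elem m l * elem m k.
Proof.
elim: m k l => [|m IHm] k l; first by rewrite /= mulr_natl mulr_natr.
set x := g m.+1; set D := elem_comm m m.+1.
have e i j : elem m.+1 i * elem m.+1 j =
    elem m i * elem m j + D * (elem m (i - 1) * elem m (j - 1)) +
    (x * (elem m i * elem m (j - 1)) + x * (elem m (i - 1) * elem m j)).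
  have ex : elem m i * x = x * elem m i + D * elem m (i - 1).
    by apply: elem_gen; lia.
  have xex : x * elem m (i - 1) * x = 0 by apply: gen_elem_gen; lia.
  rewrite !elemS -/x mulrDl !mulrDr !mulrA ex xex mul0r addr0 !mulrDl -!mulrA.
  by rewrite -!addrA; congr (_ + _); rewrite addrCA.
rewrite !e (IHm k l) (IHm (k - 1) (l - 1)) (IHm k (l - 1)) (IHm (k - 1) l).
by congr (_ + _); rewrite addrC.
Qed.

(** The two commutator terms cancel by [elemC]. The left side is a 2 x 2 minor of adjacent rows with
    common flag m and u_x between them; the shifts by 1 are those between two rows with equal
    alpha. *)
Lemma elem_gen_swap m (k l x : int) : m%:Z < x ->
  elem m k * g x * elem m l - elem m (l + 1) * g x * elem m (k - 1) =
  g x * (elem m k * elem m l - elem m (l + 1) * elem m (k - 1)).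
Proof.
move=> mx; rewrite !elem_gen // addrK !mulrDl -!mulrA (elemC m l) mulrBr.
by rewrite opprD addrACA subrr addr0.
Qed.

End Elementary.

Arguments elem {_}.

(** * Square respecting reading words *)

Lemma dist3P (i k : int) : dist3 i k -> k = i + 3 \/ k = i - 3.
Proof. by rewrite /dist3 => /eqP h; lia. Qed.

Lemma split_between (T : eqType) (v w : seq T) z1 z0 :
  uniq (v ++ w) -> z0 \in v -> z1 \in v ++ w ->
  (index z1 (v ++ w) < index z0 (v ++ w))%N ->
  exists v1 v2 v3, v = v1 ++ z1 :: v2 ++ z0 :: v3 /\
    forall y, y \in v2 -> (index z1 (v ++ w) < index y (v ++ w))%N &&
                          (index y (v ++ w) < index z0 (v ++ w))%N.
Proof.
move=> + zv; case/splitPr: zv => va v3; rewrite -catA /=.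
move=> /= U z1v lt; have := U; rewrite cat_uniq /= => /and4P[ua + z0n uw].
rewrite negb_or => /andP[z0a da].
have i0 : index z0 (va ++ z0 :: v3 ++ w) = size va.
  by rewrite index_cat (negPf z0a) /= eqxx addn0.
have z1a : z1 \in va.
  by move: lt; rewrite i0 index_cat; case: (z1 \in va) => //; rewrite ltnNge leq_addr.
case/splitPr: z1a ua i0 lt da z0a {U z1v} => v1 v2 ua i0 lt da z0a.
exists v1, v2, v3; rewrite -catA; split=> // y yv2; rewrite i0.
move: ua; rewrite cat_uniq /= => /and4P[u1 + z1n u2].
rewrite negb_or => /andP[n1 /hasPn/(_ _ yv2) ny].
have -> : index z1 ((v1 ++ z1 :: v2) ++ z0 :: v3 ++ w) = size v1.
  by rewrite -catA index_cat (negPf n1) /= eqxx addn0.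
have yz : (z1 == y) = false by apply: contraNF z1n => /eqP->.
rewrite -catA index_cat (negPf ny) /= yz index_cat yv2 size_cat /= ltn_add2l.
by rewrite -addSnnS leq_addr ltnS index_mem yv2.
Qed.

Lemma split_after (T : eqType) (v w : seq T) z :
  uniq (v ++ w) -> z \in v ->
  exists v1 v2, v = v1 ++ z :: v2 /\
    forall y, y \in v2 -> (index z (v ++ w) < index y (v ++ w))%N.
Proof.
move=> + zv; case/splitPr: zv => v1 v2; rewrite -catA /= => U.
exists v1, v2; split=> // y yv2; move: U; rewrite cat_uniq /= => /and4P[_ + zn _].
rewrite negb_or => /andP[z1 /hasPn/(_ y)]; rewrite mem_cat yv2 => /(_ isT) ny.
have yz : (z == y) = false by apply: contraNF zn => /eqP->; rewrite mem_cat yv2.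
by rewrite !index_cat (negPf z1) (negPf ny) /= eqxx yz addn0 -addSnnS leq_addr.
Qed.

Lemma count_le1 (T : eqType) (P : pred T) (s : seq T) a b :
  uniq s -> (forall y, y \in s -> P y -> y = a \/ y = b) ->
  ~~ [&& a \in s, b \in s, P a & P b] -> (count P s <= 1)%N.
Proof.
move=> us sP nab; rewrite -size_filter.
have {}nab : (a \notin filter P s) || (b \notin filter P s).
  by rewrite -negb_and !mem_filter; apply: contra nab => /andP[/andP[-> ->] /andP[-> ->]].
have [d sd] : exists d, {subset filter P s <= [:: d]}.
  case/orP: nab => n; [exists b | exists a] => y yf; rewrite inE;
    move: (yf); rewrite mem_filter => /andP[Py ys].
    by case: (sP _ ys Py) => [ey|->//]; rewrite ey (negPf n) in yf.
  by case: (sP _ ys Py) => [->//|ey]; rewrite ey (negPf n) in yf.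
by apply: (uniq_leq_size (s2 := [:: d])) => //; rewrite filter_uniq.
Qed.

(** The property of restricted shapes on which the arguments about reading words rest: rows are
    closed to the west, and a column is filled between the rows of two cells weakly east of it. *)
Definition sw_closed (theta : {fset cell}) : Prop :=
  (forall z, z \in theta -> (0 < z.2)%N) /\
  forall z z' y : cell, z \in theta -> z' \in theta ->
    (z.1 <= y.1 <= z'.1)%N -> (0 < y.2)%N -> (y.2 <= z.2)%N -> (y.2 <= z'.2)%N ->
    y \in theta.

Section ReadingWords.

Variable A : lam3_algebra.
Local Notation g := (@gen A).

Variables (theta : {fset cell}) (R : tableau).
Hypothesis theta_sw : sw_closed theta.
Hypothesis R_rsst : is_rsst theta R.
Local Notation e := (entry R).

Lemma rsst_col (r r' k : nat) : (r, k) \in theta -> (r', k) \in theta -> (r < r')%N ->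
  e (r, k) < e (r', k).
Proof. by move=> z1 z2 lt; have [h _ _] := R_rsst.2 _ _ z1 z2; apply: h. Qed.

Lemma rsst_row (r k k' : nat) : (r, k) \in theta -> (r, k') \in theta -> (k < k')%N ->
  e (r, k) < e (r, k').
Proof. by move=> z1 z2 lt; have [_ h _] := R_rsst.2 _ _ z1 z2; apply: h. Qed.

Lemma rsst_se (r r' k k' : nat) : (r, k) \in theta -> (r', k') \in theta ->
  (r < r')%N -> (k < k')%N -> e (r, k) + 3 <= e (r', k').
Proof.
move=> z1 z2 lr lk; have [_ _ h] := R_rsst.2 _ _ z1 z2; apply: h => /=.
- rewrite /lt_se /= (ltnW lr) (ltnW lk) !andbT; apply/eqP => -[err _].
  by rewrite err ltnn in lr.
- by move=> err; rewrite err ltnn in lr.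
- by move=> ekk; rewrite ekk ltnn in lk.
Qed.

Lemma dom_colP (r s t k k' : nat) : (r, k) \in theta -> (t, k') \in theta ->
  (r <= s <= t)%N -> (k <= k')%N -> (s, k) \in theta.
Proof.
move=> z1 z2 rst kk; apply: (theta_sw.2 _ _ (s, k) z1 z2 rst) => //=.
exact: theta_sw.1 z1.
Qed.

Lemma dom_rowP (r k k' : nat) : (r, k') \in theta -> (0 < k <= k')%N -> (r, k) \in theta.
Proof.
by move=> z /andP[k0 kk]; apply: (theta_sw.2 _ _ (r, k) z z); rewrite /= ?leqnn.
Qed.

(** Otherwise the cell (r + 1, k) or (r', k + 1) has an entry in between that makes the difference
    at least 4. *)
Lemma rsst_se3 (r r' k k' : nat) : (r, k) \in theta -> (r', k') \in theta ->
  (r < r')%N -> (k < k')%N -> e (r', k') = e (r, k) + 3 ->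
  r' = r.+1 /\ k' = k.+1.
Proof.
move=> z z' lr lk e3; have k0 := theta_sw.1 _ z; rewrite /= in k0; split; apply/eqP.
  rewrite eqn_leq lr andbT leqNgt; apply/negP => lr'.
  have y : (r.+1, k) \in theta by apply: (dom_colP z z'); rewrite ?leqnSn ?(ltnW lr) ?(ltnW lk).
  have := rsst_se y z' lr' lk; have := rsst_col z y (ltnSn _); lia.
rewrite eqn_leq lk andbT leqNgt; apply/negP => lk'.
have y : (r', k.+1) \in theta by apply: (dom_rowP z'); lia.
have := rsst_se z y lr (ltnSn _); have := rsst_row y z' lk'; lia.
Qed.

Lemma sw_corner (r k : nat) : (r, k) \in theta -> (r.+1, k.+1) \in theta ->
  (r.+1, k) \in theta.
Proof. by move=> z z'; apply: (dom_colP z z'); rewrite ?leqnSn ?leqnn. Qed.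

Lemma arrow_cases (r k : nat) : (r, k) \in theta -> (r.+1, k.+1) \in theta ->
  e (r.+1, k.+1) = e (r, k) + 3 ->
  (e (r.+1, k) = e (r, k) + 2 /\ nw_arrow R (r.+1, k.+1) (r, k)) \/
  (e (r.+1, k) = e (r, k) + 1 /\ se_arrow R (r, k) (r.+1, k.+1)).
Proof.
move=> z z' e3; have y := sw_corner z z'.
have l1 := rsst_col z y (ltnSn _); have l2 := rsst_row y z' (ltnSn _).
have dR : domf R = theta := R_rsst.1.
have Ry : R.[? (r.+1, k)] = Some (e (r.+1, k)).
  by rewrite /entry in_fnd // dR.
have zR : (r, k) \in domf R by rewrite dR.
have zR' : (r.+1, k.+1) \in domf R by rewrite dR.
have [e2|e1] : e (r.+1, k) = e (r, k) + 2 \/ e (r.+1, k) = e (r, k) + 1 by lia.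
  by left; split=> //; rewrite /nw_arrow zR zR' eqxx /= Ry e2 e3 !eqxx.
by right; split=> //; rewrite /se_arrow zR zR' eqxx /= Ry e1 e3 !eqxx.
Qed.

Section Word.

Variable zs : seq cell.
Hypothesis zs_reading : reading_word R zs.
Hypothesis zs_square : square_respecting R zs.

Local Notation before z z' := (index z zs < index z' zs)%N.

Lemma zs_uniq : uniq zs.
Proof. by rewrite (perm_uniq zs_reading.1) fset_uniq. Qed.

Lemma mem_zs z : (z \in zs) = (z \in theta).
Proof. by rewrite (perm_mem zs_reading.1) -R_rsst.1. Qed.

Lemma before_ne z z' : z \in theta -> z' \in theta -> lt_ne z z' -> before z z'.
Proof. by rewrite -R_rsst.1 => zt zt' lt; apply: zs_reading.2. Qed.

Lemma before_asym z z' : before z z' -> before z' z -> False.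
Proof. by move=> /ltnW; rewrite ltnNge => ->. Qed.

Lemma not_ne_cases (r k r' k' : nat) :
  ~~ lt_ne (r, k) (r', k') -> ~~ lt_ne (r', k') (r, k) -> (r, k) != (r', k') ->
  ((r < r') && (k < k') || (r' < r) && (k' < k))%N.
Proof.
rewrite /lt_ne /= [(r', k') == _]eq_sym => h1 h2 h; move: h1 h2; rewrite h /= => h1 h2.
by lia.
Qed.

End Word.

(** Two cells read in different orders are incomparable for [lt_ne], so one is strictly southeast of
    the other and their entries differ by at least 3. A difference of exactly 3 comes with an arrow,
    which fixes the order in both words. *)
Lemma reading_words_eq zs zs' :
  reading_word R zs -> square_respecting R zs ->
  reading_word R zs' -> square_respecting R zs' ->
  mon (letters R zs) = mon (letters R zs') :> A.
Proof.
move=> rw sr rw' sr'; apply: mon_exchange; first exact: zs_uniq rw.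
  by rewrite (perm_trans rw.1) // perm_sym; exact: rw'.1.
move=> [r k] [r' k']; rewrite !(mem_zs rw) => z z' lt gt.
have nzz : (r, k) != (r', k') by apply: contraTneq lt => ->; rewrite ltnn.
have /orP[/andP[lr lk]|/andP[lr lk]] : ((r < r') && (k < k') || (r' < r) && (k' < k))%N.
  apply: not_ne_cases => //; apply/negP => ne.
    by apply: before_asym gt; apply: (before_ne rw' z z' ne).
  by apply: before_asym lt; apply: (before_ne rw z' z ne).
- have := rsst_se z z' lr lk; rewrite le_eqVlt => /orP[/eqP e3|lt3]; last first.
    by rewrite distrC (lt_le_trans _ (ler_norm _)) // ltrBrDr addrC.
  have [er ek] := rsst_se3 z z' lr lk (esym e3); subst r' k'.
  case: (arrow_cases z z' (esym e3)) => -[_ ar].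
    by case: (before_asym lt); apply: sr; rewrite ar.
  by case: (before_asym gt); apply: sr'; rewrite ar orbT.
- have := rsst_se z' z lr lk; rewrite le_eqVlt => /orP[/eqP e3|lt3]; last first.
    by rewrite (lt_le_trans _ (ler_norm _)) // ltrBrDr addrC.
  have [er ek] := rsst_se3 z' z lr lk (esym e3); subst r k.
  case: (arrow_cases z' z (esym e3)) => -[_ ar].
    by case: (before_asym gt); apply: sr'; rewrite ar.
  by case: (before_asym lt); apply: sr; rewrite ar orbT.
Qed.

Lemma prefix_eq0 v1 z1 v2 z0 v3 : e z1 = e z0 ->
  (count (fun y => dist3 (e z1) (e y)) v2 <= 1)%N ->
  mon (letters R (v1 ++ z1 :: v2 ++ z0 :: v3)) = 0 :> A.
Proof.
move=> e10 c1; rewrite /letters map_cat /= map_cat /= mon_cat !mon_cons mon_cat.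
rewrite mon_cons -e10 !mulrA -[X in X * mon _]mulrA -[X in X * mon _]mulrA.
by rewrite [g _ * (_ * _)]mulrA gen_mon_gen_eq0 ?count_map // mulr0 mul0r.
Qed.

Section Prefix.

Variables v w : seq cell.
Hypothesis vw_reading : reading_word R (v ++ w).
Hypothesis vw_square : square_respecting R (v ++ w).
Local Notation before z z' := (index z (v ++ w) < index z' (v ++ w))%N.

(* The only letters x + 3 and x - 3 that can be read between the two letters x of
   the square x-1 x / x x+1 are southeast and northwest of the lower one. If both
   occur, then the four cells southwest of the square form another such square. *)
Lemma square_eq0 (r k : nat) (x : int) :
  (r, k) \in theta -> (r, k.+1) \in theta -> (r.+1, k) \in theta ->
  (r.+1, k.+1) \in theta -> (r, k.+1) \in v ->
  e (r, k) = x - 1 -> e (r, k.+1) = x -> e (r.+1, k) = x ->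
  e (r.+1, k.+1) = x + 1 ->
  mon (letters R v) = 0 :> A.
Proof.
elim: k r => [|k IHk] r tA tB tC tD vB eA eB eC eD.
  by have := theta_sw.1 _ tA.
have tv z : z \in v -> z \in theta.
  by move=> zv; rewrite -(mem_zs vw_reading) mem_cat zv.
have CB : before (r.+1, k.+1) (r, k.+2).
  by apply: (before_ne vw_reading tC tB); rewrite /lt_ne /= xpair_eqE; lia.
have Cvw : (r.+1, k.+1) \in v ++ w by rewrite (mem_zs vw_reading).
have [v1 [v2 [v3 [ev v2P]]]] :=
  split_between (zs_uniq vw_reading) vB Cvw CB.
have v2t y : y \in v2 -> y \in theta.
  by move=> yv; apply: tv; rewrite ev !(mem_cat, inE) yv !orbT.
have v2u : uniq v2.
  have := zs_uniq vw_reading.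
  by rewrite ev !cat_uniq /= cat_uniq => /andP[/and3P[_ _ /and3P[_ ->]]].
pose a : cell := (r.+2, k.+2); pose b : cell := (r, k).
(* With A, B in the upper and C, D in the lower row of the square, a cell read after C and before B
   has row and column at most those of A or at least those of D. If its entry is at distance 3 from
   x, it is diagonally adjacent to B or C; next to B it would be the head of an arrow from B and be
   read too late. This leaves the neighbours a and b of C. *)
have v2ab (p s : nat) : (p, s) \in v2 -> dist3 x (e (p, s)) ->
    (p, s) = a \/ (p, s) = b.
  move=> yv; have yt := v2t _ yv; have /andP[y1 y2] := v2P _ yv.
  move=> /dist3P d3.
  have n1 : ~~ lt_ne (p, s) (r.+1, k.+1).
    by apply/negP => /(before_ne vw_reading yt tC) /before_asym; apply.
  have n2 : ~~ lt_ne (r, k.+2) (p, s).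
    by apply/negP => /(before_ne vw_reading tB yt) /before_asym; apply.
  have ne1 : ((p, s) : cell) != (r.+1, k.+1) by apply: contraTneq y1 => ->; rewrite ltnn.
  have ne2 : ((p, s) : cell) != (r, k.+2) by apply: contraTneq y2 => ->; rewrite ltnn.
  have : ((p <= r) && (s <= k.+1) || (r < p) && (k.+1 < s))%N.
    move: n1 n2; rewrite /lt_ne ne1 [(r, k.+2) == _]eq_sym ne2 /= !negb_and -!ltnNge.
    rewrite !ltnS => /orP[pr|sk] /orP[pr'|sk'].
    - by move: pr'; rewrite ltnNge pr.
    - by rewrite pr sk'.
    - by rewrite pr' sk orbT.
    - by move: sk; rewrite ltnNge sk'.
  move=> /orP[/andP[pr sk]|/andP[pr sk]].
    move: sk; rewrite leq_eqVlt => /orP[/eqP es|sk]; last first.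
      have := rsst_se yt tC pr sk; rewrite eC => le3.
      have e3 : e (r.+1, k.+1) = e (p, s) + 3 by rewrite eC; move: le3 d3; clear; lia.
      by have [[<-] [<-]] := rsst_se3 yt tC pr sk e3; right.
    subst s; move: pr; rewrite leq_eqVlt => /orP[/eqP er|pr].
      by exfalso; subst p; move: d3; rewrite eA; clear; lia.
    have := rsst_col yt tA pr; rewrite eA => lt1.
    have e3 : e (r, k.+2) = e (p, k.+1) + 3 by rewrite eB; move: lt1 d3; clear; lia.
    have [er _] := rsst_se3 yt tB pr (ltnSn _) e3; subst r.
    case: (arrow_cases yt tB e3) => -[eA' ar]; last first.
      by exfalso; move: eA'; rewrite eA; move: lt1 d3; clear; lia.
    have lt := vw_square (introT orP (or_introl ar)).
    by case: (before_asym lt y2).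
  move: sk; rewrite leq_eqVlt => /orP[/eqP es|sk]; last first.
    have := rsst_se tB yt pr sk; rewrite eB => le3.
    have e3 : e (p, s) = e (r, k.+2) + 3 by rewrite eB; move: le3 d3; clear; lia.
    have [er es] := rsst_se3 tB yt pr sk e3; subst p s.
    case: (arrow_cases tB yt e3) => -[eD' ar].
      by exfalso; move: eD'; rewrite eD eB; clear; lia.
    have lt := vw_square (introT orP (or_intror ar)).
    by case: (before_asym lt y2).
  subst s; move: pr; rewrite leq_eqVlt => /orP[/eqP er|pr].
    by exfalso; subst p; move: d3; rewrite eD; clear; lia.
  have := rsst_se tC yt pr (ltnSn _); rewrite eC => le3.
  have e3 : e (p, k.+2) = e (r.+1, k.+1) + 3 by rewrite eC; move: le3 d3; clear; lia.
  by have [-> _] := rsst_se3 tC yt pr (ltnSn _) e3; left.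
have [/and4P[av bv /dist3P da /dist3P db]|nab] :=
    boolP [&& a \in v2, b \in v2, dist3 x (e a) & dist3 x (e b)]; last first.
  rewrite ev; apply: prefix_eq0; first by rewrite eB eC.
  by apply: (@count_le1 _ _ _ a b) => [//|[p s] yv|]; rewrite eC //; apply: v2ab.
have [ta tb] := (v2t _ av, v2t _ bv).
have k0 : (0 < k)%N := theta_sw.1 _ tb.
have [k' ek] : exists k', k = k'.+1 by exists k.-1; rewrite prednK.
subst k.
have {}da : e (r.+2, k'.+3) = x + 3 \/ e (r.+2, k'.+3) = x - 3 by [].
have {}db : e (r, k'.+1) = x + 3 \/ e (r, k'.+1) = x - 3 by [].
have ea : e (r.+2, k'.+3) = e (r.+1, k'.+2) + 3.
  by have := rsst_se tC ta (ltnSn _) (ltnSn _); rewrite eC; move: da; clear; lia.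
have eb : e (r.+1, k'.+2) = e (r, k'.+1) + 3.
  by have := rsst_se tb tC (ltnSn _) (ltnSn _); rewrite eC; move: db; clear; lia.
have /andP[ca _] := v2P _ av; have /andP[cb _] := v2P _ bv.
have tD' := sw_corner tC ta; have tA' := sw_corner tb tC.
(* Both a and b are read after C, so neither is the tail of an arrow to C; this decides the entries
   of the two corners. *)
have eD' : e (r.+2, k'.+2) = x + 1.
  case: (arrow_cases tC ta ea) => -[eD' ar]; last by rewrite eD' eC.
  by case: (before_asym ca (vw_square (introT orP (or_introl ar)))).
have eA' : e (r.+1, k'.+1) = x - 1.
  case: (arrow_cases tb tC eb) => -[eA' ar].
    by rewrite eA'; move: eb; rewrite eC; clear; lia.
  by case: (before_asym cb (vw_square (introT orP (or_intror ar)))).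
have tC' : (r.+2, k'.+1) \in theta by apply: (dom_colP tA' tD'); rewrite ?leqnSn ?leqnn.
have Cv : (r.+1, k'.+2) \in v by rewrite ev mem_cat mem_head orbT.
have eC' : e (r.+2, k'.+1) = x.
  have := rsst_col tA' tC' (ltnSn _); have := rsst_row tC' tD' (ltnSn _).
  by rewrite eA' eD'; clear; lia.
exact: (IHk r.+1 tA' tC tC' tD' Cv eA' eC eC' eD').
Qed.

(** By the assumption on the northeast, letters at distance 3 that are read later in [v] can only be
    at the two diagonal neighbours. If both are, the cell is the northeast corner of a square as in
    [square_eq0], and the word of [v] is already 0. *)
Lemma border_eq0 (p k : nat) : (p, k) \in v ->
  (forall z, z \in theta -> lt_ne (p, k) z -> ~~ dist3 (e (p, k)) (e z)) ->
  mon (letters R v) * g (e (p, k)) = 0 :> A.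
Proof.
move=> zv ne3; have [x ex] : exists x, e (p, k) = x by exists (e (p, k)).
rewrite ex in ne3 *.
have tv z : z \in v -> z \in theta.
  by move=> zv'; rewrite -(mem_zs vw_reading) mem_cat zv'.
have tz := tv _ zv.
have [v1 [v2 [ev v2P]]] := split_after (zs_uniq vw_reading) zv.
have v2t y : y \in v2 -> y \in theta.
  by move=> yv; apply: tv; rewrite ev !(mem_cat, inE) yv !orbT.
have v2u : uniq v2.
  by have := zs_uniq vw_reading; rewrite ev !cat_uniq /= => /andP[/and3P[_ _ /andP[_ ->]]].
pose a : cell := (p.+1, k.+1); pose b : cell := (p.-1, k.-1).
have v2ab (s t : nat) : (s, t) \in v2 -> dist3 x (e (s, t)) ->
    (s, t) = a \/ [/\ (s, t) = b, (0 < p)%N & (0 < k)%N].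
  move=> yv d3'; have yt := v2t _ yv; have y1 := v2P _ yv.
  have d3 := dist3P d3'.
  have n1 : ~~ lt_ne (s, t) (p, k).
    by apply/negP => /(before_ne vw_reading yt tz) /before_asym; apply.
  have n2 : ~~ lt_ne (p, k) (s, t) by apply/negP => /(ne3 _ yt)/negP.
  have ne1 : (s, t) != (p, k) by apply: contraTneq y1 => ->; rewrite ltnn.
  have /orP[/andP[ps kt]|/andP[ps kt]] := not_ne_cases n1 n2 ne1.
    have := rsst_se yt tz ps kt; rewrite ex => le3.
    have e3 : e (p, k) = e (s, t) + 3 by rewrite ex; move: le3 d3; clear; lia.
    by have [ep ek] := rsst_se3 yt tz ps kt e3; right; rewrite /b ep ek.
  have := rsst_se tz yt ps kt; rewrite ex => le3.
  have e3 : e (s, t) = e (p, k) + 3 by rewrite ex; move: le3 d3; clear; lia.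
  by have [ep ek] := rsst_se3 tz yt ps kt e3; left; rewrite ep ek.
have [/and4P[av bv da db]|nab] :=
    boolP [&& a \in v2, b \in v2, dist3 x (e a) & dist3 x (e b)]; last first.
  rewrite ev /letters map_cat /= mon_cat mon_cons ex -mulrA gen_mon_gen_eq0 ?mulr0 //.
  rewrite count_map; apply: (@count_le1 _ _ _ a b) => [//|[s t] yv|//].
  by move/(v2ab _ _ yv) => [->|[-> _ _]]; [left|right].
have [[]|[_ p0 k0]] := v2ab _ _ bv db; first by lia.
have [p' ep] : exists p', p = p'.+1 by exists p.-1; rewrite prednK.
have [k' ek] : exists k', k = k'.+1 by exists k.-1; rewrite prednK.
subst p k; have {da db} [da db] := (dist3P da, dist3P db).
have {}da : e (p'.+2, k'.+2) = x + 3 \/ e (p'.+2, k'.+2) = x - 3 by [].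
have {}db : e (p', k') = x + 3 \/ e (p', k') = x - 3 by [].
have ta : (p'.+2, k'.+2) \in theta := v2t _ av.
have tb : (p', k') \in theta := v2t _ bv.
have ea : e (p'.+2, k'.+2) = e (p'.+1, k'.+1) + 3.
  by have := rsst_se tz ta (ltnSn _) (ltnSn _); rewrite ex; move: da; clear; lia.
have eb : e (p'.+1, k'.+1) = e (p', k') + 3.
  by have := rsst_se tb tz (ltnSn _) (ltnSn _); rewrite ex; move: db; clear; lia.
have ca := v2P _ av; have cb := v2P _ bv.
have tD := sw_corner tz ta; have tA := sw_corner tb tz.
have eD : e (p'.+2, k'.+1) = x + 1.
  case: (arrow_cases tz ta ea) => -[eD ar]; last by rewrite eD ex.
  by case: (before_asym ca (vw_square (introT orP (or_introl ar)))).
have eA : e (p'.+1, k') = x - 1.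
  case: (arrow_cases tb tz eb) => -[eA ar].
    by rewrite eA; move: eb; rewrite ex; clear; lia.
  by case: (before_asym cb (vw_square (introT orP (or_intror ar)))).
have tC : (p'.+2, k') \in theta by apply: (dom_colP tA tD); rewrite ?leqnSn ?leqnn.
have eC : e (p'.+2, k') = x.
  have := rsst_col tA tC (ltnSn _); have := rsst_row tC tD (ltnSn _).
  by rewrite eA eD; clear; lia.
by rewrite (square_eq0 tA tz tC tD zv eA ex eC eD) mul0r.
Qed.

End Prefix.

End ReadingWords.

(** * [sqread] comes from a square respecting reading word *)

Lemma pairwise_index (T : eqType) (r : rel T) (s : seq T) x y :
  pairwise r s -> x \in s -> y \in s -> ~~ r y x -> x != y ->
  (index x s < index y s)%N.
Proof.
move=> rs xs ys nr nxy; rewrite ltnNge leq_eqVlt negb_or.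
apply/andP; split.
  by apply: contraNneq nxy => ei; rewrite -(nth_index x xs) -ei nth_index.
apply: contra nr => lt.
have := pairwiseP x rs (index y s) (index x s).
by rewrite !nth_index // !inE !index_mem xs ys lt; apply.
Qed.

Lemma pairwise_rev (T : Type) (r : rel T) (s : seq T) :
  pairwise r (rev s) = pairwise (fun x y => r y x) s.
Proof.
by elim: s => //= x s IHs; rewrite rev_cons pairwise_rcons all_rev IHs.
Qed.

Lemma pairwise_flatten_map (S : eqType) (T : eqType) (r : rel T) (ltS : rel S)
    (F : S -> seq T) (key : T -> S) (s : seq S) :
  (forall k x, x \in F k -> key x = k) ->
  (forall x y, ltS (key x) (key y) -> r x y) ->
  (forall k, pairwise r (F k)) ->
  pairwise ltS s -> pairwise r (flatten [seq F k | k <- s]).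
Proof.
move=> keyF ltr rF; elim: s => [|k s IHs] //= /andP[/allP ks ps].
rewrite pairwise_cat rF IHs // !andbT; apply/allrelP => x y xF.
move=> /flatten_mapP[k' k's yF]; apply: ltr.
by rewrite (keyF _ _ xF) (keyF _ _ yF) ks.
Qed.

Section SquareReading.

Variable T : tableau.
Local Notation e := (entry T).

Definition sqcells : seq cell :=
  flatten [seq rev [seq z <- diagonal T k | is_nw_tail T z] ++
               [seq z <- diagonal T k | ~~ is_nw_tail T z] | k <- contents T].

Lemma sqreadE : sqread T = letters T sqcells.
Proof. by []. Qed.

(** The order of [sqcells] as a relation on pairs: along a diagonal, tails of northwest arrows come
    first and go up, the others follow and go down. In this form a precedence is proved by refuting
    the opposite one. *)
Definition sqbefore (z z' : cell) : bool :=
  (content z < content z') || (content z == content z') &&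
  (if is_nw_tail T z then ~~ is_nw_tail T z' || (z'.1 < z.1)%N
   else ~~ is_nw_tail T z' && (z.1 < z'.1)%N).

Lemma sqbefore_irr : irreflexive sqbefore.
Proof.
by move=> z; rewrite /sqbefore ltxx eqxx ltnn; case: is_nw_tail.
Qed.

Lemma mem_diagonal k z : (z \in diagonal T k) = (z \in domf T) && (content z == k).
Proof. by rewrite mem_sort mem_filter andbC. Qed.

Lemma content_row_inj (z z' : cell) : content z = content z' -> z.1 = z'.1 -> z = z'.
Proof.
case: z z' => [r k] [r' k']; rewrite /content /= => h er; subst r'.
by congr (_, _); lia.
Qed.

Lemma diagonal_pairwise k : pairwise (fun z z' : cell => (z.1 < z'.1)%N) (diagonal T k).
Proof.
have sorted_d : pairwise (fun z z' : cell => (z.1 <= z'.1)%N) (diagonal T k).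
  rewrite -sorted_pairwise; last by move=> y x z; apply: leq_trans.
  by apply: sort_sorted => x y; apply: leq_total.
have uniq_d : uniq (diagonal T k) by rewrite sort_uniq filter_uniq ?fset_uniq.
rewrite uniq_pairwise in uniq_d.
have all_d : all [pred z | content z == k] (diagonal T k).
  by apply/allP => z; rewrite mem_diagonal => /andP[].
have := introT andP (conj sorted_d uniq_d); rewrite -pairwise_relI.
apply: sub_in_pairwise all_d => x y /eqP cx /eqP cy /andP[le ne].
rewrite ltn_neqAle le andbT; apply: contra ne => /eqP exy.
by apply/eqP/content_row_inj; rewrite ?cx.
Qed.

Lemma sqcells_pairwise : pairwise sqbefore sqcells.
Proof.
apply: (@pairwise_flatten_map _ _ _ <%O _ content).
- move=> k z; rewrite mem_cat mem_rev !mem_filter -andb_orl mem_diagonal.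
  by case/andP=> _ /andP[_ /eqP].
- by move=> x y lt; rewrite /sqbefore lt.
- move=> k; have allc (P : pred cell) : all [pred z | (content z == k) && P z]
      [seq z <- diagonal T k | P z].
    by apply/allP => z; rewrite mem_filter mem_diagonal => /and3P[/= -> _ ->].
  rewrite pairwise_cat pairwise_rev; apply/and3P; split.
  + apply/allrelP => x y; rewrite mem_rev !mem_filter !mem_diagonal.
    move=> /and3P[tx _ /eqP cx] /and3P[ty _ /eqP cy].
    by rewrite /sqbefore cx cy ltxx eqxx tx ty.
  + apply: (sub_in_pairwise _ (allc _) (pairwise_filter _ (diagonal_pairwise k))).
    move=> x y /andP[/eqP cx tx] /andP[/eqP cy ty] lt.
    by rewrite /sqbefore /= cx cy ltxx eqxx tx ty.
  + apply: (sub_in_pairwise _ (allc _) (pairwise_filter _ (diagonal_pairwise k))).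
    move=> x y /andP[/eqP cx tx] /andP[/eqP cy ty] lt.
    by rewrite /sqbefore cx cy ltxx eqxx (negPf tx) ty.
- rewrite -sorted_pairwise; last exact: lt_trans.
  by rewrite sort_lt_sorted undup_uniq.
Qed.

Lemma mem_sqcells z : (z \in sqcells) = (z \in domf T).
Proof.
apply/flatten_mapP/idP => [[k _]|zT].
  by rewrite mem_cat mem_rev !mem_filter -andb_orl mem_diagonal => /and3P[].
exists (content z); first by rewrite mem_sort mem_undup map_f.
rewrite mem_cat mem_rev !mem_filter -andb_orl mem_diagonal zT eqxx.
by case: is_nw_tail.
Qed.

Lemma sqcells_reading : reading_word T sqcells.
Proof.
split.
  apply: uniq_perm => [||z]; rewrite ?fset_uniq ?mem_sqcells //.
  exact: pairwise_uniq sqbefore_irr sqcells_pairwise.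
move=> z z' zT zT' /and3P[ne le1 le2].
apply: (pairwise_index sqcells_pairwise); rewrite ?mem_sqcells //.
have lt : content z < content z'.
  case: z z' ne le1 le2 {zT zT'} => [r k] [r' k'].
  by rewrite xpair_eqE /content /=; lia.
by rewrite /sqbefore lt_gtF // gt_eqF.
Qed.

Lemma sqcells_square : square_respecting T sqcells.
Proof.
move=> t h /orP[]; case/and5P=> tT hT /eqP eth /eqP e3 /eqP ecorner.
  apply: (pairwise_index sqcells_pairwise); rewrite ?mem_sqcells //; last first.
    by rewrite eth; case: (h) => r k /=; rewrite xpair_eqE; lia.
  have tt : is_nw_tail T t.
    by apply/hasP; exists h => //; rewrite /nw_arrow tT hT -eth e3 ecorner !eqxx.
  have ec : content h = content t by rewrite eth /content /=; lia.
  rewrite /sqbefore tt ec ltxx eqxx /=; case: is_nw_tail => //=.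
  by rewrite eth /= -leqNgt.
apply: (pairwise_index sqcells_pairwise); rewrite ?mem_sqcells //; last first.
  by rewrite eth; case: (t) => r k /=; rewrite xpair_eqE; lia.
(* A northwest arrow from h would need a corner entry exceeding that of t by 2, but it exceeds it by
   1. *)
have ht : ~~ is_nw_tail T h.
  apply/hasPn => x xT; apply/negP => /and5P[_ _ /eqP eh _ /eqP].
  rewrite (_ : x = t); last first.
    by case: (x) (t) eh eth => [r k] [r' k'] /= -> [-> ->].
  by rewrite ecorner => -[]; lia.
have ec : content h = content t by rewrite eth /content /=; lia.
rewrite /sqbefore (negPf ht) ec ltxx eqxx /= negb_and.
by rewrite eth /= -leqNgt leqnSn orbT.
Qed.

End SquareReading.

(** * Determinants with noncommuting entries *)

Section Determinants.

Variable A : lam3_algebra.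
Variable l : nat.
Local Notation g := (@gen A).

(* Rows and columns are numbered from 1 to l; the value of [pcol s c] for other c is
   irrelevant. *)
Definition pcol (s : 'S_l) (c : nat) : nat :=
  if insub c.-1 is Some o then (s o).+1 else 0.

(** A determinant over a noncommutative ring: factors are multiplied in the order of the rows,
    [f c p] being the entry in row c and column p. *)
Definition dsum (f : nat -> nat -> A) : A :=
  \sum_(s : 'S_l) (-1) ^+ odd_perm s * \prod_(1 <= c < l.+1) f c (pcol s c).

Lemma pcolE (s : 'S_l) (o : 'I_l) : pcol s o.+1 = (s o).+1.
Proof. by rewrite /pcol /= insubT //= => lo; congr (s _).+1; apply: val_inj. Qed.

Lemma dsum_congr (v v' : A) (f f' : nat -> nat -> A) :
  (forall s : 'S_l, v * \prod_(1 <= c < l.+1) f c (pcol s c) =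
                    v' * \prod_(1 <= c < l.+1) f' c (pcol s c)) ->
  v * dsum f = v' * dsum f'.
Proof.
move=> ff; rewrite !mulr_sumr; apply: eq_bigr => s _.
by rewrite !mulrA !commr_sign -!mulrA ff.
Qed.

Lemma dsumD (f1 f2 f3 : nat -> nat -> A) :
  (forall s : 'S_l, \prod_(1 <= c < l.+1) f1 c (pcol s c) =
     \prod_(1 <= c < l.+1) f2 c (pcol s c) + \prod_(1 <= c < l.+1) f3 c (pcol s c)) ->
  dsum f1 = dsum f2 + dsum f3.
Proof.
by move=> ff; rewrite -big_split; apply: eq_bigr => s _; rewrite ff mulrDr.
Qed.

Lemma prod_split (F : nat -> A) i : (0 < i <= l)%N ->
  \prod_(1 <= c < l.+1) F c =
  \prod_(1 <= c < i) F c * F i * \prod_(i.+1 <= c < l.+1) F c.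
Proof.
case/andP=> i0 il; rewrite (@big_cat_nat _ _ _ i) //=; last by rewrite ltnW.
by rewrite [X in _ * X]big_ltn // mulrA.
Qed.

Lemma prod_split2 (F : nat -> A) i : (0 < i < l)%N ->
  \prod_(1 <= c < l.+1) F c =
  \prod_(1 <= c < i) F c * (F i * F i.+1) * \prod_(i.+2 <= c < l.+1) F c.
Proof.
case/andP=> i0 il; rewrite (@prod_split F i) ?i0 ?(ltnW il) //.
by rewrite [X in _ * X]big_ltn // !mulrA.
Qed.

Lemma prod_eq0 (F : nat -> A) c : (0 < c <= l)%N -> F c = 0 ->
  \prod_(1 <= c < l.+1) F c = 0.
Proof. by move=> cl F0; rewrite (prod_split F cl) F0 mulr0 mul0r. Qed.

(** Permutations are paired by exchanging their values at i and i + 1. In the sum of two paired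
    terms the rows i and i + 1 enter only through a 2 x 2 minor. *)
Lemma dsum_swap (f f' : nat -> nat -> A) i : (0 < i < l)%N ->
  (forall c p, c != i -> c != i.+1 -> f c p = f' c p) ->
  (forall p p', f i p * f i.+1 p' - f i p' * f i.+1 p =
                f' i p * f' i.+1 p' - f' i p' * f' i.+1 p) ->
  dsum f = dsum f'.
Proof.
move=> /[dup] il0 /andP[i0 il] ff ffi.
have i1l : (i.-1 < l)%N by rewrite (leq_ltn_trans (leq_pred i)).
pose t := tperm (Ordinal i1l) (Ordinal il).
have tt (s : 'S_l) : [/\ pcol (t * s)%g i = pcol s i.+1, pcol (t * s)%g i.+1 = pcol s i &
    forall c, c != i -> c != i.+1 -> (0 < c <= l)%N -> pcol (t * s)%g c = pcol s c].
  have o0 : i = (Ordinal i1l).+1 by rewrite /= prednK.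
  have o1 : i.+1 = (Ordinal il).+1 by [].
  split.
  - by rewrite [in LHS]o0 [in RHS]o1 !pcolE permM tpermL.
  - by rewrite [in RHS]o0 [in LHS]o1 !pcolE permM tpermR.
  move=> c ci ci1 /andP[c0 cl].
  have cl' : (c.-1 < l)%N by rewrite prednK.
  have oc : c = (Ordinal cl').+1 by rewrite /= prednK.
  rewrite oc !pcolE permM tpermD //.
    by apply: contra ci => /eqP ei; rewrite oc -ei /= prednK.
  by apply: contra ci1 => /eqP ei; rewrite oc -ei.
have split_sum (h : nat -> nat -> A) : dsum h =
    \sum_(s : 'S_l | ~~ odd_perm s)
      (\prod_(1 <= c < l.+1) h c (pcol s c) -
       \prod_(1 <= c < l.+1) h c (pcol (t * s)%g c)).
  have todd : odd_perm t.
    by rewrite odd_tperm; apply/eqP => /(congr1 val) /= ei; move: i0 ei; clear; lia.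
  rewrite /dsum (bigID (fun s : 'S_l => odd_perm s)) /= addrC big_split /=.
  congr (_ + _).
    by apply: eq_bigr => s /negPf->; rewrite expr0 mul1r.
  rewrite (reindex_inj (mulgI t)) /=.
  apply: eq_big => s; rewrite odd_permM todd //= => /negPf ->.
  by rewrite expr1 mulN1r.
rewrite !split_sum; apply: eq_bigr => s _.
have [t0 t1 tc] := tt s.
have pre (h : nat -> nat -> A) : \prod_(1 <= c < i) h c (pcol (t * s)%g c) =
    \prod_(1 <= c < i) h c (pcol s c).
  by apply: eq_big_nat => c ci; rewrite tc //; move: ci (il); clear; lia.
have suf (h : nat -> nat -> A) : \prod_(i.+2 <= c < l.+1) h c (pcol (t * s)%g c) =
    \prod_(i.+2 <= c < l.+1) h c (pcol s c).
  by apply: eq_big_nat => c ci; rewrite tc //; move: ci (i0); clear; lia.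
have preff : \prod_(1 <= c < i) f c (pcol s c) = \prod_(1 <= c < i) f' c (pcol s c).
  by apply: eq_big_nat => c ci; apply: ff; move: ci; clear; lia.
have sufff : \prod_(i.+2 <= c < l.+1) f c (pcol s c) =
    \prod_(i.+2 <= c < l.+1) f' c (pcol s c).
  by apply: eq_big_nat => c ci; apply: ff; move: ci; clear; lia.
rewrite !(prod_split2 _ il0) t0 t1 !pre !suf -!mulrBl -!mulrBr preff sufff.
by rewrite ffi.
Qed.

(** All 2 x 2 minors of the rows i and i + 1 vanish, so both rows may be replaced by zeros. *)
Lemma dsum_sym_eq0 (f : nat -> nat -> A) i : (0 < i < l)%N ->
  (forall p p', f i p * f i.+1 p' = f i p' * f i.+1 p) -> dsum f = 0.
Proof.
move=> il fi; have il' : (0 < i <= l)%N by case/andP: il => -> /ltnW.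
pose f' c p := if c == i then 0 else if c == i.+1 then 0 else f c p.
rewrite (@dsum_swap f f' i il) => [|c p /negPf ci /negPf ci1|p p'].
- rewrite /dsum big1 // => s _; rewrite (prod_eq0 il') ?mulr0 //.
  by rewrite /f' eqxx.
- by rewrite /f' ci ci1.
- by rewrite (fi p p') subrr /f' eqxx !mul0r subrr.
Qed.

(* The second hypothesis says that no index alpha_c + s(c) - c is negative, i.e. that
   s contributes to the determinant. *)
Lemma pcol_fix (al : nat -> nat) (K : nat) (s : 'S_l) :
  (forall c, (0 < c <= l)%N -> (al c <= c - K.+1)%N) ->
  (forall c, (0 < c <= l)%N -> (c <= al c + pcol s c)%N) ->
  forall c, (0 < c <= l)%N -> (c <= K)%N -> pcol s c = c.
Proof.
move=> alK sup.
have surj c : (0 < c <= l)%N -> exists2 c', (0 < c' <= l)%N & pcol s c' = c.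
  case/andP=> c0 cl; have cl' : (c.-1 < l)%N by rewrite prednK.
  exists (s^-1%g (Ordinal cl')).+1; first by rewrite /= ltn_ord.
  by rewrite pcolE permKV /= prednK.
have le c : (0 < c <= l)%N -> (pcol s c <= K)%N -> (c <= pcol s c)%N.
  by move=> cl sK; have := alK c cl; have := sup c cl; move: sK; clear; lia.
move=> c; have [m] := ubnP c; elim: m c => // m IHm c cm cl cK.
(* The row c' that is sent to column c satisfies c' <= c; if c' < c, it would be fixed by the
   induction hypothesis. *)
have [c' cl' ec'] := surj c cl.
have c'c : (c' <= c)%N by rewrite -[X in (_ <= X)%N]ec' le // ec'.
move: c'c; rewrite leq_eqVlt => /orP[/eqP ecc|lt]; first by rewrite -{1}ecc ec'.
have := IHm c' (leq_trans lt cm) cl' (leq_trans (ltnW lt) cK).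
by rewrite ec' => ecc; rewrite ecc ltnn in lt.
Qed.

End Determinants.

(** * Flagged Schur determinants with an inserted factor *)

Section FlaggedSchur.

Variable A : lam3_algebra.
Variable l : nat.
Local Notation g := (@gen A).
Implicit Types (al n : seq nat) (W v : A).

Definition frow al n (c p : nat) : A :=
  elem (part n c) ((part al c)%:Z + p%:Z - c%:Z).

Definition faug al n (j : nat) W (c p : nat) : A :=
  frow al n c p * (if c == j then W else 1).

Definition fschur al n j W : A := dsum l (faug al n j W).

Definition with_row al n (j : nat) (h : nat -> A) (c p : nat) : A :=
  if c == j then h p else frow al n c p.

Lemma fschurE al n j W :
  fschur al n j W = dsum l (with_row al n j (fun p => frow al n j p * W)).
Proof.
apply: eq_bigr => s _; congr (_ * _); apply: eq_bigr => c _.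
by rewrite /faug /with_row; case: eqP => [->|]; rewrite ?mulr1.
Qed.

Lemma fschur1 al n i j : fschur al n i 1 = fschur al n j 1.
Proof.
apply: eq_bigr => s _; congr (_ * _); apply: eq_bigr => c _.
by rewrite /faug !if_same.
Qed.

Lemma frow_lt0 al n c p : (part al c + p < c)%N -> frow al n c p = 0.
Proof. by move=> lt; rewrite /frow elem_lt0 //; move: lt; clear; lia. Qed.

Lemma frow_far al n c p (x : int) : (part n c)%:Z + 3 < x ->
  g x * frow al n c p = frow al n c p * g x.
Proof. by move=> nx; apply: elem_far. Qed.

Lemma prod_far (F : nat -> A) (i : nat) (y : A) :
  (forall c, (0 < c < i)%N -> y * F c = F c * y) ->
  y * (\prod_(1 <= c < i) F c) = (\prod_(1 <= c < i) F c) * y.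
Proof.
move=> yF; rewrite big_nat_cond; apply: (big_rec (fun z => y * z = z * y)).
  by rewrite mulr1 mul1r.
by move=> c z /andP[ci _] yz; rewrite mulrA yF // -!mulrA yz.
Qed.

Lemma with_row_prod al n j h (s : 'S_l) : (0 < j <= l)%N ->
  \prod_(1 <= c < l.+1) with_row al n j h c (pcol s c) =
  \prod_(1 <= c < j) frow al n c (pcol s c) * h (pcol s j) *
  \prod_(j.+1 <= c < l.+1) frow al n c (pcol s c).
Proof.
move=> jl; rewrite (prod_split _ jl) {2}/with_row eqxx.
by congr (_ * _ * _); apply: eq_big_nat => c ci; rewrite /with_row ifN //; lia.
Qed.

Lemma dsum_with_row_congr v v' al n j h h' : (0 < j <= l)%N ->
  (forall (s : 'S_l) p, v * (\prod_(1 <= c < j) frow al n c (pcol s c) * h p) =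
      v' * (\prod_(1 <= c < j) frow al n c (pcol s c) * h' p)) ->
  v * dsum l (with_row al n j h) = v' * dsum l (with_row al n j h').
Proof.
move=> jl hh; apply: dsum_congr => s.
by rewrite !with_row_prod // !mulrA -!(mulrA _ _ (h _)) -!(mulrA _ _ (h' _)) hh.
Qed.

Lemma elem_swap_row m (a j p : nat) :
  elem m (a%:Z + p%:Z - j.+1%:Z) = elem m (a%:Z + p%:Z - j%:Z - 1) :> A.
Proof. by congr elem; lia. Qed.

(** In row j, e([m]) is replaced by e([m + 1]): the additional terms start with v u_(m+1) = 0. Rows
    j and j + 1 now have the same flag, so [elem_gen_swap] brings u_(m+2) to the front of row j.
    Then e([m]) is restored, the additional terms now containing v u_(m+2) u_(m+1), a central
    multiple of v u_(m+1) u_(m+2) = 0. *)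
Lemma fschur_move v al n (j m : nat) W : (0 < j < l)%N ->
  part al j.+1 = part al j -> part n j = m -> part n j.+1 = m.+1 ->
  (forall c, (0 < c < j)%N -> (part n c + 3 < m.+1)%N) ->
  v * g m.+1 = 0 -> (forall d, W * elem m.+1 d = elem m.+1 d * W) ->
  v * fschur al n j (g m.+2 * W) = v * g m.+2 * fschur al n j W.
Proof.
move=> /[dup] jl /andP[j0 jl'] aj nj nj1 nfar vy Wc.
have jl1 : (0 < j <= l)%N by rewrite j0 ltnW.
have far (x : nat) (s : 'S_l) : (m < x)%N ->
    g x * \prod_(1 <= c < j) frow al n c (pcol s c) =
    \prod_(1 <= c < j) frow al n c (pcol s c) * g x.
  move=> mx; apply: prod_far => c cj; apply: frow_far.
  by have := nfar c cj; move: mx; clear; lia.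
have vxy : v * g m.+2 * g m.+1 = 0.
  rewrite -mulrA (@gen_near_rev _ m.+1 m.+2); last by clear; lia.
  by rewrite mulrA -lam3_cC -!mulrA (mulrA v) vy mul0r mulr0.
pose D p := (part al j)%:Z + p%:Z - j%:Z : int.
rewrite !fschurE.
transitivity (v * dsum l (with_row al n j (fun p => elem m.+1 (D p) * (g m.+2 * W)))).
  apply: dsum_with_row_congr => // s p; rewrite /frow nj -/(D p) elemS.
  rewrite [in RHS]mulrDl [in RHS]mulrDr [in RHS]mulrDr -[LHS]addr0; congr (_ + _).
  by rewrite !mulrA -(mulrA v) -far // mulrA vy !mul0r.
transitivity (v * dsum l (with_row al n j (fun p => g m.+2 * (elem m.+1 (D p) * W)))).
  congr (_ * _); apply: (dsum_swap jl) => [c p /negPf cj _|p p'].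
    by rewrite /with_row cj.
  rewrite /with_row eqxx ifN ?gtn_eqF // /frow aj nj1 !elem_swap_row -!/(D _).
  have mv (x y : A) d : x * (y * W) * elem m.+1 d = x * y * elem m.+1 d * W.
    by rewrite -!mulrA Wc !mulrA.
  have := @elem_gen_swap A m.+1 (D p) (D p' - 1) m.+2.
  rewrite subrK !mv -!mulrBl => -> //; last by clear; lia.
  by rewrite mulrBr !mulrA.
apply: dsum_with_row_congr => // s p; rewrite /frow nj -/(D p) elemS.
rewrite [in LHS]mulrDl [in LHS]mulrDr [in LHS]mulrDr [in LHS]mulrDr -[RHS]addr0; congr (_ + _).
  by rewrite !mulrA -(mulrA v) -far // !mulrA.
by rewrite !mulrA -(mulrA v) -far // mulrA -(mulrA _ _ (g m.+1)) -far // !mulrA vxy !mul0r.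
Qed.

(** The step in alpha compensates the step in the row number, so rows i and i + 1 agree up to the
    inserted [W]. *)
Lemma fschur_eq_flags al n (i : nat) W : (0 < i < l)%N ->
  part al i.+1 = (part al i).+1 -> part n i.+1 = part n i ->
  fschur al n i.+1 W = 0.
Proof.
move=> il ai ni; rewrite fschurE; apply: (dsum_sym_eq0 il) => p p'.
rewrite /with_row ltn_eqF // eqxx /frow ai ni.
have e (x : nat) : (part al i).+1%:Z + x%:Z - i.+1%:Z = (part al i)%:Z + x%:Z - i%:Z.
  by lia.
by rewrite !e !mulrA elemC.
Qed.

Lemma pcol_support al (s : 'S_l) :
  (forall c, (0 < c <= l)%N -> (c <= part al c + pcol s c)%N) \/
  exists2 c, (0 < c <= l)%N & (part al c + pcol s c < c)%N.
Proof.
have [/forallP h|/forallPn[o]] :=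
    boolP [forall o : 'I_l, (o.+1 <= part al o.+1 + pcol s o.+1)%N]; last first.
  by rewrite -ltnNge; right; exists o.+1 => //=.
left=> c /andP[c0 cl]; have cl' : (c.-1 < l)%N by rewrite prednK.
by have := h (Ordinal cl'); rewrite /= prednK.
Qed.

(** With e([m + 1]) in place of e([m]), row i agrees with row i + 1 up to [W] and the determinant is
    0. The difference consists of terms with u_(m+1) right after the factors before i; [supp] kills
    them for the permutations without a negative index, and the other permutations give 0 anyway. *)
Lemma fschur_succ_flags v al n (i m : nat) W : (0 < i < l)%N ->
  part al i.+1 = (part al i).+1 -> part n i = m -> part n i.+1 = m.+1 ->
  (forall s : 'S_l, (forall c, (0 < c <= l)%N -> (c <= part al c + pcol s c)%N) ->
     v * (\prod_(1 <= c < i) frow al n c (pcol s c) * g m.+1) = 0) ->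
  v * fschur al n i.+1 W = 0.
Proof.
move=> /[dup] il /andP[i0 il'] ai ni ni1 supp.
have il1 : (0 < i <= l)%N by rewrite i0 ltnW.
pose D p := (part al i)%:Z + p%:Z - i%:Z : int.
pose f := with_row al n i.+1 (fun p => frow al n i.+1 p * W).
pose f1 c p := if c == i then elem m.+1 (D p) else f c p.
rewrite fschurE -/f.
transitivity (v * dsum l f1); last first.
  rewrite (@dsum_sym_eq0 _ _ _ i il) ?mulr0 // => p p'.
  rewrite /f1 eqxx ifN ?gtn_eqF // /f /with_row eqxx /frow ni1 ai.
  have e (x : nat) : (part al i).+1%:Z + x%:Z - i.+1%:Z = D x by rewrite /D; lia.
  by rewrite !e !mulrA elemC.
apply: dsum_congr => s; have [sup|[c cl lt]] := pcol_support al s; last first.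
  rewrite !(prod_eq0 cl) ?mulr0 //.
    rewrite /f1 /f /with_row; case: eqP => [ec|_].
      by rewrite elem_lt0 // /D -ec; move: lt; clear; lia.
    by case: eqP => [<-|_]; rewrite frow_lt0 ?mul0r.
  by rewrite /f /with_row; case: eqP => [<-|_]; rewrite frow_lt0 ?mul0r.
rewrite !(prod_split _ il1).
have eP h : (forall c p, (c < i)%N -> h c p = frow al n c p) ->
    \prod_(1 <= c < i) h c (pcol s c) = \prod_(1 <= c < i) frow al n c (pcol s c).
  by move=> hf; apply: eq_big_nat => c /andP[_ ci]; apply: hf.
have lti c : (c < i)%N -> (c == i.+1) = false by move=> ci; apply/eqP; move: ci; clear; lia.
rewrite !eP; last 2 first.
- by move=> c p ci; rewrite /f1 /f /with_row ltn_eqF // lti.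
- by move=> c p ci; rewrite /f /with_row lti.
have -> : \prod_(i.+1 <= c < l.+1) f1 c (pcol s c) =
    \prod_(i.+1 <= c < l.+1) f c (pcol s c).
  by apply: eq_big_nat => c /andP[ci _]; rewrite /f1 gtn_eqF.
rewrite {1}/f /f1 eqxx /with_row ltn_eqF // {2}/frow ni -/(D _) elemS.
have vP := supp s sup; rewrite mulrA in vP.
by rewrite mulrDr mulrDl mulrDr !mulrA vP !mul0r addr0.
Qed.

(** The factor e([m]) of row j may be enlarged to e([m + 2]), the polynomial of row j + 1: including
    u_(m+1) changes nothing since u_(m+1)^2 = 0, and including u_(m+2) adds terms containing v
    u_(m+2) = 0. *)
Lemma with_row_eq0 v al n (j m : nat) W : (0 < j < l)%N ->
  part al j.+1 = (part al j).+1 -> part n j = m -> part n j.+1 = m.+2 ->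
  (forall c, (0 < c < j)%N -> (part n c + 3 < m.+2)%N) ->
  v * g m.+2 = 0 -> (forall d, W * elem m.+2 d = elem m.+2 d * W) ->
  v * dsum l (with_row al n j (fun p => g m.+1 * frow al n j p * W)) = 0.
Proof.
move=> /[dup] jl /andP[j0 jl'] aj nj nj1 nfar vy Wc.
have jl1 : (0 < j <= l)%N by rewrite j0 ltnW.
pose D p := (part al j)%:Z + p%:Z - j%:Z : int.
transitivity (v * dsum l (with_row al n j (fun p => g m.+1 * (elem m.+2 (D p) * W)))).
  apply: dsum_with_row_congr => // s p; rewrite /frow nj -/(D p).
  set P := \prod_(1 <= c < j) _.
  have far : g m.+2 * P = P * g m.+2.
    apply: prod_far => c cj; apply: frow_far.
    by have := nfar c cj; clear; lia.
  have e1 : g m.+1 * elem m (D p) = g m.+1 * elem m.+1 (D p).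
    by rewrite elemS mulrDr mulrA gen_sq mul0r addr0.
  have vP : v * P * g m.+2 = 0 by rewrite -mulrA -far mulrA vy mul0r.
  have e2 : v * P * g m.+1 * g m.+2 = 0.
    rewrite -mulrA (@gen_near _ m.+1 m.+2); last by clear; lia.
    by rewrite mulrA -lam3_cVC -!mulrA (mulrA P) !(mulrA v) vP mul0r mulr0.
  rewrite e1 [elem m.+2 _]elemS; move: (elem m.+1 _) (elem m.+1 _) => E1 E2.
  by rewrite mulrDl !mulrDr !mulrA e2 !mul0r addr0.
rewrite (@dsum_sym_eq0 _ _ _ j jl) ?mulr0 // => p p'.
rewrite /with_row eqxx ifN ?gtn_eqF // /frow nj1 aj.
have e (x : nat) : (part al j).+1%:Z + x%:Z - j.+1%:Z = D x by rewrite /D; lia.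
by rewrite !e -!mulrA !Wc !(mulrA _ _ W) elemC.
Qed.

Lemma fschur_unfold al n al' n' (j m : nat) W : (0 < j <= l)%N ->
  part n j = m.+1 -> part n' j = m -> (0 < part al j)%N -> part al' j = (part al j).-1 ->
  (forall c, (0 < c)%N -> c != j -> part n' c = part n c /\ part al' c = part al c) ->
  fschur al n j W = fschur al n' j W +
    dsum l (with_row al' n' j (fun p => g m.+1 * frow al' n' j p * W)).
Proof.
move=> /[dup] jl /andP[j0 jl'] nj nj' aj aj' other.
rewrite !fschurE; apply: dsumD => s; rewrite !with_row_prod //.
have eq_rows F G (i k : nat) : (forall c, (0 < c)%N -> c != j -> F c = G c :> A) ->
    (0 < i)%N -> (k <= j)%N || (j < i)%N ->
    \prod_(i <= c < k) F c = \prod_(i <= c < k) G c.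
  move=> FG i0 ik; apply: eq_big_nat => c cik.
  apply: FG; first by case/andP: cik => /(leq_trans i0).
  by apply: contraTneq ik => <-; move: cik; clear; lia.
have e1 c : (0 < c)%N -> c != j -> frow al n' c (pcol s c) = frow al n c (pcol s c).
  by move=> c0 /(other _ c0)[en _]; rewrite /frow en.
have e2 c : (0 < c)%N -> c != j -> frow al' n' c (pcol s c) = frow al n c (pcol s c).
  by move=> c0 /(other _ c0)[en ea]; rewrite /frow en ea.
rewrite !(eq_rows _ _ 1%N j e1, eq_rows _ _ 1%N j e2) ?leqnn //.
rewrite !(eq_rows _ _ j.+1 l.+1 e1, eq_rows _ _ j.+1 l.+1 e2) ?ltnSn ?orbT //.
rewrite -mulrDl -mulrDr -mulrDl /frow nj nj' aj' elemS.
rewrite (_ : (part al j)%:Z + _ - _ - 1 =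
  (part al j).-1%:Z + (pcol s j)%:Z - j%:Z) //.
by move: aj; clear; lia.
Qed.

(** Standing before factor j is the same as standing after factor j - 1, and [W] joins [x] there by
    commuting with factor j. *)
Lemma with_row_fschur_pred al n (j : nat) (x : A) W : (1 < j <= l)%N ->
  (forall p, W * frow al n j p = frow al n j p * W) ->
  dsum l (with_row al n j (fun p => x * frow al n j p * W)) =
  fschur al n j.-1 (x * W).
Proof.
case/andP=> j1 jl Wc; have [i ej] : exists i, j = i.+1 by exists j.-1; lia.
subst j; rewrite fschurE /=; have il : (0 < i < l)%N by rewrite jl andbT.
apply: eq_bigr => s _; congr (_ * _); rewrite !(prod_split2 _ il).
congr (_ * _ * _).
- apply: eq_big_nat => c /andP[_ ci]; rewrite /with_row !ifN //; move: ci; clear; lia.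
- by rewrite /with_row !eqxx ltn_eqF // gtn_eqF // -(mulrA x) -Wc !mulrA.
apply: eq_big_nat => c /andP[ci _]; rewrite /with_row !ifN //; move: ci; clear; lia.
Qed.

(** With trivial factors before j, both [x] and [W] leave the determinant on the left. The index i
    is arbitrary because only 1 is inserted on the right-hand side. *)
Lemma with_row_fschur_left al n (j i : nat) (x : A) W : (0 < j <= l)%N ->
  (forall p, W * frow al n j p = frow al n j p * W) ->
  (forall s : 'S_l, (forall c, (0 < c <= l)%N -> (c <= part al c + pcol s c)%N) ->
     \prod_(1 <= c < j) frow al n c (pcol s c) = 1) ->
  dsum l (with_row al n j (fun p => x * frow al n j p * W)) =
  x * W * fschur al n i 1.
Proof.
move=> jl Wc triv; rewrite (fschur1 _ _ i j) fschurE -[LHS]mul1r.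
apply: dsum_congr => s; have [sup|[c cl lt]] := pcol_support al s; last first.
  rewrite !(prod_eq0 cl) ?mulr0 //; rewrite /with_row; case: eqP => [<-|_];
  by rewrite frow_lt0 ?(mulr0, mul0r).
by rewrite !with_row_prod // triv // !mul1r mulr1 -(mulrA x) -Wc !mulrA.
Qed.

End FlaggedSchur.

(** * Shapes *)

Lemma part_set (s : seq nat) (j x c : nat) : (0 < j)%N -> (0 < c)%N ->
  part (set_nth 0%N s j.-1 x) c = if c == j then x else part s c.
Proof.
move=> j0 c0; rewrite /part nth_set_nth /= -(inj_eq succn_inj) !prednK //.
Qed.

Lemma part_default (s : seq nat) c : (size s < c)%N -> part s c = 0%N.
Proof. by move=> sc; rewrite /part nth_default // -ltnS (ltn_predK sc). Qed.

Lemma part_geq (s : seq nat) c c' : sorted geq s -> (0 < c <= c')%N ->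
  (part s c' <= part s c)%N.
Proof.
move=> ss /andP[c0 cc']; have [sc|cs] := ltnP (size s) c'; first by rewrite part_default.
have := @sorted_leq_nth _ geq (fun y x z => (fun h1 h2 => leq_trans h2 h1))
  (fun x => leqnn x) 0%N s ss c.-1 c'.-1; rewrite !inE.
by apply; move: c0 cc' cs; clear; lia.
Qed.

Lemma part_leq (s : seq nat) c c' : sorted leq s -> (0 < c <= c')%N ->
  (c' <= size s)%N -> (part s c <= part s c')%N.
Proof.
move=> ss /andP[c0 cc'] cs.
have := @sorted_leq_nth _ leq (fun y x z => @leq_trans y x z)
  (fun x => leqnn x) 0%N s ss c.-1 c'.-1; rewrite !inE.
by apply; move: c0 cc' cs; clear; lia.
Qed.

Lemma mem_skew (lam al : seq nat) (r c : nat) : size al = size lam ->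
  ((r, c) \in diagram lam `\` diagram al) =
  (0 < c <= size lam)%N && (part al c < r <= part lam c)%N.
Proof.
move=> sz; rewrite in_fsetD !in_diagram /= sz.
case: (0 < c <= size lam)%N => //=.
by case: (posnP r) => [->|r0]; rewrite ?ltn0 ?andbF //= -ltnNge.
Qed.

(* Condition (i), in a form that is checked more easily for the smaller shapes met in
   the induction. For j = size lam + 1 all the parts of al are 0. *)
Record flag_shape (lam al : seq nat) (j j' : nat) : Prop := FlagShape {
  fs_size : size al = size lam;
  fs_j0 : (0 < j)%N;
  fs_jj' : (j <= j'.+1)%N;
  fs_j'l : (j' <= size lam)%N;
  fs_low : forall c, (0 < c < j)%N -> part al c = (part al c.+1).-1;
  fs_rep : (j < j')%N -> part al j.+1 = part al j;
  fs_high : forall c, (j < c < j')%N -> part al c.+1 = (part al c).+1;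
  fs_tail : forall c, (j' < c)%N -> part al c = part lam c;
  fs_lt : forall c, (0 < c <= j')%N -> (part al c < part lam c)%N;
  fs_desc : (part al j.+1 <= part al j)%N;
  fs_top : (0 < j')%N -> (part al j'.+1 <= (part al j').+1)%N;
  fs_pos : (j <= size lam)%N -> (0 < part al j)%N }.

Section Shape.

Variables (lam al : seq nat) (j j' : nat).
Hypothesis lam_sorted : sorted geq lam.
Hypothesis fs : flag_shape lam al j j'.

Lemma fs_leqS c : (0 < c < j')%N -> (part al c <= part al c.+1)%N.
Proof.
case/andP=> c0 cj'; case: (ltngtP c j) => [lt|gt|ec].
- by rewrite (fs_low fs) ?c0 // leq_pred.
- by rewrite (fs_high fs) ?gt // leqnSn.
- by rewrite ec (fs_rep fs) // -ec.
Qed.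

Lemma fs_leq c c' : (0 < c <= c')%N -> (c' <= j')%N -> (part al c <= part al c')%N.
Proof.
case/andP=> c0; elim: c' => [|c' IHc]; first by rewrite leqn0 => /eqP ec; rewrite ec in c0.
rewrite leq_eqVlt => /orP[/eqP -> //|cc'] cj'.
apply: leq_trans (IHc cc' (ltnW cj')) _; apply: fs_leqS.
by rewrite (leq_trans c0).
Qed.

Lemma fs_mem (r c : nat) : ((r, c) \in diagram lam `\` diagram al) =
  (0 < c <= j')%N && (part al c < r <= part lam c)%N.
Proof.
rewrite mem_skew ?(fs_size fs) //; case: (leqP c j') => cj'.
  by rewrite (leq_trans cj' (fs_j'l fs)).
rewrite (fs_tail fs) // !andbF /=; case: (0 < c <= size lam)%N => //=.
by rewrite ltnNge; case: (r <= part lam c)%N; rewrite ?andbF.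
Qed.

Lemma fs_sw_closed : sw_closed (diagram lam `\` diagram al).
Proof.
split=> [[r c]|[r c] [r' c'] [p s]]; first by rewrite fs_mem => /andP[/andP[]].
rewrite !fs_mem /= => /andP[/andP[c0 cj] /andP[h1 h2]] /andP[/andP[c0' cj'] /andP[h1' h2']].
move=> /andP[rp pr'] s0 sc sc'; rewrite s0 (leq_trans sc cj) /=.
rewrite (leq_trans pr') ?(leq_trans h2') ?part_geq ?s0 // andbT.
by apply: leq_trans rp; apply: leq_trans h1; rewrite ltnS fs_leq ?s0.
Qed.

Lemma fs_border c : (0 < c <= j')%N ->
  border_cell al c \in diagram lam `\` diagram al.
Proof. by move=> cj; rewrite fs_mem cj ltnSn (fs_lt fs). Qed.

Lemma fs_pred : (1 < j)%N -> (j <= size lam)%N -> part al j = (part al j.-1).+1.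
Proof.
move=> j1 jl; have := fs_low fs (c := j.-1).
rewrite prednK; last by rewrite ltnW.
move=> ->; last by move: j1; clear; lia.
by rewrite prednK ?(fs_pos fs).
Qed.

(** The predecessor in [fs_low] is truncated, which covers the initial zeros as well as the run of
    consecutive integers; going down from a value at most 1, only zeros are met. *)
Lemma fs_zero c : (0 < c < j)%N -> (part al j <= 1)%N -> part al c = 0%N.
Proof.
case/andP=> c0 cj aj; have [d ed] : exists d, j = (c + d).+1.
  by exists (j - c.+1)%N; move: cj; clear; lia.
elim: d c c0 cj ed => [|d IHd] c c0 cj ed.
  rewrite (fs_low fs) ?c0 // (_ : c.+1 = j) -?subn1; last by rewrite ed addn0.
  by apply/eqP; rewrite subn_eq0.
rewrite (fs_low fs) ?c0 // (IHd c.+1) //; rewrite ed; clear; lia.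
Qed.

(** This serves as the hypothesis of [pcol_fix] with K = j - 1. After the repetition at j + 1 the
    parts grow by at most 1 per column up to j' + 1, and from there on they are parts of [lam] and
    do not increase. *)
Lemma fs_bound c : (part al j <= 1)%N -> (0 < c)%N -> c != j -> (part al c <= c - j)%N.
Proof.
move=> aj c0; rewrite neq_ltn => /orP[cj|jc]; first by rewrite fs_zero ?c0.
have high d : (j + d < j')%N -> (part al (j + d).+1 <= d.+1)%N.
  elim: d => [|d IHd] lt; first by rewrite addn0 (fs_rep fs) // -[j]addn0.
  have lt' : (j + d < j')%N by move: lt; clear; lia.
  rewrite addnS (fs_high fs) ?ltnS ?IHd //; move: lt; clear; lia.
have [cj'|j'c] := leqP c j'.
  have [d ed] : exists d, c = (j + d).+1 by exists (c - j.+1)%N; move: jc; clear; lia.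
  have lt : (j + d < j')%N by rewrite -ed.
  by rewrite ed; apply: leq_trans (high d lt) _; clear; lia.
have top : (part al j'.+1 <= (j'.+1 - j))%N || (j == j'.+1).
  have [->|nej] := eqVneq j j'.+1; first by rewrite orbT.
  have jj' : (j <= j')%N by move: (fs_jj' fs) nej; clear; lia.
  rewrite orbF; move: jj'; rewrite leq_eqVlt => /orP[/eqP ej|lt].
    by rewrite -ej; apply: leq_trans (fs_desc fs) _; rewrite subSnn.
  apply: leq_trans (fs_top fs _) _; first by move: lt; clear; lia.
  have [d ed] : exists d, j' = (j + d).+1 by exists (j' - j.+1)%N; move: lt; clear; lia.
  have lt' : (j + d < j')%N by rewrite ed.
  have := high d lt'; rewrite -ed; move: ed; clear; lia.
have cl : (part al c <= part al j'.+1)%N.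
  by rewrite !(fs_tail fs) //; apply: part_geq; rewrite // j'c.
case/orP: top => [top|/eqP ej].
  by apply: leq_trans cl (leq_trans top _); rewrite leq_sub2r.
apply: leq_trans cl _; rewrite -ej; apply: leq_trans aj _.
by rewrite subn_gt0.
Qed.

End Shape.

Definition dec (s : seq nat) (j : nat) : seq nat := set_nth 0%N s j.-1 (part s j).-1.

Lemma part_dec s j c : (0 < j)%N -> (0 < c)%N ->
  part (dec s j) c = if c == j then (part s j).-1 else part s c.
Proof. exact: part_set. Qed.

Lemma part_dec_eq s j : (0 < j)%N -> part (dec s j) j = (part s j).-1.
Proof. by move=> j0; rewrite part_dec // eqxx. Qed.

Lemma part_dec_neq s j c : (0 < j)%N -> (0 < c)%N -> c != j -> part (dec s j) c = part s c.
Proof. by move=> j0 c0 /negPf cj; rewrite part_dec // cj. Qed.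

Lemma size_dec s j : (0 < j <= size s)%N -> size (dec s j) = size s.
Proof. by case/andP=> j0 js; rewrite size_set_nth prednK //; apply/maxn_idPr. Qed.

Lemma sumn_dec s j : (0 < j <= size s)%N -> (0 < part s j)%N ->
  (sumn (dec s j)).+1 = sumn s.
Proof.
case: j => // j /= js pj; rewrite /dec /= sumn_set_nth js /part /=.
have : (nth 0 s j <= sumn s)%N.
  by rewrite -[X in sumn X](cat_take_drop j) sumn_cat (drop_nth 0%N) //= addnCA leq_addr.
by move: pj; rewrite /part /=; lia.
Qed.

(** * The shape after the last cell of column j is removed *)

Section DecShape.

Variables (lam al : seq nat) (j j' : nat).
Hypothesis lam_sorted : sorted geq lam.
Hypothesis lam_gt0 : forall c, (0 < c <= size lam)%N -> (0 < part lam c)%N.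
Hypothesis fs : flag_shape lam al j j'.
Hypothesis jl : (j <= size lam)%N.

Let j0 : (0 < j)%N := fs_j0 fs.
Let pos : (0 < part al j)%N := fs_pos fs jl.

Lemma dec_tail c : (maxn j j' < c)%N -> part (dec al j) c = part lam c.
Proof.
rewrite gtn_max => /andP[jc j'c].
by rewrite part_dec_neq ?gtn_eqF ?(leq_trans _ jc) // (fs_tail fs).
Qed.

Lemma dec_lt c : (0 < c <= maxn j j')%N -> (part (dec al j) c < part lam c)%N.
Proof.
case/andP=> c0 cj; rewrite part_dec //; case: eqP => [->|/eqP nej].
  have [jj'|j'j] := leqP j j'.
    by apply: leq_ltn_trans (leq_pred _) (fs_lt fs _); rewrite j0.
  by rewrite -(fs_tail fs) // ltn_predL.
apply: (fs_lt fs); rewrite c0 /=; have := fs_jj' fs.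
by move: cj nej; rewrite leq_max; clear; lia.
Qed.

Lemma dec_top : (part (dec al j) (maxn j j').+1 <= (part (dec al j) (maxn j j')).+1)%N.
Proof.
have [j'j|jj'] := leqP j' j.
  by rewrite part_dec_eq // part_dec_neq ?gtn_eqF // prednK //; apply: (fs_desc fs).
have j'0 : (0 < j')%N by apply: leq_ltn_trans jj'.
rewrite !part_dec_neq ?gtn_eqF ?(fs_top fs) //.
exact: ltn_trans jj' _.
Qed.

(** Columns j - 1 and j get the same height, so the repetition moves one column to the left; 1 <
    alpha_j keeps that height positive. If j was j' + 1, column j enters the skew shape, whence
    [maxn j j']. *)
Lemma dec_shape_left : (1 < j)%N -> (1 < part al j)%N ->
  flag_shape lam (dec al j) j.-1 (maxn j j').
Proof.
move=> j1 a1; have aj := fs_pred fs j1 jl.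
have j10 : (0 < j.-1)%N by move: j1; clear; lia.
have nej : j.-1 != j by move: j1; clear; lia.
split=> //.
- by rewrite size_dec (fs_size fs) // j0.
- by apply: leq_trans (leq_pred j) (leq_trans (leq_maxl j j') (leqnSn _)).
- by rewrite geq_max jl (fs_j'l fs).
- move=> c /andP[c0 cj]; have cj1 : (c.+1 < j)%N by move: cj; clear; lia.
  have cj2 := ltnW cj1; rewrite !part_dec_neq ?ltn_eqF //.
  by apply: (fs_low fs); rewrite c0.
- by move=> _; rewrite prednK // part_dec_eq // part_dec_neq // aj.
- move=> c /andP[jc cj]; have {}jc : (j <= c)%N by move: jc; clear; lia.
  have c0 : (0 < c)%N by apply: leq_trans jc.
  have cj' : (c < j')%N by move: cj; rewrite leq_max; move: jc; clear; lia.
  rewrite part_dec_neq ?gtn_eqF //; move: jc; rewrite leq_eqVlt => /orP[/eqP ec|jc].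
    by rewrite -ec in cj' *; rewrite part_dec_eq // prednK // (fs_rep fs).
  by rewrite part_dec_neq ?gtn_eqF // (fs_high fs) // jc.
- exact: dec_tail.
- exact: dec_lt.
- by rewrite prednK // part_dec_eq // part_dec_neq // aj.
- by move=> _; apply: dec_top.
- by move=> _; rewrite part_dec_neq //; move: a1; rewrite aj.
Qed.

(** Lowering column j destroys the repetition, and no new one arises on its left: that part is empty
    or consists of zeros. The columns up to J then form a single run, as in the second form of
    alpha. *)
Lemma dec_shape_right : j = 1%N \/ part al j = 1%N ->
  exists2 j2, flag_shape lam (dec al j) j2 (maxn j j') & (maxn j j' <= j2)%N.
Proof.
set J := maxn j j' => j1; set al' := dec al j.
have Jl : (J <= size lam)%N by rewrite geq_max jl (fs_j'l fs).
have jJ : (j <= J)%N := leq_maxl j j'.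
have J0 : (0 < J)%N := leq_trans j0 jJ.
have low c : (0 < c < J)%N -> part al' c = (part al' c.+1).-1.
  case/andP=> c0 cJ; case: (ltngtP c j) => [cj|jc|ec].
  - have a1 : part al j = 1%N by case: j1 => // ej; move: c0 cj; rewrite ej; clear; lia.
    rewrite part_dec_neq ?ltn_eqF // (fs_zero fs) ?c0 ?a1 // part_dec //.
    by case: eqP => [_|/eqP nej]; rewrite ?a1 // (fs_zero fs) ?a1 //; move: nej cj; clear; lia.
  - have cj' : (c < j')%N by move: cJ; rewrite leq_max; move: jc; clear; lia.
    by rewrite !part_dec_neq ?gtn_eqF ?(fs_high fs) ?jc //; apply: ltn_trans jc _.
  - have jj' : (j < j')%N by move: cJ; rewrite leq_max ec; clear; lia.
    by rewrite ec part_dec_eq // part_dec_neq ?gtn_eqF // (fs_rep fs).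
have szl : size al' = size lam by rewrite size_dec (fs_size fs) // j0.
(* The new j is J if there is a positive part at J followed by one that is not larger, and J + 1
   otherwise. *)
have [/andP[x0 yx]|nyx] := boolP ((0 < part al' J)%N && (part al' J.+1 <= part al' J)%N).
  exists J => //; split=> //; try by move=> c; apply: dec_tail.
  - by rewrite ltnn.
  - by move=> c /andP[/ltn_trans h /h]; rewrite ltnn.
  - exact: dec_lt.
  - by move=> _; apply: dec_top.
exists J.+1; last exact: leqnSn.
split=> //; try by move=> c; apply: dec_tail.
- move=> c /andP[c0]; rewrite ltnS leq_eqVlt => /orP[/eqP ->|cJ]; last by rewrite low ?c0.
  by have := dec_top; rewrite -/J -/al'; move: nyx; clear; lia.
- by rewrite ltnNge leqnSn.
- by move=> c /andP[/ltn_trans h /h]; rewrite ltnNge leqnSn.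
- exact: dec_lt.
- by rewrite !dec_tail ?part_geq //= ltnS.
- by move=> _; apply: dec_top.
- by move=> Jl'; rewrite dec_tail // lam_gt0.
Qed.

End DecShape.

(** * Tableaux extending R *)

Lemma in_interval (m : nat) (x : int) : (x \in Defs.interval m) = (0 < x <= m%:Z).
Proof.
apply/imfsetP/idP => [[i /= + ->]|/andP[x0 xm]].
  by rewrite mem_iota; lia.
by exists `|x|%N; rewrite /= ?mem_iota; lia.
Qed.

Section Extending.

Variables (lam al n : seq nat) (j j' : nat) (R : tableau).
Hypothesis lam_sorted : sorted geq lam.
Hypothesis fs : flag_shape lam al j j'.
Local Notation theta := (diagram lam `\` diagram al).
Hypothesis R_rsst : is_rsst theta R.

Lemma fs_le c : (0 < c)%N -> (part al c <= part lam c)%N.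
Proof.
move=> c0; have [cj|jc] := leqP c j'; first by rewrite ltnW // (fs_lt fs) ?c0.
by rewrite (fs_tail fs).
Qed.

Lemma diagram_sub z : z \in diagram al -> z \in diagram lam.
Proof.
rewrite !in_diagram (fs_size fs) => /andP[/andP[c0 ->] /andP[-> le]].
by rewrite c0 (leq_trans le) // fs_le.
Qed.

Lemma in_extendingP T : T \in rsst_extending lam al n R <->
  [/\ is_rsst (diagram lam) T, {in theta, entry T =1 entry R} &
      forall z, z \in diagram al -> 0 < entry T z <= (part n z.2)%:Z].
Proof.
rewrite in_rsst_extending; split=> -[Trsst TR Ttab]; split=> //.
- by move=> z zt; rewrite -TR entry_restrict zt.
- move=> z za; rewrite -in_interval; have := Ttab.2 z za.
  by rewrite entry_restrict za.
- apply: tableauP => [|z].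
    rewrite domf_restrict R_rsst.1 Trsst.1; apply/fsetIidPl; exact: fsubsetDl.
  by rewrite domf_restrict in_fsetI => /andP[zt _]; rewrite entry_restrict zt TR.
- split=> [|z za]; last by rewrite entry_restrict za in_interval Ttab.
  rewrite domf_restrict Trsst.1; apply/fsetIidPl/fsubsetP => z; exact: diagram_sub.
Qed.

End Extending.

Section ExtendingDec.

Variables (lam al n : seq nat) (j j' : nat) (R : tableau).
Hypothesis lam_sorted : sorted geq lam.
Hypothesis fs : flag_shape lam al j j'.
Local Notation theta := (diagram lam `\` diagram al).
Local Notation al' := (dec al j).
Local Notation n' := (dec n j).
Local Notation theta' := (diagram lam `\` diagram al').
Local Notation z0 := ((part al j, j) : cell).
Local Notation R' := (R.[z0 <- (part n j)%:Z]).
Hypothesis R_rsst : is_rsst theta R.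
Hypothesis jl : (j <= size lam)%N.
Variables (j2 : nat).
Hypothesis fs' : flag_shape lam al' j2 (maxn j j').

Let j0 : (0 < j)%N := fs_j0 fs.
Let pos : (0 < part al j)%N := fs_pos fs jl.

Lemma z0_in : z0 \in diagram al.
Proof. by rewrite in_diagram /= j0 pos (fs_size fs) jl leqnn. Qed.

Lemma z0_notin : z0 \notin theta.
Proof. by rewrite in_fsetD z0_in. Qed.

Lemma in_diagram_dec z : (z \in diagram al) = (z == z0) || (z \in diagram al').
Proof.
case: z => r c; rewrite !in_diagram /= size_dec ?(fs_size fs) ?j0 //.
rewrite xpair_eqE; case: (posnP c) => [->|c0]; first by rewrite (ltn_eqF j0) andbF.
rewrite part_dec //; have [->|nej] := eqVneq c j; last by rewrite andbF.
rewrite jl andbT /=; move: pos; clear; lia.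
Qed.

Lemma in_skew_dec z : (z \in theta') = (z == z0) || (z \in theta).
Proof.
have z0n : z0 \notin diagram al'.
  by rewrite in_diagram /= part_dec_eq // ; move: pos; clear; lia.
rewrite !in_fsetD in_diagram_dec negb_or; have [->|] := eqVneq z z0; last by [].
by rewrite z0n /=; apply: (diagram_sub fs); exact: z0_in.
Qed.

Lemma R'_entry z : z \in theta -> entry R' z = entry R z.
Proof.
move=> zt; rewrite entry_set; case: eqP => // ez.
by rewrite ez (negPf z0_notin) in zt.
Qed.

Lemma R'_z0 : entry R' z0 = (part n j)%:Z.
Proof. by rewrite entry_set eqxx. Qed.

(** The border cells of columns j, j - 1 and j + 1 are directly south, west and southeast of the new
    cell. Comparing with these is enough, since R controls the entries further away and has no cell
    weakly northeast of the new one. *)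
Lemma R'_rsst :
  ((j <= j')%N -> (part n j)%:Z < entry R (border_cell al j)) ->
  ((1 < j)%N -> entry R (border_cell al j.-1) < (part n j)%:Z) ->
  ((j < j')%N -> (part n j)%:Z + 3 <= entry R (border_cell al j.+1)) ->
  is_rsst theta' R'.
Proof.
move=> H1 H2 H3; have fmem := fs_mem fs; have sw := fs_sw_closed lam_sorted fs.
have K (r c : nat) : (r, c) \in theta ->
    [/\ c = j -> (part al j < r)%N /\ (part n j)%:Z < entry R (r, c),
        r = part al j -> (c < j)%N /\ entry R (r, c) < (part n j)%:Z,
        (part al j < r)%N -> (j < c)%N -> (part n j)%:Z + 3 <= entry R (r, c) &
        (r < part al j)%N -> (c < j)%N -> entry R (r, c) + 3 <= (part n j)%:Z].
  move=> zt; have := zt; rewrite fmem => /andP[/andP[c0 cj'] /andP[acr rc]].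
  have leftP : (c < j)%N -> [/\ (1 < j)%N, (c <= j.-1)%N &
      (part al j, j.-1) \in theta] /\ border_cell al j.-1 = (part al j, j.-1).
    move=> cj; have j1 : (1 < j)%N by apply: leq_trans cj.
    have bj : border_cell al j.-1 = (part al j, j.-1) by rewrite (fs_pred fs).
    split=> //; split=> //; first by move: cj; clear; lia.
    rewrite -bj; apply: (fs_border fs); have := fs_jj' fs; move: j1; clear; lia.
  split.
  - move=> ec; subst c; split=> //; have jj' : (j <= j')%N by [].
    move: acr; rewrite leq_eqVlt => /orP[/eqP <-|lt]; first exact: H1.
    apply: lt_trans (H1 jj') _; apply: (rsst_col R_rsst) => //.
    by apply: (fs_border fs); rewrite j0.
  - move=> er; subst r; have cj : (c < j)%N.
      rewrite ltnNge; apply/negP => jc; move: acr; rewrite ltnNge => /negP; apply.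
      by apply: (fs_leq fs); rewrite ?j0.
    split=> //; have [[j1 cj1 bt] eb] := leftP cj; have := H2 j1; rewrite eb.
    move: cj1; rewrite leq_eqVlt => /orP[/eqP -> //|cj1].
    by apply: lt_trans; apply: (rsst_row R_rsst).
  - move=> ar jc; have jj' : (j < j')%N by apply: leq_trans cj'.
    apply: le_trans (H3 jj') _.
    have bt : border_cell al j.+1 \in theta by apply: (fs_border fs).
    have ebt : border_cell al j.+1 = ((part al j).+1, j.+1).
      by rewrite /border_cell (fs_rep fs).
    rewrite ebt in bt *.
    have mt : (r, j.+1) \in theta by apply: (dom_rowP sw zt).
    have le1 : entry R ((part al j).+1, j.+1) <= entry R (r, j.+1).
      move: ar; rewrite leq_eqVlt => /orP[/eqP <- //|lt].
      by apply/ltW/(rsst_col R_rsst).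
    apply: le_trans le1 _; move: jc; rewrite leq_eqVlt => /orP[/eqP <- //|lt].
    by apply/ltW/(rsst_row R_rsst).
  - move=> ra cj; have [[j1 cj1 bt] eb] := leftP cj; have := H2 j1; rewrite eb.
    move: cj1; rewrite leq_eqVlt => /orP[/eqP ec|cj1].
      by exfalso; move: acr ra; rewrite ec (fs_pred fs j1 jl); clear; lia.
    by have := rsst_se R_rsst zt bt ra cj1; clear; lia.
split.
  by apply/fsetP => z; rewrite dom_setf in_fset1U in_skew_dec R_rsst.1.
move=> [r c] [r' c']; rewrite !in_skew_dec => /predU1P[ez|zt] /predU1P[ez'|zt'].
- by rewrite ez ez'; split=> //= _; rewrite ltnn.
- rewrite ez R'_z0 (R'_entry zt'); have [K1 K2 K3 K4] := K _ _ zt'.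
  split=> /=.
  + by move=> /esym /K1[].
  + by move=> /esym /K2[lt _]; rewrite ltnNge (ltnW lt).
  + move=> /and3P[_ /= le1 le2] ne1 ne2; apply: K3; rewrite ltn_neqAle ?le1 ?le2 andbT.
      by apply/eqP.
    by apply/eqP.
- rewrite ez' R'_z0 (R'_entry zt); have [K1 K2 K3 K4] := K _ _ zt.
  split=> /=.
  + by move=> /K1[lt _]; rewrite ltnNge (ltnW lt).
  + by move=> /K2[].
  + move=> /and3P[_ /= le1 le2] ne1 ne2; apply: K4; rewrite ltn_neqAle ?le1 ?le2 andbT.
      by apply/eqP.
    by apply/eqP.
- by rewrite !R'_entry //; exact: R_rsst.2.
Qed.

(** As [z0] has the largest entry of its column in alpha', lowering the flag by 1 only forbids the
    entry n_j at [z0]; once [z0] has this entry, the cells above respect the lowered flag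
    automatically. *)
Lemma entry_lt_z0 T r : is_rsst (diagram lam) T -> (r, j) \in diagram al ->
  (r < part al j)%N -> entry T (r, j) < entry T z0.
Proof.
move=> Trsst ra; apply: (rsst_col Trsst); apply: (diagram_sub fs) => //.
exact: z0_in.
Qed.

Lemma extending_dec_neq T : T \in rsst_extending lam al n' R <->
  T \in rsst_extending lam al n R /\ entry T z0 != (part n j)%:Z.
Proof.
split.
  move=> /(in_extendingP n' fs R_rsst)[Trsst TR Tn].
  have Tz0 := Tn _ z0_in; rewrite /= part_dec_eq // in Tz0; split; last first.
    by apply/eqP; move: Tz0; clear; lia.
  apply/(in_extendingP n fs R_rsst); split=> // -[r c] za.
  have := Tn _ za; have := za; rewrite in_diagram /= => /andP[/andP[c0 _] _].
  rewrite part_dec //; case: eqP => [->|_] //; clear; lia.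
move=> [/(in_extendingP n fs R_rsst)[Trsst TR Tn] /eqP ne].
apply/(in_extendingP n' fs R_rsst); split=> // -[r c] za.
have := Tn _ za; have := za; rewrite in_diagram /= => /andP[/andP[c0 _] /andP[_ rc]].
rewrite part_dec //; case: eqP => [ec|_] //; subst c.
have := Tn _ z0_in; rewrite /= => Tz0.
move: rc; rewrite leq_eqVlt => /orP[/eqP er|lt].
  by rewrite er; move: Tz0 ne; clear; lia.
move: (entry_lt_z0 Trsst za lt) Tz0; move: (entry T (r, j)) (entry T z0) => x y.
by clear; lia.
Qed.

Lemma extending_dec_eq T : (0 < part n j)%N -> is_rsst theta' R' ->
  T \in rsst_extending lam al' n' R' <->
  T \in rsst_extending lam al n R /\ entry T z0 = (part n j)%:Z.
Proof.
move=> nj Rr; split.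
  move=> /(in_extendingP n' fs' Rr)[Trsst TR Tn].
  have Tz0 : entry T z0 = (part n j)%:Z by rewrite TR ?R'_z0 // in_skew_dec eqxx.
  split=> //; apply/(in_extendingP n fs R_rsst); split=> //.
    by move=> z zt; rewrite TR ?R'_entry // in_skew_dec zt orbT.
  move=> z; rewrite in_diagram_dec => /predU1P[->|]; first by rewrite Tz0 /=; move: nj; clear; lia.
  case: z => r c za; have := Tn _ za; move: za; rewrite in_diagram /= => /andP[/andP[c0 _] _].
  by rewrite part_dec //; case: eqP => [->|_] //; clear; lia.
move=> [/(in_extendingP n fs R_rsst)[Trsst TR Tn] Tz0].
apply/(in_extendingP n' fs' Rr); split=> //.
  move=> z; rewrite in_skew_dec => /predU1P[->|zt]; first by rewrite R'_z0.
  by rewrite R'_entry ?TR.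
move=> [r c] za'; have za : (r, c) \in diagram al by rewrite in_diagram_dec za' orbT.
have := Tn _ za; have := za'; rewrite in_diagram /= => /andP[/andP[c0 _] /andP[_]].
rewrite !part_dec //; case: eqP => [ec|_] // ra; subst c.
have lt : (r < part al j)%N by move: ra pos; clear; lia.
move: (entry_lt_z0 Trsst za lt); rewrite Tz0; move: (entry T (r, j)) => x.
by clear; lia.
Qed.

Lemma sum_extending (A : zmodType) (F : tableau -> A) :
  (0 < part n j)%N -> is_rsst theta' R' ->
  \sum_(T <- rsst_extending lam al n R) F T =
  \sum_(T <- rsst_extending lam al n' R) F T +
  \sum_(T <- rsst_extending lam al' n' R') F T.
Proof.
move=> nj Rr; rewrite -big_cat; apply: perm_big; apply: uniq_perm.
- exact: fset_uniq.
- rewrite cat_uniq !fset_uniq /= andbT; apply/hasPn => T.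
  move=> /(extending_dec_eq _ nj Rr)[_ e]; apply/negP => /extending_dec_neq[_].
  by rewrite e eqxx.
- move=> T; rewrite mem_cat; apply/idP/orP => [Text|[]].
  + have [e|ne] := eqVneq (entry T z0) (part n j)%:Z.
      by right; apply/(extending_dec_eq _ nj Rr).
    by left; apply/extending_dec_neq.
  + by move/extending_dec_neq => [].
  + by move/(extending_dec_eq _ nj Rr) => [].
Qed.

End ExtendingDec.

(** * The induction *)

Lemma mon_elem_comm (A : lam3_algebra) (s : seq int) m d :
  (forall x : int, x \in s -> m%:Z + 3 < x) -> mon s * elem m d = elem m d * mon s :> A.
Proof.
elim: s => [|x s IHs] hs; first by rewrite mon_nil mul1r mulr1.
rewrite mon_cons -mulrA IHs; last by move=> y ys; apply: hs; rewrite inE ys orbT.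
by rewrite !mulrA elem_far // hs ?mem_head.
Qed.

(** The hypotheses of the theorem with j and j' as parameters tied to alpha by [flag_shape], so that
    they pass to smaller alpha without computing a new minimum and maximum. *)
Record flag_data (lam al n : seq nat) (j j' : nat) (R : tableau) (v w : seq cell) : Prop :=
FlagData {
  fd_shape : flag_shape lam al j j';
  fd_rsst : is_rsst (diagram lam `\` diagram al) R;
  fd_reading : reading_word R (v ++ w);
  fd_square : square_respecting R (v ++ w);
  fd_sub : subseq w [seq border_cell al c | c <- iota j.+1 (j' - j)];
  fd_first : (j < j')%N ->
    entry R (border_cell al j) + 1 < entry R (border_cell al j.+1) ->
    border_cell al j.+1 \in w;
  fd_nsize : size n = size lam;
  fd_nsorted : sorted leq n;
  fd_n : forall c, (0 < c <= j')%N ->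
    (part n c)%:Z = entry R (border_cell al c) - 1 \/
    [/\ c = j, ohead (letters R w) <> Some (entry R (border_cell al j) + 1)
      & (part n c)%:Z < entry R (border_cell al c) - 1] }.

Section Data.

Variable A : lam3_algebra.
Local Notation g := (@gen A).
Variables (lam al n : seq nat) (j j' : nat) (R : tableau) (v w : seq cell).
Hypothesis lam_sorted : sorted geq lam.
Hypothesis fd : flag_data lam al n j j' R v w.

Local Notation theta := (diagram lam `\` diagram al).
Local Notation r c := (entry R (border_cell al c)).
Let fs := fd_shape fd.
Let sw := fs_sw_closed lam_sorted fs.
Let rs := fd_rsst fd.

Lemma fd_nlow c : (0 < c <= j')%N -> c != j -> (part n c)%:Z = r c - 1.
Proof. by move=> cj /eqP ne; case: (fd_n fd cj) => // -[/ne]. Qed.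

Lemma fd_nj : (j <= j')%N -> (part n j)%:Z <= r j - 1.
Proof. by move=> jj'; case: (fd_n fd (c := j)) => [|->//|[_ _ /ltW]//]; rewrite (fs_j0 fs). Qed.

Lemma fd_nmono c c' : (0 < c <= c')%N -> (c' <= size lam)%N -> (part n c <= part n c')%N.
Proof. by rewrite -(fd_nsize fd); apply: part_leq; exact: fd_nsorted fd. Qed.

Lemma r_step c : (0 < c < j')%N -> part al c.+1 = (part al c).+1 -> r c + 3 <= r c.+1.
Proof.
case/andP=> c0 cj ac; apply: (rsst_se rs); rewrite ?ac //.
  by apply: (fs_border fs); rewrite c0 ltnW.
by rewrite -ac; apply: (fs_border fs).
Qed.

Lemma r_rep : (j < j')%N -> r j < r j.+1.
Proof.
move=> jj'; have bj1 : border_cell al j.+1 \in theta by apply: (fs_border fs).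
rewrite /border_cell (fs_rep fs) //; apply: (rsst_row rs) => //.
  by apply: (fs_border fs); rewrite (fs_j0 fs) ltnW.
by move: bj1; rewrite /border_cell (fs_rep fs).
Qed.

Lemma r_high c : (j.+1 < c <= j')%N -> r j.+1 + 3 <= r c.
Proof.
case/andP=> jc cj; have [d ed] : exists d, c = (j.+1 + d).+1.
  by exists (c - j.+2)%N; move: jc; clear; lia.
subst c; elim: d cj {jc} => [|d IHd] cj.
  rewrite addn0 in cj *; apply: r_step => //.
  by rewrite (fs_high fs) // ltnSn.
have lt : (j.+1 + d < j')%N by move: cj; clear; lia.
apply: le_trans (IHd lt) _; rewrite addnS in cj *.
have := r_step (c := (j.+1 + d).+1); rewrite cj (fs_high fs) ?cj; last by clear; lia.
by move=> /(_ isT erefl); clear; lia.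
Qed.

Lemma w_border z : z \in w -> exists2 c, (j < c <= j')%N & z = border_cell al c.
Proof.
move=> /(mem_subseq (fd_sub fd))/mapP[c]; rewrite mem_iota => jc ->; exists c => //.
by move: jc; clear; lia.
Qed.

Lemma w_letter x : x \in letters R w -> (j < j')%N /\ r j.+1 <= x.
Proof.
move=> /mapP[z /w_border[c /andP[jc cj] ->] ->].
split; first exact: leq_trans cj.
move: jc; rewrite leq_eqVlt => /orP[/eqP <- //|jc].
by have := r_high (c := c); rewrite jc cj => /(_ isT); clear; lia.
Qed.

Lemma w_letter3 z : z \in w -> z != border_cell al j.+1 -> r j.+1 + 3 <= entry R z.
Proof.
move=> /w_border[c /andP[jc cj] ->] ne; apply: r_high; rewrite cj andbT.
by rewrite ltn_neqAle jc andbT; apply: contraNneq ne => ->.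
Qed.

Lemma w_uniq : uniq w.
Proof. by have := zs_uniq (fd_reading fd); rewrite cat_uniq => /and3P[]. Qed.

Lemma border_in_v c : (0 < c <= j)%N -> (c <= j')%N -> border_cell al c \in v.
Proof.
case/andP=> c0 cj cj'.
have : border_cell al c \in v ++ w.
  by rewrite (mem_zs rs (fd_reading fd)) (fs_border fs) ?c0.
rewrite mem_cat => /orP[//|/w_border[c' /andP[jc _] [_ ec]]].
by move: cj; rewrite ec leqNgt jc.
Qed.

(** The border goes down one row from column j - 1 to j, so r_(j-1) + 3 <= r_j, while n_c <= n_(j-1)
    = r_(j-1) - 1. Letters from r_j on therefore commute with the factors before j. *)
Lemma fd_low_far c : (0 < c < j)%N -> (j <= j')%N -> (part n c)%:Z + 3 < r j.
Proof.
case/andP=> c0 cj jj'; have jl : (j <= size lam)%N := leq_trans jj' (fs_j'l fs).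
have j1 : (1 < j)%N by apply: leq_trans cj.
have aj := fs_pred fs j1 jl.
have ej : j.-1.+1 = j by rewrite prednK ?(fs_j0 fs).
have j10 : (0 < j.-1)%N by move: j1; clear; lia.
have h1 : (part n c <= part n j.-1)%N.
  by apply: fd_nmono; rewrite ?c0; move: cj jl; clear; lia.
have h2 : (part n j.-1)%:Z = r j.-1 - 1.
  by apply: fd_nlow; move: j10 jj'; clear; lia.
have h3 : r j.-1 + 3 <= r j.-1.+1.
  by apply: r_step; rewrite ?ej // j10.
by rewrite ej in h3; move: h1 h2 h3; clear; lia.
Qed.

(** The only cell of R weakly northeast of the border cell of column j, other than itself, is its
    eastern neighbour, with entry r_j + 1, so [border_eq0] applies. *)
Lemma v_rj_eq0 : (j < j')%N -> r j.+1 = r j + 1 ->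
  mon (letters R v) * g (r j) = 0.
Proof.
move=> jj' er; apply: (border_eq0 A sw rs (fd_reading fd) (fd_square fd)).
  by apply: border_in_v; rewrite ?(fs_j0 fs) ?leqnn // ltnW.
move=> [p c]; rewrite (fs_mem fs) => /andP[/andP[c0 cj] /andP[acp _]].
move=> /and3P[ne /= pa jc].
have ac : (part al c <= part al j)%N by move: acp pa; clear; lia.
have ep : p = (part al j).+1.
  apply/eqP; rewrite eqn_leq pa; apply: leq_ltn_trans acp.
  by apply: (fs_leq fs); rewrite ?(fs_j0 fs).
have jc' : (j < c)%N.
  by rewrite ltn_neqAle jc andbT; apply: contraNneq ne => <-; rewrite ep.
have ec : c = j.+1.
  apply/eqP; rewrite eqn_leq jc' andbT leqNgt; apply/negP => jc2.
  have := fs_leq fs (c := j.+2) (c' := c); rewrite jc2 cj => /(_ isT isT).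
  have -> : part al j.+2 = (part al j).+1.
    by rewrite (fs_high fs) ?(fs_rep fs) // ltnSn (leq_trans jc2 cj).
  by move: ac; clear; lia.
have -> : (p, c) = border_cell al j.+1 by rewrite ec ep /border_cell (fs_rep fs).
rewrite er -/(border_cell al j) /dist3; move: (r j) => x.
by apply/eqP; clear; lia.
Qed.

(** As alpha_j = alpha_(j-1) + 1, no other cell of R lies weakly northeast of the border cell of
    column j - 1. *)
Lemma v_rpred_eq0 : (1 < j <= size lam)%N ->
  mon (letters R v) * g (r j.-1) = 0.
Proof.
case/andP=> j1 jl; have aj := fs_pred fs j1 jl.
have j10 : (0 < j.-1)%N by move: j1; clear; lia.
apply: (border_eq0 A sw rs (fd_reading fd) (fd_square fd)).
  apply: border_in_v; rewrite ?j10 ?leq_pred //.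
  by have := fs_jj' fs; move: j1; clear; lia.
move=> [p c]; rewrite (fs_mem fs) => /andP[/andP[c0 cj] /andP[acp _]].
move=> /and3P[ne /= pa jc]; exfalso.
have ac : (part al c <= part al j.-1)%N by move: acp pa; clear; lia.
have [cj1|jc1] := ltnP c j.
  have ec : c = j.-1 by move: cj1 jc; clear; lia.
  move: ne; rewrite ec; case/negP; apply/eqP; congr (_, _).
  by move: acp pa; rewrite ec; clear; lia.
have := fs_leq fs (c := j) (c' := c); rewrite (fs_j0 fs) jc1 cj => /(_ isT isT).
by move: ac; rewrite aj; clear; lia.
Qed.

(** The cell b must be the border cell of column j + 1, so r_(j+1) = r_j + 1 and [fd_first] becomes
    vacuous; the exception in (v) is excluded, which gives the flags required by [fschur_move]. The
    letters left in w' are at least r_j + 4, so a second move is never called for. *)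
Lemma fd_move b w' : w = b :: w' -> entry R b = r j + 1 ->
  [/\ flag_data lam al n j j' R (rcons v b) w',
      ohead (letters R w') <> Some (r j + 1) &
      mon (letters R v) * fschur (size lam) al n j (mon (letters R w)) =
      mon (letters R (rcons v b)) * fschur (size lam) al n j (mon (letters R w')) :> A].
Proof.
move=> ew eb; have bw : b \in w by rewrite ew mem_head.
have [jj' le1] : (j < j')%N /\ r j.+1 <= entry R b by apply: w_letter; apply: map_f.
have lt1 := r_rep jj'.
have er : r j.+1 = r j + 1 by move: le1 lt1; rewrite eb; clear; lia.
have ebj : b = border_cell al j.+1.
  apply/eqP; apply: contraT => ne; have := w_letter3 bw ne.
  by rewrite eb er; clear; lia.
have far z : z \in w' -> r j + 4 <= entry R z.
  move=> zw'; have zw : z \in w by rewrite ew inE zw' orbT.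
  have ne : z != border_cell al j.+1.
    by rewrite -ebj; apply: contraTneq zw' => ->; have := w_uniq; rewrite ew => /andP[].
  by have := w_letter3 zw ne; rewrite er; clear; lia.
have nj : (part n j)%:Z = r j - 1.
  case: (fd_n fd (c := j)) => [|//|[_ + _]]; first by rewrite (fs_j0 fs) ltnW.
  by rewrite ew /= eb.
have nj1 : (part n j.+1)%:Z = r j.+1 - 1 by apply: fd_nlow; rewrite ?gtn_eqF.
split.
- split=> //; rewrite ?cat_rcons -?ew; try by case: fd.
  + by have := fd_sub fd; rewrite ew; apply: subseq_trans; apply: subseq_cons.
  + by rewrite er ltxx.
  + move=> c cj; have [->|ne] := eqVneq c j; first by left.
    by left; apply: fd_nlow.
- case: w' ew far => [|z w'] //= _ far [] ez.
  by have := far z (mem_head _ _); rewrite ez; clear; lia.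
rewrite ew /letters map_rcons /= mon_cons mon_rcons eb.
have e1 : r j = (part n j).+1%:Z by move: nj; clear; lia.
have e2 : r j + 1 = (part n j).+2%:Z by rewrite e1; clear; lia.
rewrite e2; apply: (@fschur_move A (size lam) _ al n j (part n j)) => //.
- by rewrite (fs_j0 fs) (leq_trans jj') ?(fs_j'l fs).
- exact: fs_rep fs jj'.
- by move: nj1; rewrite er e1; clear; lia.
- by move=> c cj; have := fd_low_far cj (ltnW jj'); rewrite e1; clear; lia.
- by rewrite -e1 v_rj_eq0.
- move=> d; apply: mon_elem_comm => x /mapP[z /far]; rewrite e1 => + ->.
  by clear; lia.
Qed.

End Data.

Lemma index_insert (T : eqType) (v w : seq T) x y z :
  y != x -> z != x -> (index y (v ++ x :: w) < index z (v ++ x :: w))%N =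
  (index y (v ++ w) < index z (v ++ w))%N.
Proof.
move=> /negPf yx /negPf zx; rewrite !index_cat /= ![x == _]eq_sym yx zx.
case: (boolP (y \in v)) => yv; case: (boolP (z \in v)) => zv.
- by [].
- have yv' : (index y v < size v)%N by rewrite index_mem.
  by rewrite !(leq_trans yv') ?leq_addr.
- have zv' : (index z v < size v)%N by rewrite index_mem.
  by rewrite !ltnNge !(leq_trans (ltnW zv')) ?leq_addr.
- by rewrite !ltn_add2l ltnS.
Qed.

(** * The tableau with one more cell and its reading word *)

Section Step.

Variables (lam al n : seq nat) (j j' : nat) (R : tableau) (v w : seq cell).
Hypothesis lam_sorted : sorted geq lam.
Hypothesis fd : flag_data lam al n j j' R v w.
Hypothesis jl : (j <= size lam)%N.

Local Notation theta := (diagram lam `\` diagram al).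
Local Notation r c := (entry R (border_cell al c)).
Local Notation al' := (dec al j).
Local Notation n' := (dec n j).
Local Notation z0 := ((part al j, j) : cell).
Local Notation R' := (R.[z0 <- (part n j)%:Z]).
Let fs := fd_shape fd.
Let rs := fd_rsst fd.
Let j0 : (0 < j)%N := fs_j0 fs.
Let pos : (0 < part al j)%N := fs_pos fs jl.

Lemma w_head : border_cell al j.+1 \in w ->
  ohead (letters R w) = Some (r j.+1).
Proof.
move=> bw; have jj' : (j < j')%N.
  by have [] := w_letter fd (map_f (entry R) bw).
have := fd_sub fd; rewrite (_ : j' - j = (j' - j.+1).+1)%N; last by rewrite -subnSK.
case: w bw => // z w' bw /=; case: eqP => [-> //|_ sub].
have := mem_subseq sub bw => /mapP[c]; rewrite mem_iota => /andP[jc _] [_ ec].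
by rewrite ec ltnn in jc.
Qed.

Section AddCell.

Hypothesis no_first : ohead (letters R w) <> Some (r j + 1).

(** The lowered n_j falls under the exception in (v), hence the assumption on the first letter of
    [w]; the gap above n_(j-1) keeps the flags sorted. *)
Lemma fd_dec_flag : (0 < part n j)%N ->
  ((1 < j)%N -> (part n j.-1 < part n j)%N) ->
  flag_data lam al n' j j' R v w.
Proof.
move=> nj njj; have szn : (0 < j <= size n)%N by rewrite j0 (fd_nsize fd).
split; try by case: fd.
- by rewrite size_dec // (fd_nsize fd).
- apply/(sortedP 0%N) => i; rewrite size_dec // => il.
  have H := fd_nmono fd (c := i.+1) (c' := i.+2).
  change (part n' i.+1 <= part n' i.+2)%N; rewrite !part_dec //.
  have {}H : (part n i.+1 <= part n i.+2)%N by apply: H; rewrite ?leqnSn // -(fd_nsize fd).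
  case: eqP => [e1|_]; case: eqP => [e2|_] //.
  + by rewrite -e1; apply: leq_trans (leq_pred _) H.
  + have j1 : (1 < j)%N by rewrite -e2.
    by have := njj j1; rewrite -e2 /=; clear; lia.
- move=> c cj; rewrite part_dec //; last by case/andP: cj.
  have [ec|ne] := eqVneq c j; last by left; apply: (fd_nlow fd).
  right; split=> //; subst c; have := fd_nj fd; case/andP: cj => _ cj /(_ cj).
  by move: nj; clear; lia.
Qed.

Hypothesis H2 : (1 < j)%N -> r j.-1 < (part n j)%:Z.
Hypothesis H3 : (j < j')%N -> (part n j)%:Z + 3 <= r j.+1.

Variables (j2 : nat).
Hypothesis fs' : flag_shape lam al' j2 (maxn j j').

Lemma step_rsst : is_rsst (diagram lam `\` diagram al') R'.
Proof.
apply: (R'_rsst lam_sorted fs rs jl) => // jj'.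
by have := fd_nj fd jj'; clear; lia.
Qed.

Lemma z0_notin_vw : z0 \notin v ++ w.
Proof. by rewrite (mem_zs rs (fd_reading fd)); exact: (z0_notin fs jl). Qed.

Lemma step_mem z : (z \in v ++ z0 :: w) = (z == z0) || (z \in theta).
Proof.
rewrite -(mem_zs rs (fd_reading fd)) !mem_cat inE.
by case: (z \in v); rewrite ?orbT.
Qed.

Lemma nw_notin z : z \in theta -> (z.1 < part al j)%N -> z.2 = j.-1 -> False.
Proof.
case: z => p c zt /= pa ec; have := zt; rewrite (fs_mem fs) ec => /andP[/andP[c0 _] /andP[ap _]].
have j1 : (1 < j)%N by move: c0; clear; lia.
by move: ap pa; rewrite (fs_pred fs j1 jl); clear; lia.
Qed.

Lemma z0_first z : z \in v -> (index z (v ++ z0 :: w) < index z0 (v ++ z0 :: w))%N.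
Proof.
move=> zv; have := z0_notin_vw; rewrite mem_cat negb_or => /andP[z0v _].
by rewrite !index_cat zv (negPf z0v) /= eqxx addn0 index_mem.
Qed.

Lemma z0_last z : z \in w -> (index z0 (v ++ z0 :: w) < index z (v ++ z0 :: w))%N.
Proof.
move=> zw; have := z0_notin_vw; rewrite mem_cat negb_or => /andP[z0v z0w].
have zv : z \notin v.
  by have := zs_uniq (fd_reading fd); rewrite cat_uniq => /and3P[_ /hasPn/(_ _ zw)].
have ne : (z0 == z) = false by apply: contraNF z0w => /eqP->.
by rewrite !index_cat (negPf zv) (negPf z0v) /= eqxx ne addn0 -addSnnS leq_addr.
Qed.

(** No cell of R is weakly northeast of [z0]. Those weakly southwest are in columns up to j and thus
    in [v], because [w] only has cells from later columns. *)
Lemma step_reading : reading_word R' (v ++ z0 :: w).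
Proof.
have dR z : (z \in domf R') = (z == z0) || (z \in theta).
  by rewrite dom_setf in_fset1U rs.1.
split.
  apply: uniq_perm => [||z]; [|exact: fset_uniq|by rewrite dR step_mem].
  have := zs_uniq (fd_reading fd); have := z0_notin_vw.
  by rewrite -[z0 :: w]cat1s uniq_catCA cat1s /= => -> ->.
move=> z z'; rewrite !dR => /predU1P[->|zt] /predU1P[->|zt'] ne.
- by case/and3P: ne; rewrite eqxx.
- exfalso; case: z' zt' ne => p c; rewrite (fs_mem fs).
  move=> /andP[/andP[c0 cj] /andP[ap _]] /and3P[_ /= pa jc].
  have := fs_leq fs (c := j) (c' := c); rewrite j0 jc cj => /(_ isT isT).
  by move: ap pa; clear; lia.
- apply: z0_first; have : z \in v ++ w by rewrite (mem_zs rs (fd_reading fd)).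
  rewrite mem_cat => /orP[//|/(w_border fd)[c /andP[jc _] ez]].
  by case/and3P: ne => _ _; rewrite ez /= leqNgt jc.
- rewrite index_insert; last 2 first.
  + by apply: contraNneq z0_notin_vw => <-; rewrite (mem_zs rs (fd_reading fd)).
  + by apply: contraNneq z0_notin_vw => <-; rewrite (mem_zs rs (fd_reading fd)).
  exact: (before_ne rs (fd_reading fd) zt zt' ne).
Qed.

(** For [z0] to be the southeast cell or the southwest corner of a square, a cell in the row above
    it, in column j - 1 or j, would have to be in R; both are outside the skew shape. *)
Lemma step_corner (p c : nat) : (p, c) \in domf R' -> (p.+1, c.+1) \in domf R' ->
  [/\ ((p.+1, c.+1) : cell) != z0, ((p.+1, c) : cell) != z0 &
      (p, c) = z0 -> [/\ (j < j')%N, (p.+1, c.+1) = border_cell al j.+1 &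
                         (p.+1, c) = border_cell al j]].
Proof.
rewrite !dom_setf !in_fset1U !rs.1 => zt zt'; split.
- apply: contraTneq zt => -[ep ec]; rewrite !negb_or xpair_eqE.
  rewrite (_ : (c == j) = false) ?andbF /=; last by apply/eqP; move: ec; clear; lia.
  by apply/negP => /nw_notin; rewrite /= -ep -ec; apply.
- apply: contraTneq zt => -[ep ec]; rewrite !negb_or xpair_eqE ec -ep eqxx andbT.
  by rewrite -[X in X && _]negbK (ltn_eqF (ltnSn p)) /= (fs_mem fs) -ep; apply/negP; clear; lia.
move=> [ep ec]; subst p c; move: zt'; rewrite xpair_eqE (gtn_eqF (ltnSn j)) andbF /=.
rewrite (fs_mem fs) => /andP[/andP[_ jj'] _]; split=> //.
by rewrite /border_cell (fs_rep fs).
Qed.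

Lemma mem_dom_step z : (z \in domf R') = (z == z0) || (z \in domf R).
Proof. by rewrite dom_setf in_fset1U. Qed.

Lemma entry_step_neq z : z != z0 -> entry R' z = entry R z.
Proof. by move=> /negPf ne; rewrite entry_set ne. Qed.

Lemma nw_arrow_step t h : t != z0 -> h != z0 -> ((h.1.+1, h.2) : cell) != z0 ->
  nw_arrow R' t h = nw_arrow R t h.
Proof.
move=> tn hn kn; rewrite /nw_arrow !mem_dom_step !entry_step_neq // fnd_set.
by rewrite (negPf tn) (negPf hn) (negPf kn).
Qed.

Lemma se_arrow_step t h : t != z0 -> h != z0 -> ((t.1.+1, t.2) : cell) != z0 ->
  se_arrow R' t h = se_arrow R t h.
Proof.
move=> tn hn kn; rewrite /se_arrow !mem_dom_step !entry_step_neq // fnd_set.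
by rewrite (negPf tn) (negPf hn) (negPf kn).
Qed.

Lemma step_square : square_respecting R' (v ++ z0 :: w).
Proof.
have entry_fnd (T : tableau) z x : T.[? z] == Some x -> entry T z = x by rewrite /entry => /eqP ->.
have z0v z : z \in theta -> z \in v ++ w by rewrite (mem_zs rs (fd_reading fd)).
move=> t h ar; have same : t != z0 -> h != z0 -> nw_arrow R t h || se_arrow R t h ->
    (index t (v ++ z0 :: w) < index h (v ++ z0 :: w))%N.
  by move=> tn hn ar'; rewrite index_insert //; apply: (fd_square fd).
have corner_in : (j < j')%N -> border_cell al j.+1 \in theta by move=> jj'; apply: (fs_border fs).
have nbj : (j < j')%N -> border_cell al j.+1 != z0.
  by move=> jj'; apply: contraNneq z0_notin_vw => <-; rewrite z0v ?corner_in.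
case/orP: ar => ar; have := ar => /and5P[].
  case: h ar same => p c ar same tt ht /eqP et /eqP e3 ek.
  have {}et : t = (p.+1, c.+1) := et; subst t.
  have [tn kn hz] := step_corner ht tt.
  have [eh|hn] := eqVneq ((p, c) : cell) z0; last first.
    by apply: same => //; rewrite -(nw_arrow_step tn hn kn) ar.
  have [jj' et ek'] := hz eh.
  have := entry_fnd _ _ _ ek; rewrite entry_step_neq // ek' eh R'_z0 => ej.
  move: e3; rewrite et eh entry_step_neq ?nbj // R'_z0 => ej1.
  (* If the border cell were in [w], it would be the first cell there, with letter r_j + 1. *)
  apply: z0_first; have := z0v _ (corner_in jj'); rewrite mem_cat => /orP[//|bw].
  by case: no_first; rewrite (w_head bw) ej ej1; congr Some; clear; lia.
case: t ar same => p c ar same tt ht /eqP et /eqP e3 ek.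
have {}et : h = (p.+1, c.+1) := et; subst h.
have [hn kn tz] := step_corner tt ht.
have [et|tn] := eqVneq ((p, c) : cell) z0; last first.
  by apply: same => //; rewrite -(se_arrow_step tn hn kn) ar orbT.
have [jj' eh ek'] := tz et.
have := entry_fnd _ _ _ ek; rewrite entry_step_neq // ek' et R'_z0 => ej.
move: e3; rewrite eh et entry_step_neq ?nbj // R'_z0 => ej1.
apply: z0_last; apply: (fd_first fd jj'); rewrite ej ej1; clear; lia.
Qed.

Lemma step_letters zs : {subset zs <= v ++ w} -> letters R' zs = letters R zs.
Proof.
move=> sub; apply/eq_in_map => z /sub; rewrite (mem_zs rs (fd_reading fd)) => zt.
exact: (R'_entry n R fs jl).
Qed.

Lemma step_border c : (0 < c)%N -> c != j -> border_cell al' c = border_cell al c.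
Proof. by move=> c0 cj; rewrite /border_cell part_dec_neq. Qed.

Lemma step_border_j : border_cell al' j = z0.
Proof. by rewrite /border_cell part_dec_eq // prednK. Qed.

Hypothesis nj : (0 < part n j)%N.

(** Where the enlarged word is divided is left open: the new cell either starts w', or goes with [w]
    into v' and leaves w' empty. The exception in (v) does not arise, since n_j and the border entry
    of column j are now n_j - 1 and n_j. *)
Lemma step_data v' w' : v' ++ w' = v ++ z0 :: w ->
  subseq w' [seq border_cell al' c | c <- iota j2.+1 (maxn j j' - j2)] ->
  ((j2 < maxn j j')%N -> border_cell al' j2.+1 \in w') ->
  flag_data lam al' n' j2 (maxn j j') R' v' w'.
Proof.
move=> ev sub first; have szn : (0 < j <= size n)%N by rewrite j0 (fd_nsize fd).
split=> //; rewrite ?ev.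
- exact: step_rsst.
- exact: step_reading.
- exact: step_square.
- by move=> lt _; apply: first.
- by rewrite size_dec // (fd_nsize fd).
- have [] // := fd_dec_flag nj.
  move=> j1; have e : (part n j.-1)%:Z = r j.-1 - 1.
    by apply: (fd_nlow fd); have := fs_jj' fs; move: j1; clear; lia.
  by have := H2 j1; move: e; clear; lia.
- move=> c /andP[c0 cJ]; left; have [->|ne] := eqVneq c j.
    by rewrite step_border_j R'_z0 part_dec_eq //; move: nj; clear; lia.
  have cj' : (c <= j')%N.
    by have := fs_jj' fs; move: cJ ne; rewrite leq_max; clear; lia.
  rewrite step_border // part_dec_neq // (R'_entry n R fs jl); last first.
    by apply: (fs_border fs); rewrite c0.
  by apply: (fd_nlow fd); rewrite ?c0.
Qed.

End AddCell.

End Step.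

(** * The case alpha = 0 and the boundary cases *)

Section Vanishing.

Variable A : lam3_algebra.
Local Notation g := (@gen A).
Variables (lam al n : seq nat) (j j' : nat) (R : tableau) (v w : seq cell).
Hypothesis lam_sorted : sorted geq lam.
Hypothesis fd : flag_data lam al n j j' R v w.

Local Notation r c := (entry R (border_cell al c)).
Local Notation z0 := ((part al j, j) : cell).
Let fs := fd_shape fd.
Let rs := fd_rsst fd.

Lemma sum_extending_eq0 (F : tableau -> A) :
  (forall T, T \in rsst_extending lam al n R -> False) ->
  \sum_(T <- rsst_extending lam al n R) F T = 0.
Proof. by move=> h; rewrite big_seq big1 // => T /h. Qed.

(** For alpha = 0 the entry in row c and column p has index p - c, so only the identity permutation
    contributes and gives 1, while R is the only tableau; [reading_words_eq] compares the two
    words. *)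
Lemma expansion_base : (size lam < j)%N ->
  mon (letters R v) * fschur (size lam) al n j (mon (letters R w)) =
  \sum_(T <- rsst_extending lam al n R) mon (sqread T) :> A.
Proof.
move=> lj; have ej : j = (size lam).+1.
  by have := fs_jj' fs; have := fs_j'l fs; move: lj; clear; lia.
have ej' : j' = size lam.
  by have := fs_jj' fs; have := fs_j'l fs; move: lj; clear; lia.
have w0 : w = [::].
  have := fd_sub fd; rewrite ej ej' (_ : (size lam - (size lam).+1 = 0)%N); last by clear; lia.
  by rewrite subseq0 => /eqP.
have al0 c : (0 < c)%N -> part al c = 0%N.
  move=> c0; have aj : part al j = 0%N by rewrite part_default // (fs_size fs).
  have [cj|jc] := ltnP c j; first by rewrite (fs_zero fs) ?c0 ?aj.
  by rewrite part_default // (fs_size fs) (leq_trans lj).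
have -> : fschur (size lam) al n j (mon (letters R w)) = 1 :> A.
  rewrite w0 /= mon_nil fschurE /dsum (bigD1 1%g) //= odd_perm1 expr0 mul1r.
  have row1 (s : 'S_(size lam)) c : (0 < c)%N -> pcol s c = c ->
      with_row al n j (fun p => frow A al n j p * 1) c (pcol s c) = 1.
    move=> c0 sc; rewrite /with_row sc; case: eqP => [<-|_]; rewrite ?mulr1 /frow al0 //;
    by rewrite add0r subrr elem0.
  rewrite big_nat_cond big1 => [|c /andP[/andP[c0 cl] _]]; last first.
    apply: row1 => //; case: c c0 cl => // c _ cl.
    by have := pcolE 1%g (Ordinal (cl : (c < size lam)%N)); rewrite perm1.
  rewrite big1 ?addr0 // => s s1.
  have [sup|[c cl lt]] := pcol_support al s.
    case/negP: s1; apply/eqP/permP => o; apply/val_inj; rewrite perm1.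
    have := pcol_fix (K := size lam) (al := part al) _ sup (c := o.+1).
    rewrite pcolE ltn_ord => e; apply: succn_inj; apply: e => // c /andP[c0 _].
    by rewrite al0.
  rewrite (prod_eq0 cl) ?mulr0 // /with_row.
  by case: eqP => [<-|_]; rewrite frow_lt0 ?mul0r.
have Rext T : (T \in rsst_extending lam al n R) = (T == R).
  have dal0 : diagram al = fset0.
    apply/fsetP => -[p c]; rewrite in_diagram in_fset0 /=; case: (posnP c) => //= c0.
    by rewrite al0 //; move: c0; clear; lia.
  have dl : diagram lam `\` diagram al = diagram lam by rewrite dal0 fsetD0.
  apply/idP/eqP => [/(in_extendingP n fs rs)[Trs TR _]|->].
    apply: tableauP; first by rewrite Trs.1 rs.1 dl.
    by move=> z zT; apply: TR; rewrite dl -Trs.1.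
  apply/(in_extendingP n fs rs); split=> //; first by have := rs; rewrite dl.
  by move=> z; rewrite dal0.
have -> : rsst_extending lam al n R = [fset R].
  by apply/fsetP => T; rewrite Rext in_fset1.
rewrite big_seq_fset1 mulr1 sqreadE.
have rd := fd_reading fd; have sq := fd_square fd; rewrite w0 cats0 in rd sq.
by apply: (reading_words_eq A (fs_sw_closed lam_sorted fs) rs) => //;
  [exact: sqcells_reading | exact: sqcells_square].
Qed.

Hypothesis jl : (j <= size lam)%N.
Let j0 : (0 < j)%N := fs_j0 fs.
Let pos : (0 < part al j)%N := fs_pos fs jl.

(** The entry of [z0] would have to exceed its western neighbour r_(j-1) = n_(j-1) + 1, so there is
    no tableau. Rows j - 1 and j either agree up to the inserted word or become so after adding
    u_(r_(j-1)), which [v] kills. *)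
Lemma expansion_flag_low : (1 < j)%N -> (part n j <= (part n j.-1).+1)%N ->
  mon (letters R v) * fschur (size lam) al n j (mon (letters R w)) =
  \sum_(T <- rsst_extending lam al n R) mon (sqread T) :> A.
Proof.
move=> j1 njj; have aj := fs_pred fs j1 jl.
have [i ej] : exists i, j = i.+1 by exists j.-1; rewrite prednK.
have i0 : (0 < i)%N by move: j1; rewrite ej.
have ij' : (i <= j')%N by have := fs_jj' fs; rewrite ej.
have ni : (part n i)%:Z = r i - 1 by apply: (fd_nlow fd); rewrite ?i0 // ej; clear; lia.
rewrite ej /= in njj aj.
have nmono : (part n i <= part n i.+1)%N.
  by apply: (fd_nmono fd); rewrite ?i0 ?leqnSn // -ej.
rewrite sum_extending_eq0; last first.
  move=> T /(in_extendingP n fs rs)[Trs TR Tn].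
  have bi : border_cell al i \in diagram lam `\` diagram al by apply: (fs_border fs); rewrite i0.
  have zin := z0_in fs jl; have := Tn _ zin; have := TR _ bi.
  have : entry T (border_cell al i) < entry T z0.
    rewrite /border_cell -aj -ej; apply: (rsst_row Trs); last by rewrite ej.
      by move: bi; rewrite /border_cell -aj -ej in_fsetD => /andP[].
    exact: (diagram_sub fs).
  by rewrite /= ej; move: ni njj; clear; lia.
have il : (0 < i < size lam)%N by rewrite i0 -ej.
rewrite ej; have [en|nen] := eqVneq (part n i.+1) (part n i).
  by rewrite fschur_eq_flags // mulr0.
have en : part n i.+1 = (part n i).+1 by move: nmono njj nen; clear; lia.
have eri : (part n i).+1%:Z = r i by move: ni; clear; lia.
have vr : mon (letters R v) * g (r i) = 0.
  have := v_rpred_eq0 A lam_sorted fd; rewrite j1 jl => /(_ isT).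
  by rewrite {1}ej.
apply: (fschur_succ_flags (m := part n i)) => // s sup; rewrite eri.
(* The letter r_i has to pass the factors before i. If alpha_i = 0, the preceding border cells are
   in the same row and may have close entries, but those factors are 1; otherwise the border goes
   down and the flags are far below r_i. *)
have [ai0|ai0] := posnP (part al i).
  have fixs : forall c, (0 < c <= size lam)%N -> (c <= i.-1)%N -> pcol s c = c.
    apply: (pcol_fix (al := part al)) => // c /andP[c0 cl].
    have aj1 : (part al j <= 1)%N by rewrite ej aj ai0.
    have [->|ne] := eqVneq c j.
      by rewrite (leq_trans aj1) // ej prednK // subSnn.
    by apply: leq_trans (fs_bound lam_sorted fs aj1 c0 ne) _; rewrite ej prednK // leq_sub2l.
  rewrite big_nat_cond big1 ?mul1r // => c /andP[/andP[c0 ci] _].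
  rewrite fixs; last 2 first.
  - by rewrite c0 (leq_trans (ltnW ci)) // ltnW //; case/andP: il.
  - by move: ci i0; clear; lia.
  rewrite /frow (fs_zero fs) ?add0r ?subrr ?elem0 //.
    by rewrite c0 ej ltnW.
  by rewrite ej aj ai0.
rewrite -prod_far ?mulrA ?vr ?mul0r // => c /andP[c0 ci]; apply: frow_far; rewrite -eri.
have [k ek] : exists k, i = k.+1 by exists i.-1; rewrite prednK.
have k0 : (0 < k)%N by move: c0 ci; rewrite ek; clear; lia.
have ak : part al k.+1 = (part al k).+1.
  have := fs_low fs (c := k); rewrite -ek => ->; first by rewrite prednK.
  by rewrite k0 ej ek ltnW.
have rk : r k + 3 <= r i.
  by have := r_step fd (c := k); rewrite -ek => -> //; rewrite ?k0 // -?ak ?ek // -ek.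
have nk : (part n k)%:Z = r k - 1.
  by apply: (fd_nlow fd); rewrite ?k0 ?(leq_trans _ ij') // ?ej ?ek //; clear; lia.
have nck : (part n c <= part n k)%N.
  by apply: (fd_nmono fd); [move: c0 ci; rewrite ek; clear; lia|
     move: jl; rewrite ej ek; clear; lia].
by move: rk nk nck eri; clear; lia.
Qed.

(** The first factor is e_d of the empty set with d >= alpha_1 > 0, and no entry fits into column
    1. *)
Lemma expansion_flag0 : j = 1%N -> part n j = 0%N ->
  mon (letters R v) * fschur (size lam) al n j (mon (letters R w)) =
  \sum_(T <- rsst_extending lam al n R) mon (sqread T) :> A.
Proof.
move=> ej nj; rewrite sum_extending_eq0; last first.
  move=> T /(in_extendingP n fs rs)[_ _ /(_ _ (z0_in fs jl))].
  by rewrite /= nj; clear; lia.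
rewrite fschurE /dsum big1 ?mulr0 // => s _.
rewrite (prod_eq0 (c := j)) ?mulr0 ?j0 // /with_row eqxx /frow nj /=.
have l0 : (0 < size lam)%N by apply: leq_trans jl.
have -> : pcol s j = (s (Ordinal l0)).+1 by rewrite ej -[1%N]/((Ordinal l0).+1) pcolE.
rewrite (_ : (_ == 0) = false) ?mul0r //; apply/eqP.
by move: (pos); rewrite ej; clear; lia.
Qed.

End Vanishing.

(** * The induction step *)

Section Expansion.

Variable A : lam3_algebra.
Local Notation g := (@gen A).
Variable lam : seq nat.
Hypothesis lam_sorted : sorted geq lam.
Hypothesis lam_gt0 : forall c, (0 < c <= size lam)%N -> (0 < part lam c)%N.

Definition expands al n (j : nat) (R : tableau) (v w : seq cell) : Prop :=
  mon (letters R v) * fschur (size lam) al n j (mon (letters R w)) =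
  \sum_(T <- rsst_extending lam al n R) mon (sqread T) :> A.

Lemma expansion_step al n j j' R v w :
  flag_data lam al n j j' R v w ->
  (forall al1 n1 j1 j1' R1 v1 w1, flag_data lam al1 n1 j1 j1' R1 v1 w1 ->
     (sumn al1 + sumn n1 < sumn al + sumn n)%N -> expands al1 n1 j1 R1 v1 w1) ->
  ohead (letters R w) <> Some (entry R (border_cell al j) + 1) ->
  expands al n j R v w.
Proof.
move=> fd IH no_first; have fs := fd_shape fd; have rs := fd_rsst fd.
have [jl|lj] := leqP j (size lam); last exact: (expansion_base A lam_sorted fd lj).
have j0 := fs_j0 fs; have pos := fs_pos fs jl.
have j01 : (0 < j <= size lam)%N by rewrite j0.
have szn : (0 < j <= size n)%N by rewrite (fd_nsize fd).
have sza : (0 < j <= size al)%N by rewrite (fs_size fs).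
have [/andP[j1 njj]|far] :=
    boolP ((1 < j)%N && (part n j <= (part n j.-1).+1)%N).
  exact: (expansion_flag_low A lam_sorted fd jl).
have {}far : (1 < j)%N -> ((part n j.-1).+1 < part n j)%N.
  by move=> j1; rewrite ltnNge; apply: contra far => ->; rewrite j1.
have [nj0|nj] := posnP (part n j).
  apply: (expansion_flag0 A fd jl) => //; apply/eqP; rewrite eqn_leq j0 andbT leqNgt.
  by apply/negP => /far; rewrite nj0.
have [m em] : exists m, part n j = m.+1 by exists (part n j).-1; rewrite prednK.
have H2 : (1 < j)%N -> entry R (border_cell al j.-1) < (part n j)%:Z.
  move=> j1; have e : (part n j.-1)%:Z = entry R (border_cell al j.-1) - 1.
    by apply: (fd_nlow fd); have := fs_jj' fs; move: j1; clear; lia.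
  by have := far j1; move: e; clear; lia.
have sn : (sumn (dec n j) < sumn n)%N by rewrite -(sumn_dec szn nj).
have fd1 : flag_data lam al (dec n j) j j' R v w.
  apply: (fd_dec_flag fd jl no_first nj) => j1; exact: (ltnW (far j1)).
have E1 : expands al (dec n j) j R v w by apply: IH fd1 _; rewrite ltn_add2l.
have unfold W : fschur (size lam) al n j W = fschur (size lam) al (dec n j) j W +
    dsum (size lam) (with_row (dec al j) (dec n j) j
      (fun p => g m.+1 * frow A (dec al j) (dec n j) j p * W)).
  apply: fschur_unfold => //; rewrite ?part_dec_eq ?em // => c c0 cj.
  by rewrite !part_dec_neq.
(* Here the entry n_j at [z0] is impossible because of the border cell southeast of it. The
   inequalities force n_j = r_j - 1 and r_(j+1) = r_j + 1, which is the situation of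
   [with_row_eq0]. *)
have [/andP[jj' close]|nclose] :=
    boolP ((j < j')%N && (entry R (border_cell al j.+1) < (part n j)%:Z + 3)).
  have lt1 := r_rep fd jj'; have lt2 := fd_nj fd (ltnW jj').
  have er : entry R (border_cell al j.+1) = entry R (border_cell al j) + 1.
    by move: lt1 lt2 close; clear; lia.
  have ej : entry R (border_cell al j) = m.+2%:Z.
    by move: lt1 lt2 close; rewrite em; clear; lia.
  have nj1 : part n j.+1 = m.+2.
    have := fd_nlow fd (c := j.+1); rewrite /= jj' gtn_eqF // er ej => /(_ isT isT).
    by clear; lia.
  (* The border cell of column j + 1 is not in [w], since it would give the excluded first letter
     r_j + 1. *)
  have wfar z : z \in w -> m.+2%:Z + 4 <= entry R z.
    move=> zw; have ne : z != border_cell al j.+1.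
      apply: contraTneq zw => ->; apply/negP => /(w_head fd) e; apply: no_first.
      by rewrite e er.
    by have := w_letter3 fd zw ne; rewrite er ej; clear; lia.
  have -> : expands al n j R v w <-> expands al (dec n j) j R v w; last exact: E1.
  rewrite /expands unfold mulrDr [X in _ + X](_ : _ = 0) ?addr0; last first.
    apply: with_row_eq0.
    - by rewrite j0 (leq_trans jj') // (fs_j'l fs).
    - by rewrite part_dec_neq ?gtn_eqF // part_dec_eq // prednK // (fs_rep fs).
    - by rewrite part_dec_eq // em.
    - by rewrite part_dec_neq ?gtn_eqF.
    - move=> c cj; have := fd_low_far fd cj (ltnW jj').
      case/andP: cj => c0 cj; rewrite part_dec_neq ?ltn_eqF // ej; clear; lia.
    - by rewrite -ej (v_rj_eq0 A lam_sorted fd).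
    - move=> d; apply: mon_elem_comm => x /mapP[z /wfar + ->]; clear; lia.
  suff -> : rsst_extending lam al n R = rsst_extending lam al (dec n j) R by [].
  apply/fsetP => T; apply/idP/idP => [Text|/(extending_dec_neq n fs rs jl)[] //].
  apply/(extending_dec_neq n fs rs jl); split=> //; apply/eqP => Tz0.
  have [Trs TR Tn] := (in_extendingP n fs rs T).1 Text.
  have b1 : border_cell al j.+1 \in diagram lam `\` diagram al by apply: (fs_border fs).
  have e1 := TR _ b1; have eb : border_cell al j.+1 = ((part al j).+1, j.+1).
    by rewrite /border_cell (fs_rep fs).
  move: close; rewrite eb in b1 e1 *.
  have b2 : ((part al j).+1, j.+1) \in diagram lam := fsubsetP (fsubsetDl _ _) _ b1.
  have := rsst_se Trs (diagram_sub fs (z0_in fs jl)) b2 (ltnSn _) (ltnSn _).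
  by rewrite Tz0 e1; clear; lia.
have H3 : (j < j')%N -> (part n j)%:Z + 3 <= entry R (border_cell al j.+1).
  by move=> jj'; move: nclose; rewrite jj' /= -leNgt.
have wfar (x : int) : x \in letters R w -> m%:Z + 3 < x.
  move=> xw; have [jj' le1] := w_letter fd xw; have := H3 jj'; rewrite em.
  by move: le1; clear; lia.
have Wrow (p : nat) : mon (letters R w) * frow A (dec al j) (dec n j) j p =
    frow A (dec al j) (dec n j) j p * mon (letters R w).
  by rewrite /frow part_dec_eq // em; apply: mon_elem_comm.
have lt' : (sumn (dec al j) + sumn (dec n j) < sumn al + sumn n)%N.
  by rewrite -(sumn_dec sza pos) addSn ltnS leq_add2l ltnW.
have vR : letters R.[(part al j, j) <- (part n j)%:Z] v = letters R v.
  by apply: (step_letters fd jl) => z zv; rewrite mem_cat zv.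
have wR : letters R.[(part al j, j) <- (part n j)%:Z] w = letters R w.
  by apply: (step_letters fd jl) => z zw; rewrite mem_cat zw orbT.
have z0R : entry R.[(part al j, j) <- (part n j)%:Z] (part al j, j) = m.+1%:Z.
  by rewrite entry_set eqxx em.
(* In the first case the new letter stays next to [w], inserted after factor j - 1; in the second
   the factors before j are trivial and the letter goes to [v] with all of [w]. *)
have [/andP[j1 a1]|nja] := boolP ((1 < j)%N && (1 < part al j)%N).
  have fs' := dec_shape_left fs jl j1 a1.
  have Rr := step_rsst lam_sorted fd jl H2 H3.
  have /IH/(_ lt') : flag_data lam (dec al j) (dec n j) j.-1 (maxn j j')
      R.[(part al j, j) <- (part n j)%:Z] v ((part al j, j) :: w).
    apply: (step_data lam_sorted fd jl no_first H2 H3 fs' nj) => //.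
      rewrite prednK // (_ : (maxn j j' - j.-1 = (j' - j).+1)%N) /=; last first.
        by have := fs_jj' fs; move: j0; rewrite maxnE; clear; lia.
      rewrite (step_border_j fd jl) eqxx.
      have -> : [seq border_cell (dec al j) c | c <- iota j.+1 (j' - j)] =
          [seq border_cell al c | c <- iota j.+1 (j' - j)].
        apply/eq_in_map => c; rewrite mem_iota => /andP[jc _].
        by rewrite (step_border fd) ?gtn_eqF // (leq_trans _ jc).
      exact: fd_sub fd.
    by move=> _; rewrite prednK // (step_border_j fd jl) mem_head.
  rewrite /expands unfold mulrDr E1 (sum_extending fs rs jl fs' _ nj Rr) => E2.
  by congr (_ + _); rewrite -E2 with_row_fschur_pred ?j1 // vR /= mon_cons wR z0R.
have ja : j = 1%N \/ part al j = 1%N.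
  move: nja; rewrite negb_and -!leqNgt => /orP[h|h]; [left|right]; apply/eqP.
    by rewrite eqn_leq h j0.
  by rewrite eqn_leq h pos.
have [j2 fs' j2J] := dec_shape_right lam_sorted lam_gt0 fs jl ja.
have Rr := step_rsst lam_sorted fd jl H2 H3.
have /IH/(_ lt') : flag_data lam (dec al j) (dec n j) j2 (maxn j j')
    R.[(part al j, j) <- (part n j)%:Z] (v ++ (part al j, j) :: w) [::].
  apply: (step_data lam_sorted fd jl no_first H2 H3 fs' nj); rewrite ?cats0 //.
    by rewrite sub0seq.
  by rewrite ltnNge j2J.
rewrite /expands unfold mulrDr E1 (sum_extending fs rs jl fs' _ nj Rr) => E2.
congr (_ + _); rewrite -E2.
rewrite (@with_row_fschur_left A (size lam) (dec al j) (dec n j) j j2) //; last first.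
  (* For j > 1 we have alpha_j = 1, so the columns before j are empty, and [pcol_fix] makes the
     diagonal entries e_0 = 1 the only ones that occur there. *)
  move=> s sup; have [ej|nej] := eqVneq j 1%N; first by rewrite ej big_geq.
  have aj : part al j = 1%N by case: ja => // ej; rewrite ej eqxx in nej.
  rewrite big_nat_cond big1 // => c /andP[/andP[c0 cj] _].
  have cl : (0 < c <= size lam)%N by rewrite c0 (leq_trans (ltnW cj)).
  have -> : pcol s c = c.
    apply: (pcol_fix (K := j.-1) _ sup) => //; last by move: cj; clear; lia.
    move=> d /andP[d0 dl]; rewrite prednK //; have [->|ne] := eqVneq d j.
      by rewrite part_dec_eq // aj.
    by rewrite part_dec_neq // (fs_bound lam_sorted fs) // aj.
  rewrite /frow !part_dec_neq ?ltn_eqF // (fs_zero fs) ?c0 ?aj //.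
  by rewrite add0r subrr elem0.
have -> : letters R.[(part al j, j) <- (part n j)%:Z] (v ++ (part al j, j) :: w) =
    letters R v ++ m.+1%:Z :: letters R w by rewrite -vR -wR -z0R /letters map_cat.
by rewrite mon_cat mon_cons mon_nil !mulrA.
Qed.

(** [fd_move] leaves alpha and n unchanged and cannot be an induction step by itself; it is applied
    before [expansion_step], under the same induction hypothesis. *)
Lemma expansion al n j j' R v w : flag_data lam al n j j' R v w ->
  expands al n j R v w.
Proof.
move: {2}(sumn al + sumn n)%N (leqnn (sumn al + sumn n)) => N.
elim/ltn_ind: N al n j j' R v w => N IHN al n j j' R v w leN fd.
have IH al1 n1 j1 j1' R1 v1 w1 : flag_data lam al1 n1 j1 j1' R1 v1 w1 ->
    (sumn al1 + sumn n1 < sumn al + sumn n)%N -> expands al1 n1 j1 R1 v1 w1.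
  move=> fd1 lt; apply: (IHN (sumn al1 + sumn n1)%N) fd1 => //.
  exact: leq_trans lt leN.
have [first|no_first] :=
    eqVneq (ohead (letters R w)) (Some (entry R (border_cell al j) + 1)); last first.
  by apply: expansion_step fd IH _; apply/eqP.
case: w fd first => // b w' fd [eb].
have [fd1 no_first e] := fd_move A lam_sorted fd (erefl _) eb.
rewrite /expands e; exact: expansion_step fd1 IH no_first.
Qed.

End Expansion.

(** * Admissible forms *)

Section Bounds.

Variables (N : nat) (P : pred nat).

Lemma bigmin_le c : (0 < c < N)%N -> P c ->
  (\big[minn/N]_(1 <= i < N | P i) i <= c)%N.
Proof.
move=> cN Pc; have : c \in index_iota 1 N by rewrite mem_index_iota.
elim: (index_iota 1 N) => // i s IHs; rewrite inE big_cons => /orP[/eqP <-|cs].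
  by rewrite Pc geq_minl.
by case: (P i); rewrite ?IHs // (leq_trans (geq_minr _ _)) ?IHs.
Qed.

Lemma bigmin_attained (x := \big[minn/N]_(1 <= i < N | P i) i) :
  x = N \/ (0 < x < N)%N /\ P x.
Proof.
rewrite /x big_nat_cond; apply: (big_ind (fun x => x = N \/ (0 < x < N)%N /\ P x)).
- by left.
- by move=> y z Ky Kz; rewrite /minn; case: ifP.
- by move=> i /andP[iN Pi]; right.
Qed.

Lemma bigmax_ge c : (0 < c < N)%N -> P c -> (c <= \max_(1 <= i < N | P i) i)%N.
Proof.
move=> cN Pc; have : c \in index_iota 1 N by rewrite mem_index_iota.
elim: (index_iota 1 N) => // i s IHs; rewrite inE big_cons => /orP[/eqP <-|cs].
  by rewrite Pc leq_maxl.
by case: (P i); rewrite ?IHs // (leq_trans _ (leq_maxr _ _)) ?IHs.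
Qed.

Lemma bigmax_attained (x := \max_(1 <= i < N | P i) i) :
  x = 0%N \/ (0 < x < N)%N /\ P x.
Proof.
rewrite /x big_nat_cond; apply: (big_ind (fun x => x = 0%N \/ (0 < x < N)%N /\ P x)).
- by left.
- by move=> y z Ky Kz; rewrite /maxn; case: ifP.
- by move=> i /andP[iN Pi]; right.
Qed.

End Bounds.

Lemma nth_form1 (k b m m' i : nat) : (i < k + m.+1 + m'.+1)%N ->
  nth 0%N (nseq k 0%N ++ iota b m.+1 ++ iota (b + m) m'.+1) i =
  (if i < k then 0 else if i < k + m.+1 then b + (i - k) else b + m + (i - (k + m.+1)))%N.
Proof.
move=> isz; rewrite nth_cat size_nseq nth_nseq.
case: (ltnP i k) => [ik|ki]; first by [].
rewrite nth_cat size_iota; case: (ltnP i (k + m.+1)) => [lt|ge].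
  have lt' : (i - k < m.+1)%N by move: ki lt; clear; lia.
  by rewrite lt' nth_iota.
rewrite ifF; last by apply/negbTE; rewrite -leqNgt; move: ge; clear; lia.
by rewrite nth_iota; move: ki ge isz; clear; lia.
Qed.

Lemma nth_form2 (k b m i : nat) : (i < k + m)%N ->
  nth 0%N (nseq k 0%N ++ iota b m) i = (if i < k then 0 else b + (i - k))%N.
Proof.
move=> isz; rewrite nth_cat size_nseq nth_nseq.
case: (ltnP i k) => [ik|ki]; first by [].
by rewrite nth_iota //; move: ki isz; clear; lia.
Qed.

(** For [fs_low]: by the minimality of j, a positive part before j is followed by a larger one, and
    by the two forms and the bound at j' a part exceeds the preceding one by at most 1. A zero part
    is followed by 0 or 1, which the truncated predecessor covers. *)
Lemma admissible_flag_shape (lam al : seq nat) :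
  size al = size lam -> is_partition lam -> restricted_difference lam al ->
  admissible_form lam al -> flag_shape lam al (jmin al) (jmax lam al).
Proof.
move=> sz /andP[lam_sorted _] [j'' [j''l _ lt_low eq_high]] [_ top form].
set j := jmin al in form *; set j' := jmax lam al in top form *.
have jmin_le c : (0 < c <= size al)%N -> (0 < part al c)%N ->
    (part al c.+1 <= part al c)%N -> (j <= c)%N.
  by move=> cl pc dc; apply: bigmin_le; rewrite ?ltnS // pc.
have jminP : j = (size al).+1 \/ (0 < j < (size al).+1)%N /\
    ((0 < part al j)%N && (part al j.+1 <= part al j)%N).
  exact: (@bigmin_attained _ (fun i => (0 < part al i)%N && (part al i.+1 <= part al i)%N)).
have jmax_ge c : (0 < c <= size al)%N -> (part al c < part lam c)%N -> (c <= j')%N.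
  by move=> cl pc; apply: (@bigmax_ge _ (fun i => part al i < part lam i)%N).
have jmaxP : j' = 0%N \/ (0 < j' < (size al).+1)%N /\ (part al j' < part lam j')%N.
  exact: (@bigmax_attained _ (fun i => part al i < part lam i)%N).
have j'l : (j' <= size lam)%N by case: jmaxP => [->//|[/andP[_ +] _]]; rewrite ltnS sz.
have j0 : (0 < j)%N by case: jminP => [->//|[/andP[]]].
have j'j'' : (j' <= j'')%N.
  case: jmaxP => [->//|[/andP[j'0 j's] lt]]; rewrite leqNgt; apply/negP => gt.
  by move: lt; rewrite eq_high ?ltnn // gt j'l.
have jj' : (j <= j'.+1)%N.
  case: form => [[k [b [m [m' [_ _ _ lt _]]]]]|[k [b [m [_ _ _ [e|e]]]]]].
  - by rewrite ltnW // ltnW.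
  - by rewrite /j e leqnSn.
  - by rewrite /j e.
have nth_part c : (0 < c <= j')%N -> part al c = nth 0%N (take j' al) c.-1.
  by case/andP=> c0 cj; rewrite nth_take // prednK.
have szt : size (take j' al) = j' by rewrite size_takel // sz.
have step c : (0 < c < j')%N -> (part al c.+1 <= (part al c).+1)%N.
  case/andP=> c0 cj; rewrite !nth_part ?c0 ?(ltnW cj) //=.
  have ci : (c.-1.+1 < size (take j' al))%N by rewrite prednK // szt.
  have ec : nth 0%N (take j' al) c = nth 0%N (take j' al) c.-1.+1 by rewrite prednK.
  rewrite ec; move: ci; case: form => [[k [b [m [m' [b0 kb -> _ _]]]]]|[k [b [m [b0 kb -> _]]]]].
    rewrite !size_cat size_nseq !size_iota addnA; move: (c.-1) => i ci.
    rewrite !nth_form1 //; last exact: ltnW.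
    case: (ltnP i k) => ik; last first.
      rewrite ifF; last by apply/negbTE; rewrite -leqNgt (leq_trans ik).
      by case: (ltnP i.+1) => h1; case: (ltnP i) => h2; move: ik h1 h2; clear; lia.
    have k0 : (0 < k)%N by apply: leq_trans ik.
    by rewrite (kb k0); case: ltnP => // h1; case: ltnP => h2; move: ik h1 h2; clear; lia.
  rewrite size_cat size_nseq size_iota; move: (c.-1) => i ci.
  rewrite !nth_form2 //; last exact: ltnW.
  case: (ltnP i k) => ik; last first.
    by rewrite ifF; [move: ik; clear; lia|apply/negbTE; rewrite -leqNgt (leq_trans ik)].
  have k0 : (0 < k)%N by apply: leq_trans ik.
  by rewrite (kb k0); case: ltnP => // h1; move: ik h1; clear; lia.
(* Only the first form has j < j', and there j = k + m + 1 is the position of the first a = b +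
   m. *)
have high : (j < j')%N -> part al j.+1 = part al j /\
    forall c, (j < c < j')%N -> part al c.+1 = (part al c).+1.
  move=> lt.
  case: form => [[k [b [m [m' [b0 kb et _ ej]]]]]|[k [b [m [_ _ _ [e|e]]]]]]; last 2 first.
  - by rewrite /j e ltnn in lt.
  - by rewrite /j e ltnNge leqnSn in lt.
  have ej1 : j = (k + m).+1 := ej.
  have szf : j' = (k + m.+1 + m'.+1)%N by rewrite -szt et !size_cat size_nseq !size_iota addnA.
  have al_nth c : (0 < c <= j')%N -> part al c =
      (if c.-1 < k then 0 else if c.-1 < k + m.+1 then b + (c.-1 - k)
       else b + m + (c.-1 - (k + m.+1)))%N.
    move=> cj; rewrite nth_part // et nth_form1 // -szf.
    by case/andP: cj => c0 cj; rewrite prednK.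
  split=> [|c /andP[jc cj]].
    rewrite !al_nth ?j0 ?(ltnW lt) //= ej1 /=.
    do 3 ![rewrite ifF; last by apply/negbTE; rewrite -leqNgt; clear; lia].
    rewrite ifT; last by clear; lia.
    by clear; lia.
  have c0 : (0 < c)%N by apply: leq_trans jc.
  rewrite !al_nth ?c0 ?(ltnW cj) //=; rewrite ej1 in jc.
  do 4 ![rewrite ifF; last by apply/negbTE; rewrite -leqNgt; move: jc; clear; lia].
  by move: jc; clear; lia.
split=> //.
- move=> c /andP[c0 cj]; have cl : (c <= size al)%N.
    case: jminP => [ej|[/andP[_ h] _]]; first by move: cj; rewrite ej.
    by move: h; rewrite ltnS => /(leq_trans (ltnW cj)).
  have := jmin_le c; rewrite c0 cl => h.
  have top' : (part al c.+1 <= (part al c).+1)%N.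
    have [cj'|j'c] := ltnP c j'; first by rewrite step ?c0.
    have ec : c = j' by apply/eqP; rewrite eqn_leq j'c -ltnS (leq_trans cj).
    by rewrite ec top // -ec.
  have [pc|pc] := posnP (part al c); first by move: top'; rewrite pc; clear; lia.
  have : ~~ (part al c.+1 <= part al c)%N by apply/negP => /(h isT pc); rewrite leqNgt cj.
  by move: top'; clear; lia.
- by move=> /high[].
- by move=> c /andP[jc cj]; have [_] := high (ltn_trans jc cj); apply; rewrite jc.
- move=> c j'c; have c0 : (0 < c)%N by apply: leq_ltn_trans j'c.
  have [cl|lc] := leqP c (size lam); last by rewrite !part_default ?sz.
  have [cj|jc] := leqP c j''; last by rewrite eq_high // jc.
  have := jmax_ge c; rewrite c0 sz cl lt_low ?c0 // => /(_ isT isT).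
  by rewrite leqNgt j'c.
- by move=> c /andP[c0 cj]; rewrite lt_low // c0 (leq_trans cj).
- case: jminP => [ej|[_ /andP[]//]].
  by rewrite part_default // ej ltnW.
- by rewrite -sz; case: jminP => [->|[_ /andP[]//]]; rewrite ltnn.
Qed.

(** * Passage to the quotient *)

Section PowersetSums.

Variables (T : choiceType) (V : nmodType).

Lemma big_fpowerset1U (F : {fset T} -> V) (x : T) (S : {fset T}) : x \notin S ->
  \sum_(B <- fpowerset (x |` S)) F B =
  \sum_(B <- fpowerset S) F B + \sum_(B <- fpowerset S) F (x |` B).
Proof.
move=> xS; rewrite -(big_map (fun B => x |` B) predT F) -big_cat.
have xB B : B `<=` S -> x \notin B by move/fsubsetP => BS; apply: contra xS; apply: BS.
apply: perm_big; apply: uniq_perm => [||B]; first exact: fset_uniq.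
  rewrite cat_uniq fset_uniq map_inj_in_uniq ?fset_uniq ?andbT /=.
    apply/hasPn => _ /mapP[B _ ->]; apply/negP; rewrite fpowersetE => /xB.
    by rewrite fset1U1.
  move=> B C; rewrite !fpowersetE => /xB xnB /xB xnC e.
  by rewrite -(fsetU1K xnB) e fsetU1K.
rewrite mem_cat !fpowersetE; apply/idP/orP => [BS|[BS|/mapP[C]]].
- have [xinB|xnB] := boolP (x \in B); last first.
    left; apply/fsubsetP => y yB; have := fsubsetP BS y yB.
    by rewrite in_fset1U => /predU1P[ey|//]; rewrite ey (negPf xnB) in yB.
  right; apply/mapP; exists (B `\ x); last by rewrite fsetD1K.
  rewrite fpowersetE; apply/fsubsetP => y; rewrite in_fsetD1 => /andP[yx yB].
  by have := fsubsetP BS y yB; rewrite in_fset1U (negPf yx).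
- exact: fsubset_trans BS (fsubsetU1 _ _).
- by rewrite fpowersetE => CS ->; apply: fsetUS.
Qed.

End PowersetSums.

Lemma intervalS m : Defs.interval m.+1 = m.+1%:Z |` Defs.interval m.
Proof.
by apply/fsetP => x; rewrite in_fset1U !in_interval; apply/idP/orP; lia.
Qed.

Lemma interval_notin m : m.+1%:Z \notin Defs.interval m.
Proof. by rewrite in_interval; lia. Qed.

Lemma sort_geq_fsetU1 (x : int) (B : {fset int}) :
  (forall y, y \in B -> y < x) ->
  sort (fun y z : int => z <= y) (x |` B) = x :: sort (fun y z : int => z <= y) B.
Proof.
move=> Bx; pose r := fun y z : int => z <= y.
have r_trans : transitive r by move=> y z t h1 h2; apply: le_trans h2 h1.
have r_anti : antisymmetric r by move=> y z /andP[h1 h2]; apply: le_anti; apply/andP.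
have r_total : total r by move=> y z; exact: le_total.
have xB : x \notin B by apply/negP => /Bx; rewrite ltxx.
apply: (sorted_eq r_trans r_anti); first exact: sort_sorted.
  rewrite /= path_sortedE // sort_sorted // andbT; apply/allP => y.
  by rewrite mem_sort => /Bx /ltW.
rewrite perm_sort perm_sym (perm_trans (y := x :: B)) //.
  by rewrite perm_cons perm_sort.
apply: uniq_perm; rewrite /= ?xB ?fset_uniq // => y.
by rewrite inE in_fset1U.
Qed.

Section Specialization.

Variables (A : lam3_algebra) (f : {rmorphism U -> A}).
Hypothesis f_u : forall i, f (u i) = gen i.

Lemma image_word s : f (word s) = mon s.
Proof.
elim: s => [|i s IHs]; first by rewrite word_nil mon_nil rmorph1.
by rewrite -[i :: s]cat1s word_cat mon_cat mon1 rmorphM IHs -f_u.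
Qed.

(** Subsets of [m + 1] are split according to whether they contain m + 1, whose letter then comes
    first in the decreasing word. *)
Lemma image_e m d : f (e d (Defs.interval m)) = elem m d.
Proof.
rewrite /e rmorph_sum /=; under eq_bigr do rewrite image_word.
elim: m d => [|m IHm] d.
  have -> : Defs.interval 0 = fset0 by apply/fsetP => x; rewrite in_interval in_fset0; lia.
  rewrite fpowerset0 big_mkcond big_seq_fset1 cardfs0 eq_sym /=.
  by case: eqP => // _; rewrite [sort _ _]size0nil ?mon_nil // size_sort cardfs0.
rewrite elemS -!IHm big_mkcond intervalS big_fpowerset1U ?interval_notin //=.
rewrite -big_mkcond; congr (_ + _); rewrite mulr_sumr [RHS]big_mkcond /=.
apply: eq_big_seq => B; rewrite fpowersetE => /fsubsetP BS.
have xB : m.+1%:Z \notin B by apply: contra (interval_notin m); apply: BS.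
rewrite cardfsU1 xB sort_geq_fsetU1 ?mon_cons; last first.
  by move=> y /BS; rewrite in_interval; lia.
by rewrite (_ : ((1 + #|` B|)%N%:Z == d) = (#|` B|%:Z == d - 1)) //; apply/eqP/eqP; lia.
Qed.

(** For j > l, [J] puts the word after all factors, whereas no factor of [fschur] carries it; hence
    the condition on [w]. The factors of [J] are numbered from 0, those of [fschur] from 1. *)
Lemma image_J l (al n : l.-tuple nat) (j : nat) (w : seq int) :
  (0 < j)%N -> (j <= l)%N \/ w = [::] ->
  f (J al n j w) = fschur l al n j (mon w).
Proof.
move=> j0 jlw; rewrite /J rmorph_sum; apply: eq_bigr => s _.
rewrite rmorphMsign; congr (_ * _).
pose F (i : nat) : A := frow A al n i.+1 (pcol s i.+1).
have fF (i : 'I_l) : f (e ((tnth al i)%:Z + (s i)%:Z - i%:Z) (Defs.interval (tnth n i))) = F i.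
  rewrite image_e /F /frow !(tnth_nth 0%N) pcolE.
  by congr elem; rewrite /part /=; lia.
rewrite !rmorphM !rmorph_prod image_word /=.
under eq_bigr do rewrite fF; under [X in _ * X]eq_bigr do rewrite fF.
have -> : \prod_(i < l | (j <= i)%N) F i = \prod_(j <= i < l) F i.
  by rewrite big_geq_mkord.
rewrite [in RHS]big_add1 /=.
have [jl|lj] := leqP j l.
  rewrite -(big_ord_widen _ F jl) -(big_mkord xpredT F).
  rewrite [in RHS](@big_cat_nat _ _ _ j) //=; congr (_ * _); last first.
    by apply: eq_big_nat => i /andP[ji _]; rewrite /faug gtn_eqF ?mulr1.
  have [k ek] : exists k, j = k.+1 by exists j.-1; rewrite prednK.
  rewrite ek !big_nat_recr //= {2}/faug eqxx mulrA; congr (_ * _ * _).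
  by apply: eq_big_nat => i /andP[_ ik]; rewrite /faug ltn_eqF ?mulr1.
have w0 : w = [::] by case: jlw => //; rewrite leqNgt lj.
rewrite w0 mon_nil mulr1 [X in _ * X]big_geq ?mulr1; last exact: ltnW.
rewrite -(big_mkord (fun i => (i < j)%N) F) big_mkcond.
apply: eq_big_nat => i /andP[_ il]; rewrite (ltn_trans il lj) /faug.
by rewrite if_same mulr1.
Qed.

End Specialization.

Lemma quotient_algebra :
  exists (A : lam3_algebra) (f : {rmorphism U -> A}),
    (forall i, f (u i) = gen i) /\ forall x y, f x = f y <-> eq_lam3 x y.
Proof.
have [A [f [f_surj fP]]] := lam3_quotient_exists.
have fM x y : f x * f y = f (x * y) by rewrite rmorphM.
have f0 x : lam3_rel x -> f x = 0.
  move=> rx; rewrite -(rmorph0 f); apply/fP; rewrite /eq_lam3 subr0.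
  exact: ideal_gen.
have central a x : f (a *: 1) * x = x * f (a *: 1).
  by have [y ->] := f_surj x; rewrite !fM scale1_central.
have feq x y : lam3_rel (x - y) -> f x = f y by move=> rxy; apply/fP; apply: ideal_gen.
have cK : f (q *: 1) * f (qV *: 1) = 1.
  by rewrite fM -scalerAl mul1r scalerA q_qV scale1r rmorph1.
have sq i : f (u i) * f (u i) = 0 by rewrite fM; apply: f0; apply: lam3_sq.
have hlh i : f (u (i + 3)) * f (u i) * f (u (i + 3)) = 0.
  by rewrite fM fM; apply: f0; apply: lam3_hlh.
have lhl i : f (u i) * f (u (i + 3)) * f (u i) = 0.
  by rewrite fM fM; apply: f0; apply: lam3_lhl.
have far (i k : int) : 3 < `|i - k| -> f (u i) * f (u k) = f (u k) * f (u i).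
  move=> ik.
  exact: (etrans (fM _ _) (etrans (feq _ _ (lam3_far ik)) (esym (fM _ _)))).
have near (i k : int) : 0 < k - i < 3 ->
    f (u i) * f (u k) = f (qV *: 1) * (f (u k) * f (u i)).
  move=> ik; have e : (qV *: 1) * (u k * u i) = qV *: (u k * u i).
    by rewrite -scalerAl mul1r.
  have e' := congr1 (fun z => f (qV *: 1) * z) (esym (fM (u k) (u i))).
  have e'' := etrans (congr1 f (esym e)) (etrans (esym (fM _ _)) e').
  exact: (etrans (fM _ _) (etrans (feq _ _ (lam3_near ik)) e'')).
pose A' := @Lam3Algebra A (fun i => f (u i)) _ _ cK (central q) (central qV) sq hlh lhl far near.
by exists A', f.
Qed.

Theorem theorem4p8 (l : nat) (lam al n : l.-tuple nat) (R : tableau)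
    (v w : seq cell)
    (lam_part : is_partition lam)
    (lam_al : restricted_difference lam al) :
  let j := jmin al in
  let j' := jmax lam al in
  let r c := entry R (border_cell al c) in
  admissible_form lam al ->
  is_rsst (diagram lam `\` diagram al) R ->
  reading_word R (v ++ w) ->
  square_respecting R (v ++ w) ->
  subseq w [seq border_cell al c | c <- iota j.+1 (j' - j)] ->
  ((j < j')%N -> r j + 1 < r j.+1 -> border_cell al j.+1 \in w) ->
  sorted leq n ->
  (forall c, (0 < c <= j')%N ->
    (part n c)%:Z = r c - 1 \/
    [/\ c = j, ohead (letters R w) <> Some (r j + 1)
      & (part n c)%:Z < r c - 1]) ->
  eq_lam3 (word (letters R v) * J al n j (letters R w))
          (\sum_(T <- rsst_extending lam al n R) word (sqread T)).
Proof.
move=> j j' r form rsst reading square sub first n_sorted n_r.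
have [A [f [f_u fP]]] := quotient_algebra.
have [lam_sorted /(all_nthP 0%N) lam_pos] := andP lam_part.
have lam_gt0 c : (0 < c <= size lam)%N -> (0 < part lam c)%N.
  by case/andP=> c0 cl; apply: lam_pos; rewrite prednK.
have sizes : size al = size lam by rewrite !size_tuple.
have shape := admissible_flag_shape sizes lam_part lam_al form.
have size_n : size n = size lam by rewrite !size_tuple.
have data := FlagData shape rsst reading square sub first size_n n_sorted n_r.
(* The value j = l + 1 occurs, but then j' <= l < j and [w] is empty. *)
have jl : (j <= l)%N \/ letters R w = [::].
  have [|lj] := leqP j l; [by left | right].
  have j'l : (j' <= l)%N by rewrite -(size_tuple lam); exact: fs_j'l shape.
  have e : (j' - j)%N = 0%N by apply/eqP; rewrite subn_eq0 (leq_trans j'l) // ltnW.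
  by move: sub; rewrite e subseq0 => /eqP ->.
have j0 : (0 < j)%N := fs_j0 shape.
apply/fP; rewrite rmorphM (image_word f_u) (image_J f_u al n j0 jl) rmorph_sum.
under [RHS]eq_bigr do rewrite (image_word f_u).
have := expansion A lam_sorted lam_gt0 data.
by rewrite /expands size_tuple.
Qed.
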